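(* Let $n\ge2$ and $N\ge1$ be integers and $\rho>0$. Suppose that the non-negative integers $\nu_1,\dots,\nu_{n-1}$ satisfy $N=\nu_0\ge\nu_1\ge\cdots\ge\nu_{n-1}\ge\nu_n=0$ and $$\nu_{j-1}+\nu_{j+1}\ge 2\nu_j\qquad\text{for all } j=1,\dots,n-1.$$ Then for $w\in\mathcal F^{(\rho)}_{\nu_1,\dots,\nu_{n-1}}$ and $W\in\mathcal W_{\nu_1,\dots,\nu_{n-1}}$ the integral $$I(w,W)(\beta_1,\dots,\beta_N)=\Bigl(\prod_{j=1}^{n-1}\prod_{m=1}^{\nu_j}\int_{C_j}d\gamma_{j,m}\Bigr)\prod_{j=1}^{n-1}\prod_{m=1}^{\nu_j}\prod_{m'=1}^{\nu_{j-1}}\varphi(\gamma_{j,m}-\gamma_{j-1,m'})\;w(\{\gamma_{j,m}\})\,W(\{\gamma_{j,m}\})$$ is absolutely convergent.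
   Context: Here $i=\sqrt{-1}$ and $\mathrm{sh}$ denotes the hyperbolic sine. **Index sets and variables.** For $J=(j_1,\dots,j_N)\in(\mathbb Z_{\ge0})^N$ put $\mathcal N_j=\mathcal N_j(J)=\{r: j_r\ge j\}$. $\mathcal Z_{\nu_1,\dots,\nu_{n-1}}$ is the set of $J$ with $\#\mathcal N_j=\nu_j$ for $j=0,1,\dots,n$ (so $0\le j_r\le n-1$). Write $\mathcal N_j=\{r_{j,1}<\cdots<r_{j,\nu_j}\}$ (so $r_{0,m}=m$). The variables are $\gamma_{j,m}$ ($0\le j\le n-1$, $1\le m\le\nu_j$) with $\gamma_{0,m}=\beta_m$; put $\alpha^J_{j,r_{j,m}}=\gamma_{j,m}$. For $1\le j\le n-1$, $\mathrm{Skew}_j$ is skew-symmetrization in $\gamma_{j,1},\dots,\gamma_{j,\nu_j}$: $\mathrm{Skew}_jX(\gamma_{j,1},\dots,\gamma_{j,\nu_j})=\sum_{\sigma\in S_{\nu_j}}\mathrm{sgn}(\sigma)X(\gamma_{j,\sigma(1)},\dots,\gamma_{j,\sigma(\nu_j)})$. **Space $\mathcal F$.** $\mathcal F^{(\rho)}_{\nu_1,\dots,\nu_{n-1}}=\sum_{J\in\mathcal Z_{\nu_1,\dots,\nu_{n-1}}}\mathbb C\,w_J$, with $w_J=\mathrm{Skew}_{n-1}\circ\cdots\circ\mathrm{Skew}_1\, g_J$ and $$\begin{aligned} g_J=\prod_{j=1}^{n-1}\Bigl\{&\prod_{r\in\mathcal N_j}e^{\frac{\pi}{\rho}(\alpha^J_{j-1,r}-\alpha^J_{j,r})}\prod_{m=1}^{\nu_j}\Bigl[\prod_{m':\,r_{j-1,m'}<r_{j,m}}\mathrm{sh}\tfrac{\pi}{\rho}(\gamma_{j,m}-\gamma_{j-1,m'}+\tfrac{\pi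 i}{n})\\ &\times\prod_{m':\,r_{j,m}<r_{j-1,m'}}\mathrm{sh}\tfrac{\pi}{\rho}(\gamma_{j,m}-\gamma_{j-1,m'}-\tfrac{\pi i}{n})\Bigr]\prod_{1\le m<m'\le\nu_j}\mathrm{sh}\tfrac{\pi}{\rho}(\gamma_{j,m'}-\gamma_{j,m}-\tfrac{2\pi i}{n})\Bigr\}.\end{aligned}$$ **Space $\mathcal W$.** $\mathcal W_{\nu_1,\dots,\nu_{n-1}}=\sum_{J\in\mathcal Z_{\nu_1,\dots,\nu_{n-1}}}\mathbb C\,W_J$, with $W_J=\mathrm{Skew}_{n-1}\circ\cdots\circ\mathrm{Skew}_1\,G_J$ and $$\begin{aligned} G_J=\prod_{j=1}^{n-1}\Bigl\{&\prod_{r\in\mathcal N_j}e^{\frac n4(\alpha^J_{j-1,r}-\alpha^J_{j,r})}\prod_{m=1}^{\nu_j}\Bigl[\prod_{m':\,r_{j-1,m'}<r_{j,m}}\mathrm{sh}\tfrac n4(\gamma_{j,m}-\gamma_{j-1,m'}+\tfrac{\pi i}{n})\\ &\times\prod_{m':\,r_{j,m}<r_{j-1,m'}}\mathrm{sh}\tfrac n4(\gamma_{j,m}-\gamma_{j-1,m'}-\tfrac{\pi i}{n})\Bigr]\Bigr\}.\end{aligned}$$ **Kernel and contours.** $$\varphi(\beta)=\frac{1}{S_2(i\beta-\frac{\pi}{n}|\rho,\frac{4\pi}{n})\,S_2(-i\beta-\frac{\pi}{n}|\rho,\frac{4\pi}{n})},$$ where $S_2(x|\omega_1,\omega_2)=\Gamma_2(\omega_1+\omega_2-x|\omega_1,\omega_2)/\Gamma_2(x|\omega_1,\omega_2)$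 is the double sine function ($\Gamma_2$ is Barnes' double gamma function); it is symmetric in $\omega_1,\omega_2$, satisfies $S_2(x+\omega_1)/S_2(x)=1/(2\sin\frac{\pi x}{\omega_2})$, and vanishes at $x\in-\omega_1\mathbb Z_{\ge0}-\omega_2\mathbb Z_{\ge0}$. The contour $C_j$ for $\gamma_{j,m}$ is the real line $(-\infty,\infty)$, deformed so that the poles of the integrand at $\gamma_{j\pm1,m'}+\frac{\pi i}{n}-\rho i\mathbb Z_{\ge0}-\frac{4\pi i}{n}\mathbb Z_{\ge0}$ are below $C_j$ and the poles at $\gamma_{j\pm1,m'}-\frac{\pi i}{n}+\rho i\mathbb Z_{\ge0}+\frac{4\pi i}{n}\mathbb Z_{\ge0}$ are above $C_j$.
   Formalization: If ν_1≥2 and ν_2≥1, no contour meets the prescription for the whole integrand (poles to be above and below C_2 collide). There convergence is shown for each term of the expansion of wW, on contours separating that term's poles; contours are uniformly away from poles and near the real line. *)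

(* Defs.v *)
(* MathComp-Analysis; complex numbers are R[i] over R : realType. *)
From HB Require Import structures.
From mathcomp Require Import all_boot all_order all_algebra all_fingroup.
From mathcomp Require Import all_classical all_reals all_analysis.
From mathcomp Require Import complex.

Set Implicit Arguments.
Unset Strict Implicit.
Unset Printing Implicit Defensive.

Import Order.TTheory GRing.Theory Num.Theory.
Import numFieldNormedType.Exports.

Local Open Scope classical_set_scope.
Local Open Scope ring_scope.

Definition ofR (R : realType) (x : R) : R[i] := Complex x 0.
Definition iR (R : realType) (x : R) : R[i] := Complex 0 x.
Definition cabs (R : realType) (z : R[i]) : R :=
  Num.sqrt (complex.Re z ^+ 2 + complex.Im z ^+ 2).

Definition cexp (R : realType) (z : R[i]) : R[i] :=
  ofR (expR (complex.Re z)) * Complex (cos (complex.Im z)) (sin (complex.Im z)).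
Definition sh (R : realType) (z : R[i]) : R[i] := (cexp z - cexp (- z)) / 2%:R.

Definition cintegral (R : realType) (D : set R) (f : R -> R[i]) : R[i] :=
  Complex (\int[lebesgue_measure]_(t in D) complex.Re (f t))
          (\int[lebesgue_measure]_(t in D) complex.Im (f t)).

(** * Barnes' double gamma function and the double sine function

  Gamma_2(x | w1, w2) = exp (d/ds zeta_2(s, x | w1, w2) at s = 0), where
  zeta_2(s, x) continues \sum_(k, l >= 0) (x + k w1 + l w2)^(-s).  Subtracting
  the polar part of the Mellin transform gives, for Re x > 0, the classical
  convergent integral (Barnes, Friedman-Ruijsenaars)
    log Gamma_2(x) = \int_0^oo (e^(-xt) / ((1 - e^(-w1 t)) (1 - e^(-w2 t)))
        - B_20 / t^2 + B_21(x) / t - B_22(x) e^(-t) / 2) dt / t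
  with the double Bernoulli polynomials B_2n.  For arbitrary x the finitely many
  terms (k, l) with k, l < K are taken out of the zeta sum and restored as
  factors, using \int_0^oo (e^(-at) - e^(-t)) dt / t = - log a; K is chosen so
  large that Re (x + k w1 + l w2) > 0 for all the other ones, and the value does
  not depend on it.  At the poles of Gamma_2, and so also at the zeros and the
  poles of S_2, division by 0 yields the value 0. *)

Definition bern20 (R : realType) (w1 w2 : R) : R[i] := ofR (w1 * w2)^-1.
Definition bern21 (R : realType) (w1 w2 : R) (x : R[i]) : R[i] :=
  x / ofR (w1 * w2) - ofR ((w1 + w2) / (2 * (w1 * w2))).
Definition bern22 (R : realType) (w1 w2 : R) (x : R[i]) : R[i] :=
  x ^+ 2 / ofR (w1 * w2) - ofR ((w1 + w2) / (w1 * w2)) * x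
  + ofR ((w1 ^+ 2 + w2 ^+ 2 + 3 * (w1 * w2)) / (6 * (w1 * w2))).

Definition lattice (R : realType) (w1 w2 : R) (k l : nat) : R :=
  k%:R * w1 + l%:R * w2.

Definition gamma2_cutoff (R : realType) (w1 w2 : R) (x : R[i]) : nat :=
  (Num.truncn (cabs x / w1 + cabs x / w2)).+1.

Definition gamma2_integrand (R : realType) (w1 w2 : R) (x : R[i]) (t : R)
    : R[i] :=
  let K := gamma2_cutoff w1 w2 x in
  (cexp (- (x * ofR t))
     * ofR (((1 - expR (- (w1 * t))) * (1 - expR (- (w2 * t))))^-1
            - \sum_(k < K) \sum_(l < K) expR (- (lattice w1 w2 k l * t)))
   - bern20 w1 w2 / ofR (t ^+ 2) + bern21 w1 w2 x / ofR t
   - (bern22 w1 w2 x / 2%:R - (K ^ 2)%:R) * ofR (expR (- t))) / ofR t.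

Definition Gamma2 (R : realType) (w1 w2 : R) (x : R[i]) : R[i] :=
  let K := gamma2_cutoff w1 w2 x in
  cexp (cintegral `]0, +oo[ (gamma2_integrand w1 w2 x))
  / \prod_(k < K) \prod_(l < K) (x + ofR (lattice w1 w2 k l)).

Definition S2 (R : realType) (w1 w2 : R) (x : R[i]) : R[i] :=
  Gamma2 w1 w2 (ofR (w1 + w2) - x) / Gamma2 w1 w2 x.

Definition phi (R : realType) (n : nat) (rho : R) (b : R[i]) : R[i] :=
  let S := S2 rho (4 * pi / n%:R) in
  (S (iR 1 * b - ofR (pi / n%:R)) * S (- (iR 1 * b) - ofR (pi / n%:R)))^-1.

(** * The spaces F and W

  A point is g : nat -> nat -> R[i], where g j m is gamma_(j,m+1) (so that g 0 m
  is beta_(m+1)); only 0 <= j < n and m < nu j are ever used. *)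

Definition gammas (R : realType) : Type := nat -> nat -> R[i].

(* The elements of N_j(J) in increasing order; its entry of rank m is
   r_(j,m+1). *)
Definition rows (N n : nat) (J : {ffun 'I_N -> 'I_n}) (j : nat) : seq nat :=
  [seq val r | r <- enum 'I_N & (j <= J r)%N].
Definition row_of (N n : nat) (J : {ffun 'I_N -> 'I_n}) (j m : nat) : nat :=
  nth N (rows J j) m.

Definition inZ (N n : nat) (nu : nat -> nat) (J : {ffun 'I_N -> 'I_n}) : bool :=
  [forall j : 'I_n.+1, #|[set r : 'I_N | (j <= J r)%N]%SET| == nu j].

Definition alpha (R : realType) (N n : nat) (J : {ffun 'I_N -> 'I_n})
    (g : gammas R) (j r : nat) : R[i] :=
  g j (index r (rows J j)).

(* The factors of level j shared by g_J (a = pi / rho) and G_J (a = n / 4). *)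
Definition level_factor (R : realType) (N n : nat) (nu : nat -> nat) (a : R)
    (J : {ffun 'I_N -> 'I_n}) (g : gammas R) (j : nat) : R[i] :=
  (\prod_(r <- rows J j) cexp (ofR a * (alpha J g j.-1 r - alpha J g j r)))
  * \prod_(m < nu j)
      ((\prod_(m' < nu j.-1 | (row_of J j.-1 m' < row_of J j m)%N)
          sh (ofR a * (g j m - g j.-1 m' + iR (pi / n%:R))))
       * (\prod_(m' < nu j.-1 | (row_of J j m < row_of J j.-1 m')%N)
          sh (ofR a * (g j m - g j.-1 m' - iR (pi / n%:R))))).

Definition g_small (R : realType) (N n : nat) (nu : nat -> nat) (rho : R)
    (J : {ffun 'I_N -> 'I_n}) (g : gammas R) : R[i] :=
  \prod_(1 <= j < n)
    (level_factor nu (pi / rho) J g j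
     * \prod_(m < nu j) \prod_(m' < nu j | (m < m')%N)
         sh (ofR (pi / rho) * (g j m' - g j m - iR (2 * pi / n%:R)))).

Definition G_big (R : realType) (N n : nat) (nu : nat -> nat)
    (J : {ffun 'I_N -> 'I_n}) (g : gammas R) : R[i] :=
  \prod_(1 <= j < n) level_factor nu (n%:R / 4) J g j.

Definition perm_nat (k : nat) (s : 'S_k) (m : nat) : nat :=
  if insub m is Some i then val (s i) else m.

Definition permute_level (R : realType) (k j : nat) (s : 'S_k) (g : gammas R)
    : gammas R :=
  fun j' m => if j' == j then g j (perm_nat s m) else g j' m.

Definition Skew (R : realType) (nu : nat -> nat) (j : nat)
    (X : gammas R -> R[i]) : gammas R -> R[i] :=
  fun g => \sum_(s : 'S_(nu j)) (-1) ^+ s * X (permute_level j s g).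

(* Skew_(n-1) o ... o Skew_1 *)
Definition Skew_all (R : realType) (n : nat) (nu : nat -> nat)
    (X : gammas R -> R[i]) : gammas R -> R[i] :=
  foldl (fun Y j => Skew nu j Y) X (iota 1 n.-1).

Definition in_F (R : realType) (n N : nat) (nu : nat -> nat) (rho : R)
    (w : gammas R -> R[i]) : Prop :=
  exists c : {ffun 'I_N -> 'I_n} -> R[i], forall g : gammas R,
    w g = \sum_(J | inZ nu J) c J * Skew_all n nu (g_small nu rho J) g.

Definition in_W (R : realType) (n N : nat) (nu : nat -> nat)
    (W : gammas R -> R[i]) : Prop :=
  exists c : {ffun 'I_N -> 'I_n} -> R[i], forall g : gammas R,
    W g = \sum_(J | inZ nu J) c J * Skew_all n nu (G_big nu J) g.

Definition integrand (R : realType) (n : nat) (nu : nat -> nat) (rho : R)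
    (w W : gammas R -> R[i]) (g : gammas R) : R[i] :=
  (\prod_(1 <= j < n) \prod_(m < nu j) \prod_(m' < nu j.-1)
      phi n rho (g j m - g j.-1 m')) * w g * W g.

(** * Contours

  The contours are given by real parameters t j m (1 <= j < n, m < nu j):
  gamma_(j,m+1) = C j m t.  Since the poles move with the other variables, so do
  the contours: the contour of (j, m) may depend on the variables that precede
  (j, m) in the lexicographic order, and is traversed when t j m runs over R. *)

Definition param (R : realType) : Type := nat -> nat -> R.
Definition contours (R : realType) : Type := nat -> nat -> param R -> R[i].

Definition upd (R : realType) (t : param R) (j m : nat) (u : R) : param R :=
  fun j' m' => if (j' == j) && (m' == m) then u else t j' m'.

Definition curve (R : realType) (C : contours R) (j m : nat) (t : param R)
    (u : R) : R[i] :=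
  C j m (upd t j m u).

Definition velocity (R : realType) (C : contours R) (j m : nat) (t : param R)
    : R[i] :=
  Complex (derive1 (fun u => complex.Re (curve C j m t u)) (t j m))
          (derive1 (fun u => complex.Im (curve C j m t u)) (t j m)).

Definition on_contours (R : realType) (beta : nat -> R[i]) (C : contours R)
    (t : param R) : gammas R :=
  fun j m => if j == 0%N then beta m else C j m t.

(* p lies above c: p can be joined, off c, to a point higher than all of c. *)
Definition above (R : realType) (c : R -> R[i]) (p : R[i]) : Prop :=
  exists q : R -> R[i],
    [/\ continuous (fun s => complex.Re (q s)),
        continuous (fun s => complex.Im (q s)),
        q 0 = p,
        forall u, complex.Im (c u) < complex.Im (q 1)
      & forall s u, 0 <= s <= 1 -> q s <> c u].

Definition below (R : realType) (c : R -> R[i]) (p : R[i]) : Prop :=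
  exists q : R -> R[i],
    [/\ continuous (fun s => complex.Re (q s)),
        continuous (fun s => complex.Im (q s)),
        q 0 = p,
        forall u, complex.Im (q 1) < complex.Im (c u)
      & forall s u, 0 <= s <= 1 -> q s <> c u].

Definition is_pole (R : realType) (f : R[i] -> R[i]) (z : R[i]) : Prop :=
  ~ exists e M : R, 0 < e /\
      forall y, 0 < cabs (y - z) < e -> cabs (f y) <= M.

Definition is_variable (n : nat) (nu : nat -> nat) (j m : nat) : bool :=
  [&& (0 < j)%N, (j < n)%N & (m < nu j)%N].

Definition precedes (j' m' j m : nat) : bool :=
  (j' < j)%N || ((j' == j) && (m' <= m)%N).

(* f j m m' is the factor of the integrand that carries its poles in
   gamma_(j,m) - gamma_(j-1,m').  The poles in gamma_(j,m) - gamma_(j+1,m') are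
   on the same hyperplanes as those of f (j+1) m' m, with "above" and "below"
   exchanged, so the position of the contours of level j with respect to level
   j + 1 is prescribed by the contours of level j + 1. *)
Record contour_system (R : realType) (n : nat) (nu : nat -> nat) (rho : R)
    (beta : nat -> R[i]) (f : nat -> nat -> nat -> R[i] -> R[i])
    (C : contours R) : Prop := ContourSystem {
  contour_triangular : forall j m t t', is_variable n nu j m ->
    (forall j' m', is_variable n nu j' m' -> precedes j' m' j m ->
       t j' m' = t' j' m') ->
    C j m t = C j m t';
  contour_continuous : forall j m t (e : R), is_variable n nu j m -> 0 < e ->
    exists2 d : R, 0 < d & forall t',
      (forall j' m', is_variable n nu j' m' -> `|t' j' m' - t j' m'| < d) ->
      cabs (C j m t' - C j m t) < e;
  contour_C1 : forall j m t, is_variable n nu j m ->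
    let x u := complex.Re (curve C j m t u) in
    let y u := complex.Im (curve C j m t u) in
    [/\ (forall u, derivable x u 1), (forall u, derivable y u 1),
        continuous (derive1 x) & continuous (derive1 y)];
  (* a deformation of the real line, by a bounded amount *)
  contour_bounded : exists K : R, forall j m t, is_variable n nu j m ->
    cabs (C j m t - ofR (t j m)) <= K /\ cabs (velocity C j m t) <= K;
  contour_below : forall j m m' t (k l : nat),
    is_variable n nu j m -> (m' < nu j.-1)%N ->
    let p := iR (pi / n%:R - rho * k%:R - 4 * pi / n%:R * l%:R) in
    is_pole (f j m m') p ->
    below (curve C j m t) (on_contours beta C t j.-1 m' + p);
  contour_above : forall j m m' t (k l : nat),
    is_variable n nu j m -> (m' < nu j.-1)%N ->
    let p := iR (- (pi / n%:R) + rho * k%:R + 4 * pi / n%:R * l%:R) in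
    is_pole (f j m m') p ->
    above (curve C j m t) (on_contours beta C t j.-1 m' + p);
  (* the contours do not come arbitrarily close to the moving poles *)
  contour_avoids : exists2 d : R, 0 < d & forall j m m' t z,
    is_variable n nu j m -> (m' < nu j.-1)%N ->
    is_pole (f j m m') z ->
    d <= cabs (on_contours beta C t j m - on_contours beta C t j.-1 m' - z)
}.

Fixpoint iterated_integral (R : realType) (vars : seq (nat * nat))
    (F : param R -> \bar R) (t : param R) : \bar R :=
  if vars is (j, m) :: vars' then
    \int[lebesgue_measure]_(u in [set: R])
      iterated_integral vars' F (upd t j m u)
  else F t.

Definition variables (n : nat) (nu : nat -> nat) : seq (nat * nat) :=
  flatten [seq [seq (j, m) | m <- iota 0 (nu j)] | j <- iota 1 n.-1].

(* |F| |dgamma| in the parameters t *)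
Definition abs_density (R : realType) (n : nat) (nu : nat -> nat)
    (beta : nat -> R[i]) (C : contours R) (F : gammas R -> R[i]) (t : param R)
    : R :=
  cabs (F (on_contours beta C t))
  * \prod_(v <- variables n nu) cabs (velocity C v.1 v.2 t).

Definition abs_convergent (R : realType) (n : nat) (nu : nat -> nat)
    (beta : nat -> R[i]) (C : contours R) (F : gammas R -> R[i]) : Prop :=
  (iterated_integral (variables n nu)
     (fun t => (abs_density n nu beta C F t)%:E) (fun _ _ => 0%R) < +oo)%E.

(** * The terms of the expanded integrand

  Expanding the skew-symmetrizations, the integrand is a linear combination of
  the kernel times g_J and G_K with permuted variables.  The sh factors of such a
  term cancel many of the poles of phi, and which ones depends on the term.  When
  nu 2 >= 1, separating all the poles of phi by one contour_system is obstructed: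
  for two variables gamma_(1,m), gamma_(1,m') on the deformed contour, points that
  C_2 has to separate come to coincide.  For generic rho and beta this does not
  happen for the poles of a single term, and the integral is the linear
  combination of those of the terms. *)

Definition permute_all (R : realType) (nu : nat -> nat)
    (s : forall j, 'S_(nu j)) (g : gammas R) : gammas R :=
  fun j m => if j == 0%N then g 0%N m else g j (perm_nat (s j) m).

(* In X_J (permute_all s g), the variable g j m occurs in the place of
   alpha^J_(j,r) with r = permuted_row J s j m. *)
Definition permuted_row (N n : nat) (nu : nat -> nat)
    (J : {ffun 'I_N -> 'I_n}) (s : forall j, 'S_(nu j)) (j m : nat) : nat :=
  row_of J j (if j == 0%N then m else perm_nat (s j)^-1%g m).

Definition pair_factor (R : realType) (N n : nat) (nu : nat -> nat) (a : R)
    (J : {ffun 'I_N -> 'I_n}) (s : forall j, 'S_(nu j)) (j m m' : nat)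
    (z : R[i]) : R[i] :=
  let r := permuted_row J s j m in
  let r' := permuted_row J s j.-1 m' in
  if (r' < r)%N then sh (ofR a * (z + iR (pi / n%:R)))
  else if (r < r')%N then sh (ofR a * (z - iR (pi / n%:R)))
  else 1.

(* Main.v *)
Require Import Defs.
From mathcomp Require Import all_boot all_order all_algebra all_fingroup.
From mathcomp Require Import all_classical all_reals all_analysis.
From mathcomp Require Import complex measurable_realfun.
From mathcomp Require Import ring lra.

(** Put a = pi / rho and b = n / 4.  The proof bounds the integrand on the
contours by a constant times the exponential of - eps \sum |t_(j,m)|, where the
t_(j,m) are the real parameters.  Three facts are combined.

Decay of the kernel ([phi_decay]).  For v bounded and |u| >= 1,
log |phi (u + iv)| <= C - (b + 3a/2) |u|.  Insert the integral for log Gamma_2 in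
the four Gamma_2 that make up phi: the terms with B_20 and B_22 cancel, and what
remains is the integral over t > 0 of (cos (ut) q_v(t) - A / t) / t, where q_v
does not depend on u, decays exponentially and differs from A / t by O(t) near
t = 0.  Replacing q_v(t) by A / t therefore changes the integral by O(1), and
the integral of A (1 - cos (ut)) / t^2 is A pi |u| / 2.  The defining integral of
Gamma_2 has a cutoff K that grows with its argument; Frullani's integral shows
that the modulus does not depend on K ([log_gamma2_widen]), so that a single K
serves a whole strip.  For |u| <= 1 no estimate of phi is needed: a point where
a function is not locally bounded is a pole, the contours avoid the poles by a
fixed distance, and the rest is compactness ([bounded_off_poles]).

Growth of w and W.  Every sh and every exponential factor with rate c is at most
e^(c |x|), where x is the difference of the real parts of two variables.  For two
variables of adjacent levels there is exactly one such factor with rate a from w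
and one with rate b from W, and for two variables of the same level there is one
more, with rate a, from w.  With the decay of phi, the integrand is at most a
constant times the exponential of - (a/2) (P - S), where P is the sum of all
|x - y| for x and y in adjacent levels, and S the sum over all ordered pairs in
the same level j >= 1.

The energy inequality ([energy_ge0]).  When the variables of level 0 are 0,
P - S >= (1/n) \sum |x_(j,m)|.  Both sides are linear in the distances |x - y|,
and |x - y| is a combination with nonnegative coefficients of the distances
between the indicators of {c < x} and {c < y}, so the variables may be assumed to
be 0 or 1 (and 0 in level 0).  If c_j of the variables of level j are 1, then
  P - S = \sum_j c_j (nu_(j-1) + nu_(j+1) - 2 nu_j)
          + \sum_j (c_j - c_(j-1))^2 + c_(n-1)^2.
The first sum is nonnegative by the hypothesis on nu, and the second one is at
least c_k for every k < n, because the c_j are integers.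

Finally an iterated integral of nonnegative functions is monotone, so the bound
by a product of exponentials suffices ([iterated_integral_prod]). *)

Import Order.TTheory GRing.Theory Num.Theory.
Import numFieldNormedType.Exports.
Set Implicit Arguments.
Unset Strict Implicit.
Unset Printing Implicit Defensive.
Local Open Scope classical_set_scope.
Local Open Scope ring_scope.

(** * Laplace transforms under Tonelli's theorem *)

Section HalfLineIntegrals.
Context {R : realType}.
Implicit Types (f F k L : R -> R) (a s t u : R).
Local Notation mu := (@lebesgue_measure R).

Lemma integral_ge0_derive f F a (l : R) :
  (forall x, a <= x -> 0 <= f x) ->
  (forall x, a <= x -> {for x, continuous f}) ->
  (forall x, a <= x -> is_derive x 1 F (f x)) ->
  F x @[x --> +oo] --> l ->
  (\int[mu]_(x in `]a, +oo[) (f x)%:E = (l - F a)%:E)%E.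
Proof.
move=> f0 cf dF Fl.
have cfa : {within `[a, +oo[, continuous f}.
  by apply: continuous_in_subspaceT => x; rewrite inE/= in_itv/= andbT => /cf.
rewrite integral_itv_obnd_cbnd; last first.
  apply/measurable_EFinP; apply: open_continuous_measurable_fun => //.
  by move=> x; rewrite inE/= in_itv/= andbT => /ltW /cf.
rewrite EFinB (ge0_continuous_FTC2y (F := F) (l := l)) //.
- by move=> x /ltW ax; have [] := dF x ax.
- apply: cvg_at_right_filter; apply: differentiable_continuous.
  by apply/derivable1_diffP; have [] := dF a (lexx a).
- move=> x; rewrite in_itv/= andbT => /ltW ax.
  by rewrite derive1E; have [_ ->] := dF x ax.
Qed.

(** Two instances are used: k = 1 on ]a, +oo[ gives kappa t = e^(-at) / t, and
    k s = s on ]0, +oo[ gives kappa t = 1 / t^2.  Both turn an integral with a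
    power of t in the denominator into one of a rational function of s. *)
Lemma laplace_tonelli f k (kappa L : R -> R) a :
  measurable_fun setT f -> measurable_fun setT k ->
  (forall t, 0 < t -> 0 <= f t) -> (forall s, a < s -> 0 <= k s) ->
  (forall t, 0 < t ->
     (\int[mu]_(s in `]a, +oo[) (k s * expR (- (s * t)))%:E = (kappa t)%:E)%E) ->
  (forall s, a < s ->
     (\int[mu]_(t in `]0%R, +oo[) (f t * expR (- (s * t)))%:E = (L s)%:E)%E) ->
  (\int[mu]_(t in `]0%R, +oo[) (f t * kappa t)%:E =
   \int[mu]_(s in `]a, +oo[) (k s * L s)%:E)%E.
Proof.
move=> mf mk f0 k0 Ekappa EL.
pose A : set R := `]0, +oo[%classic; pose B : set R := `]a, +oo[%classic.
pose h (z : R * R) : R :=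
  (f z.1 * \1_A z.1) * (k z.2 * \1_B z.2) * expR (- (z.2 * z.1)).
have mh : measurable_fun setT h.
  have m1 : measurable_fun setT (fun z : R * R => f z.1 * \1_A z.1).
    apply: (@measurableT_comp _ _ _ _ _ _ (fun t => f t * \1_A t) _ fst) => //.
    by apply: measurable_funM => //; apply: measurable_indic; exact: measurable_itv.
  have m2 : measurable_fun setT (fun z : R * R => k z.2 * \1_B z.2).
    apply: (@measurableT_comp _ _ _ _ _ _ (fun t => k t * \1_B t) _ snd) => //.
    by apply: measurable_funM => //; apply: measurable_indic; exact: measurable_itv.
  apply: measurable_funM; first exact: measurable_funM.
  apply: measurableT_comp => //; apply: measurableT_comp => //.
  by apply: measurable_funM.
have h0 z : 0 <= h z.
  rewrite /h; apply: mulr_ge0; last exact: expR_ge0.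
  apply: mulr_ge0; rewrite indicE.
    case: (boolP (z.1 \in A)) => zA; last by rewrite mulr0.
    rewrite mulr1; apply: f0; move: zA; rewrite inE /A/= in_itv/= andbT//.
  case: (boolP (z.2 \in B)) => zB; last by rewrite mulr0.
  rewrite mulr1; apply: k0; move: zB; rewrite inE /B/= in_itv/= andbT//.
have := @fubini_tonelli _ _ _ _ R mu mu (EFin \o h)
  (proj2 (measurable_EFinP _ _) mh) (fun z => h0 z).
have inner1 t : t \in A ->
    (\int[mu]_s (h (t, s))%:E = (f t * kappa t)%:E)%E.
  move=> tA; have t0 : 0 < t by move: tA; rewrite inE /A/= in_itv/= andbT.
  have -> : (\int[mu]_s (h (t, s))%:E =
      \int[mu]_(s in B) ((f t)%:E * (k s * expR (- (s * t)))%:E))%E.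
    rewrite [RHS]integral_mkcond; apply: eq_integral => s _.
    rewrite patchE /h /= !indicE tA; case: ifP => sB; rewrite ?mulr1.
      by rewrite -EFinM mulrA.
    by rewrite !mulr0 mul0r.
  rewrite ge0_integralZl //.
  - by rewrite Ekappa// EFinM.
  - exact: measurable_itv.
  - apply/measurable_EFinP; apply: measurable_funTS.
    apply: measurable_funM => //; apply: measurableT_comp => //.
    by apply: measurableT_comp => //; apply: measurable_funM.
  - move=> s; rewrite /B/= in_itv/= andbT => sa; rewrite lee_fin.
    by rewrite mulr_ge0 ?expR_ge0// k0.
  - by rewrite lee_fin f0.
have inner2 s : s \in B ->
    (\int[mu]_t (h (t, s))%:E = (k s * L s)%:E)%E.
  move=> sB; have sa : a < s by move: sB; rewrite inE /B/= in_itv/= andbT.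
  have -> : (\int[mu]_t (h (t, s))%:E =
      \int[mu]_(t in A) ((k s)%:E * (f t * expR (- (s * t)))%:E))%E.
    rewrite [RHS]integral_mkcond; apply: eq_integral => t _.
    rewrite patchE /h /= !indicE sB; case: ifP => tA; rewrite ?mulr1.
      by rewrite -EFinM; congr EFin; ring.
    by rewrite !mulr0 !mul0r.
  rewrite ge0_integralZl //.
  - by rewrite EL// EFinM.
  - exact: measurable_itv.
  - apply/measurable_EFinP; apply: measurable_funTS.
    apply: measurable_funM => //; apply: measurableT_comp => //.
    by apply: measurableT_comp => //; apply: measurable_funM.
  - move=> t; rewrite /A/= in_itv/= andbT => t0; rewrite lee_fin.
    by rewrite mulr_ge0 ?expR_ge0// f0.
  - by rewrite lee_fin k0.
move=> Fub.
rewrite [LHS]integral_mkcond [RHS]integral_mkcond.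
transitivity (\int[mu]_t \int[mu]_s (h (t, s))%:E)%E.
  apply: eq_integral => t _; rewrite patchE; case: ifP => tA.
    by rewrite inner1.
  symmetry; apply: integral0_eq => s _.
  by congr EFin; rewrite /h /= [\1_A t]indicE tA mulr0 !mul0r.
rewrite [LHS]Fub; apply: eq_integral => s _; rewrite patchE; case: ifP => sB.
  by rewrite -inner2.
apply: integral0_eq => t _.
by congr EFin; rewrite /h /= [\1_B s]indicE sB !mulr0 mul0r.
Qed.

End HalfLineIntegrals.

Section LaplaceTransforms.
Context {R : realType}.
Implicit Types (a c s t u x : R) (f g : R -> R).
Local Notation mu := (@lebesgue_measure R).

Lemma cvg_expRNMy c : 0 < c -> expR (- (c * x)) @[x --> +oo] --> (0 : R).
Proof.
move=> c0; apply: (@cvg_comp _ _ _ (fun x => c * x) (fun y => expR (- y))) (@cvgr_expR R).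
exact: gt0_cvgMry.
Qed.

(** Shows that the antiderivatives of the Laplace integrands vanish at
    infinity. *)
Lemma cvg0_expRN (g : R -> R) M c : 0 < c ->
  (forall x, 0 <= x -> `|g x| <= M * expR (- (c * x))) ->
  g x @[x --> +oo] --> (0 : R).
Proof.
move=> c0 gM; have E : M * expR (- (c * x)) @[x --> +oo] --> (0 : R).
  rewrite -(mulr0 M); apply: cvgM; first exact: cvg_cst.
  exact: cvg_expRNMy.
have E' : - (M * expR (- (c * x))) @[x --> +oo] --> (0 : R).
  by rewrite -oppr0; apply: cvgN.
apply: squeeze_cvgr E' E.
by near=> x; rewrite -ler_norml; apply: gM; near: x; exact: nbhs_pinfty_ge.
Unshelve. all: by end_near. Qed.

Lemma is_derive_pointwiseD f g x a b :
  is_derive x 1 f a -> is_derive x 1 g b ->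
  is_derive x 1 (fun t => f t + g t) (a + b).
Proof. by move=> df dg; apply: is_deriveD. Qed.

Lemma is_derive_pointwiseN f x a :
  is_derive x 1 f a -> is_derive x 1 (fun t => - f t) (- a).
Proof. by move=> df; apply: is_deriveN. Qed.

Lemma is_derive_pointwiseM f g x a b :
  is_derive x 1 f a -> is_derive x 1 g b ->
  is_derive x 1 (fun t => f t * g t) (a * g x + f x * b).
Proof.
move=> df dg; apply: (is_derive_eq (is_deriveM df dg)).
by rewrite /GRing.scale/= addrC [X in X + _]mulrC.
Qed.

Lemma is_derive_mull c x : is_derive x 1 (fun t => c * t) c.
Proof.
apply: (is_derive_eq (is_derive_pointwiseM (is_derive_cst c x 1)
  (is_derive_id x 1))).
by rewrite mul0r add0r mulr1.
Qed.

Lemma is_derive_expRM c x :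
  is_derive x 1 (fun t => expR (- (c * t))) (- c * expR (- (c * x))).
Proof.
rewrite [X in is_derive _ _ _ X]mulrC.
apply: (is_derive1_comp (f := expR)).
by apply: is_derive_pointwiseN; exact: is_derive_mull.
Qed.

Lemma is_derive_cosM c x :
  is_derive x 1 (fun t => cos (c * t)) (- c * sin (c * x)).
Proof.
rewrite mulNr -mulrN [X in is_derive _ _ _ X]mulrC.
by apply: (is_derive1_comp (f := cos)); exact: is_derive_mull.
Qed.

Lemma is_derive_sinM c x :
  is_derive x 1 (fun t => sin (c * t)) (c * cos (c * x)).
Proof.
rewrite [X in is_derive _ _ _ X]mulrC.
by apply: (is_derive1_comp (f := sin)); exact: is_derive_mull.
Qed.

Lemma is_derive_lnD c x : 0 < x + c ->
  is_derive x 1 (fun t => ln (t + c)) (x + c)^-1.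
Proof.
move=> xc; rewrite -[X in is_derive _ _ _ X]mulr1.
apply: (is_derive1_comp (f := @ln R)); first exact: is_derive1_ln.
rewrite -[X in is_derive _ _ _ X]addr0; exact: is_derive_pointwiseD.
Qed.

Lemma is_derive_lnDsqr u x : 0 < x ->
  is_derive x 1 (fun t => ln (t * t + u * u)) (2 * x / (x * x + u * u)).
Proof.
move=> x0; have p : 0 < x * x + u * u by nra.
rewrite [X in is_derive _ _ _ X]mulrC.
apply: (is_derive1_comp (f := @ln R)); first exact: is_derive1_ln.
apply: (is_derive_eq (is_derive_pointwiseD (is_derive_pointwiseM
  (is_derive_id x 1) (is_derive_id x 1)) (is_derive_cst (u * u) x 1))).
by rewrite addr0 mulr1 mul1r -mulr2n mulr_natl.
Qed.

Lemma is_derive_continuous f x a : is_derive x 1 f a -> {for x, continuous f}.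
Proof.
by move=> [df _]; apply: differentiable_continuous; exact/derivable1_diffP.
Qed.

Lemma laplace_cst a t : 0 < t ->
  (\int[mu]_(s in `]a, +oo[) (1 * expR (- (s * t)))%:E =
   (expR (- (a * t)) / t)%:E)%E.
Proof.
move=> t0; pose F s := - (t^-1) * expR (- (t * s)).
transitivity ((0 - F a)%:E); last first.
  by congr EFin; rewrite /F sub0r mulNr opprK mulrC [t * a]mulrC.
apply: integral_ge0_derive.
- by move=> s _; rewrite mul1r expR_ge0.
- move=> s _; apply: (@is_derive_continuous _ _ (- t * expR (- (t * s)))).
  rewrite (_ : (fun _ => _) = (fun s : R => expR (- (t * s)))).
    exact: is_derive_expRM.
  by apply/funext => r; rewrite mul1r mulrC.
- move=> s _.
  apply: (is_derive_eq (is_derive_pointwiseM (is_derive_cst _ s 1)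
    (is_derive_expRM t s))).
  by rewrite mul1r mul0r add0r mulrA mulrNN mulVf ?mul1r 1?mulrC// gt_eqF.
- apply: (@cvg0_expRN _ (t^-1) t) => // s _.
  by rewrite /F normrM normrN !ger0_norm ?expR_ge0 ?invr_ge0// ltW.
Qed.

(** Half of the exponent absorbs the factor x, since y <= e^y for y = cx / 2. *)
Lemma mulr_expRN_le c x : 0 < c -> 0 <= x ->
  x * expR (- (c * x)) <= 2 / c * expR (- (c / 2 * x)).
Proof.
move=> c0 x0; have -> : - (c * x) = - (c / 2 * x) + - (c / 2 * x) by lra.
rewrite expRD mulrA ler_wpM2r ?expR_ge0//.
have := expR_ge1Dx (c / 2 * x); rewrite expRN => e1.
rewrite ler_pdivrMr ?expR_gt0// mulrAC ler_pdivlMr//.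
have : 0 <= c * x by nra.
nra.
Qed.

Lemma laplace_id t : 0 < t ->
  (\int[mu]_(s in `]0%R, +oo[) (s * expR (- (s * t)))%:E = (t^-1 * t^-1)%:E)%E.
Proof.
move=> t0; have tn0 : t != 0 by rewrite gt_eqF.
pose F s := - (t^-1 * s + t^-1 * t^-1) * expR (- (t * s)).
have dF s : is_derive s 1 F (s * expR (- (s * t))).
  apply: (is_derive_eq (is_derive_pointwiseM (is_derive_pointwiseN
    (is_derive_pointwiseD (is_derive_mull t^-1 s)
       (is_derive_cst (t^-1 * t^-1) s 1))) (is_derive_expRM t s))).
  by rewrite [s * t]mulrC /=; field.
transitivity ((0 - F 0)%:E); last first.
  by congr EFin; rewrite /F !mulr0 oppr0 expR0; ring.
apply: integral_ge0_derive.
- by move=> s s0; rewrite mulr_ge0// expR_ge0.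
- move=> s _.
  have := is_derive_pointwiseM (is_derive_id s 1) (is_derive_expRM t s).
  have -> : (fun s : R => id s * expR (- (t * s))) =
      (fun s : R => s * expR (- (s * t))).
    by apply/funext => r; rewrite [r * t]mulrC.
  exact: is_derive_continuous.
- apply: (@cvg0_expRN _ (t^-1 * (2 / t) + t^-1 * t^-1) (t / 2)).
    by rewrite divr_gt0.
  move=> s s0; rewrite /F mulNr normrN ger0_norm; last first.
    by rewrite mulr_ge0 ?expR_ge0// addr_ge0// mulr_ge0 ?invr_ge0// ltW.
  rewrite [leLHS]mulrDl [leRHS]mulrDl; apply: lerD.
    rewrite -!mulrA ler_wpM2l ?invr_ge0 ?(ltW t0)//.
    by have := mulr_expRN_le t0 s0; rewrite -!mulrA.
  rewrite -!mulrA !ler_wpM2l ?invr_ge0 ?(ltW t0)// ler_expR lerN2; nra.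
Qed.

Lemma laplace_1Bexp c s : 0 < s -> 0 <= c ->
  (\int[mu]_(t in `]0%R, +oo[) ((1 - expR (- (c * t))) * expR (- (s * t)))%:E =
   (s^-1 - (s + c)^-1)%:E)%E.
Proof.
move=> s0 c0; have sn0 : s != 0 by rewrite gt_eqF.
have scn0 : s + c != 0 by rewrite gt_eqF// ltr_wpDr.
pose F t := - s^-1 * expR (- (s * t)) + (s + c)^-1 * expR (- ((s + c) * t)).
transitivity ((0 - F 0)%:E); last first.
  by congr EFin; rewrite /F !mulr0 oppr0 expR0; ring.
apply: integral_ge0_derive.
- move=> t t0; rewrite mulr_ge0 ?expR_ge0// subr_ge0 -expR0 ler_expR.
  by rewrite oppr_le0 mulr_ge0.
- move=> t _.
  have := is_derive_pointwiseM (is_derive_pointwiseD (is_derive_cst (1 : R) t 1)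
    (is_derive_pointwiseN (is_derive_expRM c t))) (is_derive_expRM s t).
  exact: is_derive_continuous.
- move=> t _.
  apply: (is_derive_eq (is_derive_pointwiseD
    (is_derive_pointwiseM (is_derive_cst (- s^-1) t 1) (is_derive_expRM s t))
    (is_derive_pointwiseM (is_derive_cst (s + c)^-1 t 1)
       (is_derive_expRM (s + c) t)))).
  have -> : - ((s + c) * t) = - (s * t) + - (c * t) by ring.
  by rewrite /= expRD; field; apply/andP.
- apply: (@cvg0_expRN _ (s^-1 + (s + c)^-1) s) => // t t0.
  have sc0 : 0 <= (s + c)^-1 by rewrite invr_ge0 addr_ge0// ltW.
  have si0 : 0 <= s^-1 by rewrite invr_ge0 ltW.
  rewrite /F [leRHS]mulrDl (le_trans (ler_normD _ _))// mulNr normrN.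
  rewrite !ger0_norm ?mulr_ge0 ?expR_ge0//; apply: lerD => //.
  rewrite ler_wpM2l//.
  by rewrite ler_expR lerN2 ler_wpM2r// lerDl.
Qed.

Lemma laplace_1Bcos u s : 0 < s ->
  (\int[mu]_(t in `]0%R, +oo[) ((1 - cos (u * t)) * expR (- (s * t)))%:E =
   (s^-1 - s / (s * s + u * u))%:E)%E.
Proof.
move=> s0; have sn0 : s != 0 by rewrite gt_eqF.
have d0 : 0 < s * s + u * u by nra.
have dn0 : s * s + u * u != 0 by rewrite gt_eqF.
pose B t := - s^-1 + (s * s + u * u)^-1 * (s * cos (u * t) - u * sin (u * t)).
pose F t := B t * expR (- (s * t)).
transitivity ((0 - F 0)%:E); last first.
  by congr EFin; rewrite /F /B !mulr0 oppr0 expR0 cos0 sin0; ring.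
apply: integral_ge0_derive.
- by move=> t t0; rewrite mulr_ge0 ?expR_ge0// subr_ge0 cos_le1.
- move=> t _.
  have := is_derive_pointwiseM (is_derive_pointwiseD (is_derive_cst (1 : R) t 1)
    (is_derive_pointwiseN (is_derive_cosM u t))) (is_derive_expRM s t).
  exact: is_derive_continuous.
- move=> t _.
  have dcos := is_derive_pointwiseM (is_derive_cst s t 1) (is_derive_cosM u t).
  have dsin := is_derive_pointwiseM (is_derive_cst u t 1) (is_derive_sinM u t).
  have dB := is_derive_pointwiseD (is_derive_cst (- s^-1) t 1)
    (is_derive_pointwiseM (is_derive_cst (s * s + u * u)^-1 t 1)
       (is_derive_pointwiseD dcos (is_derive_pointwiseN dsin))).
  apply: (is_derive_eq (is_derive_pointwiseM dB (is_derive_expRM s t))).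
  by rewrite /B /=; field; apply/andP.
- apply: (@cvg0_expRN _ (s^-1 + (s * s + u * u)^-1 * (s + `|u|)) s) => // t t0.
  have di0 : 0 <= (s * s + u * u)^-1 by rewrite invr_ge0 ltW.
  have si0 : 0 <= s^-1 by rewrite invr_ge0 ltW.
  rewrite /F normrM [`|expR _|]ger0_norm ?expR_ge0// ler_wpM2r ?expR_ge0//.
  rewrite /B (le_trans (ler_normD _ _))// normrN ger0_norm// lerD2l.
  rewrite normrM ger0_norm// ler_wpM2l// (le_trans (ler_normB _ _))//.
  rewrite !normrM (ger0_norm (ltW s0)); apply: lerD.
    by rewrite ler_piMr// ?(ltW s0)// ler_norml cos_geN1 cos_le1.
  rewrite ler_piMr//.
  by rewrite ler_norml sin_geN1 sin_le1.
Qed.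

End LaplaceTransforms.

(** * The integrals of Dirichlet and Frullani *)

Section FrullaniDirichlet.
Context {R : realType}.
Implicit Types (a c s t u x : R) (f g : R -> R).
Local Notation mu := (@lebesgue_measure R).

Lemma cvg0_inv (g : R -> R) M : (forall x, 1 <= x -> `|g x| <= M / x) ->
  g x @[x --> +oo] --> (0 : R).
Proof.
move=> gM; apply/cvgrPdist_le => e e0; near=> x.
have x1 : 1 <= x by near: x; apply: nbhs_pinfty_ge; exact: num_real.
have xM : M / e <= x by near: x; apply: nbhs_pinfty_ge; exact: num_real.
rewrite sub0r normrN (le_trans (gM x x1))// ler_pdivrMr ?(lt_le_trans _ x1)//.
by rewrite mulrC -ler_pdivrMr.
Unshelve. all: by end_near. Qed.

(** From ln (1 + y) <= y with 1 + y = q / p; it makes the antiderivatives that are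
    differences of logarithms vanish at infinity. *)
Lemma ln_quotient_bound (p q : R) : 0 < p -> p <= q ->
  `|ln p - ln q| <= (q - p) / p.
Proof.
move=> p0 pq; have q0 := lt_le_trans p0 pq.
rewrite distrC ger0_norm ?subr_ge0 ?ler_ln//.
have -> : ln q = ln p + ln (1 + (q - p) / p).
  rewrite -lnM ?posrE//; last by rewrite ltr_wpDr// divr_ge0 ?subr_ge0// ltW.
  by congr ln; field; rewrite gt_eqF.
by rewrite addrC addKr le_ln1Dx// (lt_le_trans (ltrN10 _))// divr_ge0 ?subr_ge0// ltW.
Qed.

Lemma integral_inv_sub_cos a u : 0 < a ->
  (\int[mu]_(s in `]a, +oo[) (1 * (s^-1 - s / (s * s + u * u)))%:E =
   (ln (a * a + u * u) / 2 - ln a)%:E)%E.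
Proof.
move=> a0; pose F s := ln (s + 0) - 2^-1 * ln (s * s + u * u).
have dF s : a <= s -> is_derive s 1 F (1 * (s^-1 - s / (s * s + u * u))).
  move=> /(lt_le_trans a0) s0; have p : 0 < s * s + u * u by nra.
  apply: (is_derive_eq (is_derive_pointwiseD
    (@is_derive_lnD _ 0 s _) (is_derive_pointwiseN (is_derive_pointwiseM
      (is_derive_cst (2^-1 : R) s 1) (is_derive_lnDsqr u s0))))).
    by rewrite addr0.
  by rewrite /= addr0; field; rewrite !gt_eqF.
transitivity ((0 - F a)%:E); last first.
  by congr EFin; rewrite /F addr0; ring.
apply: integral_ge0_derive.
- move=> s /(lt_le_trans a0) s0; have p : 0 < s * s + u * u by nra.
  have -> : 1 * (s^-1 - s / (s * s + u * u)) = u * u / (s * (s * s + u * u)).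
    by field; rewrite !gt_eqF.
  by apply: divr_ge0; [nra|apply: mulr_ge0; exact: ltW].
- move=> s /(lt_le_trans a0) s0; have p : 0 < s * s + u * u by nra.
  apply: cvgM; first exact: cvg_cst.
  apply: cvgB; first by apply: cvgV; [rewrite gt_eqF|exact: cvg_id].
  apply: cvgM; first exact: cvg_id.
  apply: cvgV; first by rewrite gt_eqF.
  apply: cvgD; last exact: cvg_cst.
  by apply: cvgM; exact: cvg_id.
- apply: (@cvg0_inv _ (u * u / 2)) => s s1; have s0 : 0 < s by exact: lt_le_trans s1.
  have -> : F s = 2^-1 * (ln (s * s) - ln (s * s + u * u)).
    by rewrite /F addr0 lnM ?posrE//; field.
  rewrite normrM ger0_norm ?invr_ge0//.
  have := @ln_quotient_bound (s * s) (s * s + u * u).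
  rewrite (_ : s * s + u * u - s * s = u * u); last by ring.
  move=> /(_ _ _)/le_trans h.
  rewrite mulrC mulrAC ler_pM2r ?invr_gt0//; apply: h; [nra|nra|].
  rewrite ler_pdivrMr; last nra.
  rewrite mulrAC ler_pdivlMr//; nra.
Qed.

Lemma integral_inv_sub_exp a c : 0 < a -> 0 <= c ->
  (\int[mu]_(s in `]a, +oo[) (1 * (s^-1 - (s + c)^-1))%:E =
   (ln (a + c) - ln a)%:E)%E.
Proof.
move=> a0 c0; pose F s := ln (s + 0) - ln (s + c).
have dF s : a <= s -> is_derive s 1 F (1 * (s^-1 - (s + c)^-1)).
  move=> /(lt_le_trans a0) s0; have p : 0 < s + c by rewrite ltr_wpDr.
  apply: (is_derive_eq (is_derive_pointwiseD
    (@is_derive_lnD _ 0 s _) (is_derive_pointwiseN (is_derive_lnD p)))).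
    by rewrite addr0.
  by rewrite addr0 mul1r.
transitivity ((0 - F a)%:E); last first.
  by congr EFin; rewrite /F addr0; ring.
apply: integral_ge0_derive.
- move=> s /(lt_le_trans a0) s0; have p : 0 < s + c by rewrite ltr_wpDr.
  by rewrite mul1r subr_ge0 lef_pV2 ?posrE// lerDl.
- move=> s /(lt_le_trans a0) s0; have p : 0 < s + c by rewrite ltr_wpDr.
  apply: cvgM; first exact: cvg_cst.
  apply: cvgB; first by apply: cvgV; [rewrite gt_eqF|exact: cvg_id].
  apply: cvgV; first by rewrite gt_eqF.
  by apply: cvgD; [exact: cvg_id|exact: cvg_cst].
- apply: (@cvg0_inv _ c) => s s1; have s0 : 0 < s by exact: lt_le_trans s1.
  rewrite /F addr0; have := @ln_quotient_bound s (s + c) s0.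
  by rewrite lerDl (_ : s + c - s = c); [exact|ring].
Qed.

Lemma integral_sqr_ratio u :
  (\int[mu]_(s in `]0%R, +oo[) (s * (s^-1 - s / (s * s + u * u)))%:E =
   (pi / 2 * `|u|)%:E)%E.
Proof.
have [->|u0] := eqVneq u 0.
  rewrite normr0 !mulr0; apply: integral0_eq => s; rewrite /= in_itv/= andbT => s0.
  by congr EFin; field; rewrite gt_eqF.
have v0 : 0 < `|u| by rewrite normr_gt0.
have uu : u * u = `|u| * `|u| by rewrite -normrM ger0_norm// -expr2 sqr_ge0.
rewrite {}uu; set v := `|u| in v0 *.
transitivity (\int[mu]_(s in `]0%R, +oo[) (v * v * (s * s + v * v)^-1)%:E)%E.
  apply: eq_integral => s; rewrite inE/= in_itv/= andbT => s0; congr EFin.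
  by field; rewrite !gt_eqF//; nra.
pose F s := v * atan (v^-1 * s).
have dF s : is_derive s 1 F (v * v * (s * s + v * v)^-1).
  have := is_derive1_comp (is_derive1_atan (v^-1 * s)) (is_derive_mull v^-1 s).
  move=> /(is_derive_pointwiseM (is_derive_cst (v : R) s 1)) d.
  apply: (is_derive_eq d) => /=.
  have : 0 < s * s + v * v by nra.
  have : v ^+ 2 + s ^+ 2 != 0 by rewrite gt_eqF//; nra.
  move=> h1 h2; field; rewrite !gt_eqF//=; nra.
transitivity ((pi / 2 * v - F 0)%:E); last first.
  by congr EFin; rewrite /F mulr0 atan0; ring.
apply: integral_ge0_derive.
- move=> s s0; rewrite mulr_ge0 ?invr_ge0//; nra.
- move=> s s0; have p : 0 < s * s + v * v by nra.
  apply: cvgM; first exact: cvg_cst.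
  apply: cvgV; first by rewrite gt_eqF.
  apply: cvgD; last exact: cvg_cst.
  by apply: cvgM; exact: cvg_id.
- rewrite mulrC; apply: cvgM; first exact: cvg_cst.
  apply: (@cvg_comp _ _ _ (fun x => v^-1 * x) (@atan R)) (@cvgy_atan R).
  have vi0 : 0 < v^-1 by rewrite invr_gt0.
  by apply: gt0_cvgMry.
Qed.

Lemma measurable_1BcosM u : measurable_fun setT (fun t => 1 - cos (u * t)).
Proof.
apply: continuous_measurable_fun => t.
exact: is_derive_continuous (is_derive_pointwiseD (is_derive_cst (1 : R) t 1)
  (is_derive_pointwiseN (is_derive_cosM u t))).
Qed.

Lemma measurable_1BexpRM c : measurable_fun setT (fun t => 1 - expR (- (c * t))).
Proof.
apply: continuous_measurable_fun => t.
exact: is_derive_continuous (is_derive_pointwiseD (is_derive_cst (1 : R) t 1)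
  (is_derive_pointwiseN (is_derive_expRM c t))).
Qed.

Lemma integral_dirichlet u :
  (\int[mu]_(t in `]0%R, +oo[) ((1 - cos (u * t)) * (t^-1 * t^-1))%:E =
   (pi / 2 * `|u|)%:E)%E.
Proof.
rewrite -integral_sqr_ratio; apply: (@laplace_tonelli _ (fun t => 1 - cos (u * t)) id
  (fun t => t^-1 * t^-1)) => //.
- exact: measurable_1BcosM.
- by move=> s /ltW.
- by move=> t; exact: laplace_id.
- by move=> s; exact: laplace_1Bcos.
Qed.

Lemma integral_frullani_cos a u : 0 < a ->
  (\int[mu]_(t in `]0%R, +oo[)
     ((1 - cos (u * t)) * (expR (- (a * t)) / t))%:E =
   (ln (a * a + u * u) / 2 - ln a)%:E)%E.
Proof.
move=> a0; rewrite -integral_inv_sub_cos//.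
apply: (@laplace_tonelli _ (fun t => 1 - cos (u * t)) (fun=> 1)
  (fun t => expR (- (a * t)) / t)) => //.
- exact: measurable_1BcosM.
- by move=> t; exact: laplace_cst.
- by move=> s /(lt_trans a0); exact: laplace_1Bcos.
Qed.

Lemma integral_frullani_exp a c : 0 < a -> 0 <= c ->
  (\int[mu]_(t in `]0%R, +oo[)
     ((1 - expR (- (c * t))) * (expR (- (a * t)) / t))%:E =
   (ln (a + c) - ln a)%:E)%E.
Proof.
move=> a0 c0; rewrite -integral_inv_sub_exp//.
apply: (@laplace_tonelli _ (fun t => 1 - expR (- (c * t))) (fun=> 1)
  (fun t => expR (- (a * t)) / t)) => //.
- exact: measurable_1BexpRM.
- move=> t t0; rewrite /= subr_ge0 -expR0 ler_expR oppr_le0 mulr_ge0//.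
  exact: ltW.
- by move=> t; exact: laplace_cst.
- by move=> s /(lt_trans a0) s0; exact: laplace_1Bexp.
Qed.

End FrullaniDirichlet.

(** * Taylor remainders *)

Section TaylorRemainders.
Context {R : realType}.
Implicit Types (a c s t u x S M : R) (f g : R -> R).

(** The mean value theorem gains one power of |x| per integration.  Iterating it
    from a crude bound on a high derivative yields every Taylor remainder below. *)
Lemma primitive_bound g (g' : R -> R) S M k :
  (forall x, is_derive x 1 g (g' x)) -> g 0 = 0 ->
  (forall x, `|x| <= S -> `|g' x| <= M * `|x| ^+ k) ->
  forall x, `|x| <= S -> `|g x| <= M * `|x| ^+ k.+1.
Proof.
move=> dg g0 g'M x xS.
have M0 : 0 <= M * `|x| ^+ k by rewrite (le_trans _ (g'M x xS)).
have cg (I : set R) : {within I, continuous g}.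
  apply: continuous_subspaceT => y; exact: is_derive_continuous (dg y).
have key c : `|c| <= `|x| -> `|g' c| * `|x| <= M * `|x| ^+ k.+1.
  move=> cx; rewrite exprS mulrCA mulrC ler_wpM2l//.
  rewrite (le_trans (g'M c (le_trans cx xS)))//.
  have [k0|k0] := posnP k; first by rewrite k0 !expr0.
  have [c0|c0] := eqVneq c 0; first by rewrite c0 normr0 expr0n gtn_eqF//= mulr0.
  have : 0 <= M.
    have := le_trans (normr_ge0 _) (g'M c (le_trans cx xS)).
    by rewrite pmulr_lge0// exprn_gt0// normr_gt0.
  by move=> ?; rewrite ler_wpM2l// lerXn2r// nnegrE.
have [x0|x0|->] := ltgtP x 0.
- have [c cI E] := MVT x0 (fun y _ => dg y) (cg _).
  rewrite g0 sub0r sub0r in E; rewrite -normrN E normrM normrN.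
  apply: key; move: cI; rewrite in_itv/= => /andP[xc c0].
  by rewrite !ltr0_norm// lerN2 ltW.
- have [c cI E] := MVT x0 (fun y _ => dg y) (cg _).
  rewrite g0 !subr0 in E; rewrite E normrM.
  apply: key; move: cI; rewrite in_itv/= => /andP[c0 xc].
  by rewrite !gtr0_norm// ltW.
- by rewrite g0 normr0 exprS mul0r mulr0.
Qed.

Lemma expR_taylor2 S x : `|x| <= S ->
  `|expR x - (1 + x + x ^+ 2 / 2)| <= expR S * `|x| ^+ 3.
Proof.
pose r1 (x : R) := expR x + - 1.
pose r2 (x : R) := r1 x + - x.
pose r3 (x : R) := r2 x + - (2^-1 * (x * x)).
have d1 (y : R) : is_derive y 1 r1 (expR y).
  apply: (is_derive_eq (is_derive_pointwiseD (is_derive_expR y)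
    (is_derive_cst (- 1 : R) y 1))).
  by rewrite addr0.
have d2 (y : R) : is_derive y 1 r2 (r1 y).
  exact: (is_derive_eq (is_derive_pointwiseD (d1 y)
    (is_derive_pointwiseN (is_derive_id y 1)))).
have d3 (y : R) : is_derive y 1 r3 (r2 y).
  apply: (is_derive_eq (is_derive_pointwiseD (d2 y)
    (is_derive_pointwiseN (is_derive_pointwiseM (is_derive_cst (2^-1 : R) y 1)
      (is_derive_pointwiseM (is_derive_id y 1) (is_derive_id y 1)))))).
  by rewrite /r2 /=; field.
have b0 (y : R) : `|y| <= S -> `|expR y| <= expR S * `|y| ^+ 0.
  by move=> /ler_normlW yS; rewrite expr0 mulr1 ger0_norm ?expR_ge0// ler_expR.
have e1 : r1 0 = 0 by rewrite /r1 expR0 subrr.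
have e2 : r2 0 = 0 by rewrite /r2 e1 subrr.
have e3 : r3 0 = 0 by rewrite /r3 e2 !mulr0 subrr.
have b1 := primitive_bound d1 e1 b0.
have b2 := primitive_bound d2 e2 b1.
have b3 := primitive_bound d3 e3 b2.
move=> /b3; rewrite (_ : r3 x = expR x - (1 + x + x ^+ 2 / 2))//.
by rewrite /r3 /r2 /r1; field.
Qed.

Lemma expR_taylor3 S x : `|x| <= S ->
  `|expR x - (1 + x + x ^+ 2 / 2 + x ^+ 3 / 6)| <= expR S * `|x| ^+ 4.
Proof.
pose r3 (x : R) := expR x - (1 + x + x ^+ 2 / 2).
pose r4 (x : R) := expR x - (1 + x + x ^+ 2 / 2 + x ^+ 3 / 6).
have d4 (y : R) : is_derive y 1 r4 (r3 y).
  have dx2 := is_derive_pointwiseM (is_derive_id y 1) (is_derive_id y 1).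
  have := is_derive_pointwiseD (is_derive_expR y) (is_derive_pointwiseN
    (is_derive_pointwiseD (is_derive_pointwiseD (is_derive_pointwiseD
      (is_derive_cst (1 : R) y 1) (is_derive_id y 1))
      (is_derive_pointwiseM dx2 (is_derive_cst (2^-1 : R) y 1)))
      (is_derive_pointwiseM (is_derive_pointwiseM (is_derive_id y 1) dx2)
        (is_derive_cst (6^-1 : R) y 1)))).
  rewrite (_ : (fun t : R => _) = r4); last first.
    by apply/funext => t; rewrite /r4 /=; ring.
  by move=> d; apply: (is_derive_eq d); rewrite /r3 /=; field.
have e4 : r4 0 = 0 by rewrite /r4 expR0 !expr0n /= !mul0r !addr0 subrr.
exact: (primitive_bound d4 e4 (@expR_taylor2 S)).
Qed.

Lemma cos_taylor2 x : `|cos x - (1 - x ^+ 2 / 2)| <= `|x| ^+ 3.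
Proof.
pose r1 (x : R) := x + - sin x.
pose r2 (x : R) := cos x - (1 - x ^+ 2 / 2).
pose r0 (x : R) := 1 + - cos x.
have d0 (y : R) : is_derive y 1 r0 (sin y).
  apply: (is_derive_eq (is_derive_pointwiseD (is_derive_cst (1 : R) y 1)
    (is_derive_pointwiseN (is_derive_cos y)))).
  by rewrite add0r opprK.
have d1 (y : R) : is_derive y 1 r1 (r0 y).
  exact: (is_derive_pointwiseD (is_derive_id y 1)
    (is_derive_pointwiseN (is_derive_sin y))).
have d2 (y : R) : is_derive y 1 r2 (r1 y).
  have := is_derive_pointwiseD (is_derive_cos y) (is_derive_pointwiseN
    (is_derive_pointwiseD (is_derive_cst (1 : R) y 1) (is_derive_pointwiseN
    (is_derive_pointwiseM (is_derive_pointwiseM (is_derive_id y 1)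
    (is_derive_id y 1)) (is_derive_cst (2^-1 : R) y 1))))).
  rewrite (_ : (fun t : R => _) = r2); last first.
    by apply/funext => t; rewrite /r2 /=; ring.
  by move=> d; apply: (is_derive_eq d); rewrite /r1 /=; field.
have b0 (y : R) : `|y| <= `|x| -> `|sin y| <= 1 * `|y| ^+ 0.
  by move=> _; rewrite expr0 mulr1 ler_norml sin_geN1 sin_le1.
have e0 : r0 0 = 0 by rewrite /r0 cos0 subrr.
have e1 : r1 0 = 0 by rewrite /r1 sin0 subrr.
have e2 : r2 0 = 0 by rewrite /r2 cos0 expr0n mul0r subr0 subrr.
have b1 := primitive_bound d0 e0 b0.
have b2 := primitive_bound d1 e1 b1.
by have := primitive_bound d2 e2 b2 (lexx _); rewrite mul1r.
Qed.

Lemma expRN_lower S s : 0 <= s <= S -> s * expR (- S) <= 1 - expR (- s).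
Proof.
move=> /andP[s0 sS]; have := expR_ge1Dx s => h.
have e : expR (- s) * expR s = 1 by rewrite -expRD addNr expR0.
have : expR (- S) <= expR (- s) by rewrite ler_expR lerN2.
have := expR_gt0 (- s); have := expR_gt0 (- S); nra.
Qed.

(** s / (1 - e^(-s)) generates the Bernoulli numbers; its first coefficients 1,
    1/2, 1/12 are the source of the double Bernoulli polynomials B_20, B_21 and
    B_22. *)
Lemma todd_taylor2 S s : 0 < s <= S ->
  `|s / (1 - expR (- s)) - (1 + s / 2 + s ^+ 2 / 12)| <=
    expR S * (1 + S + expR S * (1 + S + S ^+ 2)) * s ^+ 3.
Proof.
move=> /andP[s0 sS]; have S0 := lt_le_trans s0 sS.
set d := 1 - expR (- s).
have dS : s * expR (- S) <= d by apply: expRN_lower; rewrite ltW.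
have eS : 0 < expR (- S) by exact: expR_gt0.
have d0 : 0 < d by rewrite (lt_le_trans _ dS)// mulr_gt0.
have eSN : expR S * expR (- S) = 1 by rewrite -expRD subrr expR0.
have Ns : `|- s| <= S by rewrite normrN gtr0_norm.
have := expR_taylor3 Ns; rewrite [`|- s|]normrN (gtr0_norm s0).
set r := expR (- s) - _ => hr.
have dE : d = s - s ^+ 2 / 2 + s ^+ 3 / 6 - r.
  by rewrite /d /r; field.
(* The terms up to s^3 of s - d (1 + s / 2 + s^2 / 12) cancel. *)
have -> : s / d - (1 + s / 2 + s ^+ 2 / 12) =
    (s ^+ 4 * (- 1 / 24 - s / 72) + r * (1 + s / 2 + s ^+ 2 / 12)) / d.
  have dn0 : d != 0 by rewrite gt_eqF.
  rewrite -[X in _ - X](mulfK dn0) -mulrBl; congr (_ / _).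
  by rewrite dE; field.
rewrite normrM normfV (gtr0_norm d0) ler_pdivrMr//.
have E0 := expR_gt0 S.
apply: (@le_trans _ _ ((1 + S + expR S * (1 + S + S ^+ 2)) * s ^+ 4)).
  rewrite (le_trans (ler_normD _ _))// [`|s ^+ 4 * _|]normrM [`|r * _|]normrM.
  rewrite mulrDl; apply: lerD.
    have s4 : 0 <= s ^+ 4 by rewrite exprn_ge0// ltW.
    rewrite (ger0_norm s4) mulrC ler_wpM2r// ler_norml; apply/andP; split; lra.
  rewrite (_ : expR S * (1 + S + S ^+ 2) * s ^+ 4 =
    expR S * s ^+ 4 * (1 + S + S ^+ 2)); last by ring.
  apply: ler_pM => //.
  have p : 0 <= 1 + s / 2 + s ^+ 2 / 12 by nra.
  rewrite (ger0_norm p); nra.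
have -> : s ^+ 4 = s ^+ 3 * (s * expR (- S)) * expR S.
  by rewrite -!mulrA [expR (- S) * _]mulrC eSN; ring.
have : 0 <= (1 + S + expR S * (1 + S + S ^+ 2)) by nra.
set B := 1 + S + _ => B0.
have s3 : 0 <= s ^+ 3 by rewrite exprn_ge0// ltW.
have -> : B * (s ^+ 3 * (s * expR (- S)) * expR S) =
  expR S * B * s ^+ 3 * (s * expR (- S)) by ring.
rewrite ler_wpM2l// !mulr_ge0// ltW//.
Qed.

End TaylorRemainders.

(** * Second-order expansions at 0, uniform in a parameter *)

Section UniformExpansions.
Context {R : realType} {P : Type} (D : P -> Prop).
Implicit Types (f g : P -> R -> R) (c d : P -> R) (t : R).

(** c0 p + c1 p t + c2 p t^2 + O(t^3) on ]0, 1], with one constant for all p in D.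
    Uniformity in p lets the imaginary part v run over a whole strip; bounded
    coefficients make the relation stable under products. *)
Definition expansion f c0 c1 c2 : Prop :=
  exists2 M : R, 0 <= M & forall p, D p ->
    [/\ `|c0 p| <= M, `|c1 p| <= M, `|c2 p| <= M & forall t, 0 < t <= 1 ->
        `|f p t - (c0 p + c1 p * t + c2 p * t ^+ 2)| <= M * t ^+ 3].

Lemma expansion_eq f g c0 c1 c2 d0 d1 d2 : expansion f c0 c1 c2 ->
  (forall p t, D p -> 0 < t <= 1 -> g p t = f p t) ->
  (forall p, D p -> [/\ d0 p = c0 p, d1 p = c1 p & d2 p = c2 p]) ->
  expansion g d0 d1 d2.
Proof.
move=> [M M0 fM] fg cd; exists M => // p Dp.
have [-> -> ->] := cd p Dp; have [a0 a1 a2 h] := fM p Dp.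
by split=> // t t01; rewrite fg//; exact: h.
Qed.

Lemma expansionD f g c0 c1 c2 d0 d1 d2 :
  expansion f c0 c1 c2 -> expansion g d0 d1 d2 ->
  expansion (fun p t => f p t + g p t)
    (fun p => c0 p + d0 p) (fun p => c1 p + d1 p) (fun p => c2 p + d2 p).
Proof.
move=> [M M0 fM] [M' M'0 gM]; exists (M + M'); first exact: addr_ge0.
move=> p Dp; have [a0 a1 a2 h] := fM p Dp; have [b0 b1 b2 h'] := gM p Dp.
split; try by rewrite (le_trans (ler_normD _ _))// lerD.
move=> t t01; rewrite [leRHS]mulrDl.
rewrite (le_trans _ (lerD (h t t01) (h' t t01)))//.
rewrite (le_trans _ (ler_normD _ _))// le_eqVlt; apply/orP; left.
by apply/eqP; congr `|_|; ring.
Qed.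

Lemma expansionM f g c0 c1 c2 d0 d1 d2 :
  expansion f c0 c1 c2 -> expansion g d0 d1 d2 ->
  expansion (fun p t => f p t * g p t)
    (fun p => c0 p * d0 p) (fun p => c0 p * d1 p + c1 p * d0 p)
    (fun p => c0 p * d2 p + c1 p * d1 p + c2 p * d0 p).
Proof.
move=> [M M0 fM] [M' M'0 gM].
pose B := M + M'; have B0 : 0 <= B by rewrite addr_ge0.
exists (10 * B ^+ 2); first by rewrite mulr_ge0// exprn_ge0.
move=> p /[dup] /fM[a0 a1 a2 h] /gM[b0 b1 b2 h'].
have MB : M <= B by rewrite lerDl.
have M'B : M' <= B by rewrite lerDr.
have {}a0 := le_trans a0 MB; have {}a1 := le_trans a1 MB.
have {}a2 := le_trans a2 MB; have {}b0 := le_trans b0 M'B.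
have {}b1 := le_trans b1 M'B; have {}b2 := le_trans b2 M'B.
have bM (x y : R) : `|x| <= B -> `|y| <= B -> `|x * y| <= B ^+ 2.
  by move=> xB yB; rewrite normrM expr2; apply: ler_pM.
have B2 : 0 <= B ^+ 2 by rewrite exprn_ge0.
split.
- by rewrite (le_trans (bM _ _ a0 b0))//; lra.
- rewrite (le_trans (ler_normD _ _))//.
  have := bM _ _ a0 b1; have := bM _ _ a1 b0; lra.
- rewrite (le_trans (ler_normD _ _))// (le_trans (lerD (ler_normD _ _) (lexx _)))//.
  have := bM _ _ a0 b2; have := bM _ _ a1 b1; have := bM _ _ a2 b0; lra.
move=> t /[dup] /andP[t0 t1] /[dup] /h {}h /h' {}h'.
have t3 : 0 <= t ^+ 3 by rewrite exprn_ge0// ltW.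
have t2 : 0 <= t ^+ 2 <= 1 by rewrite exprn_ge0 ?exprn_ile1// ltW.
have t31 : t ^+ 3 <= 1 by rewrite exprn_ile1// ltW.
have {}h : `|f p t - (c0 p + c1 p * t + c2 p * t ^+ 2)| <= B * t ^+ 3.
  by rewrite (le_trans h)// ler_wpM2r.
have {}h' : `|g p t - (d0 p + d1 p * t + d2 p * t ^+ 2)| <= B * t ^+ 3.
  by rewrite (le_trans h')// ler_wpM2r.
have poly (x y z : R) : `|x| <= B -> `|y| <= B -> `|z| <= B ->
    `|x + y * t + z * t ^+ 2| <= 3 * B.
  move=> xB yB zB; rewrite (le_trans (ler_normD _ _))//.
  rewrite (le_trans (lerD (ler_normD _ _) (lexx _)))//.
  rewrite [`|y * t|]normrM [`|z * _|]normrM (gtr0_norm t0) (ger0_norm (x := t ^+ 2)); last by case/andP: t2.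
  have : `|y| * t <= B * 1 by apply: ler_pM => //; exact: ltW.
  have : `|z| * t ^+ 2 <= B * 1 by case/andP: t2 => ? ?; apply: ler_pM.
  lra.
have pf := poly _ _ _ a0 a1 a2; have pg := poly _ _ _ b0 b1 b2.
set F := f p t in h *; set G := g p t in h' *.
set pF := c0 p + _ + _ in h pf; set pG := d0 p + _ + _ in h' pg.
have GB : `|G| <= 4 * B.
  rewrite -(subrK pG G) (le_trans (ler_normD _ _))//.
  have : B * t ^+ 3 <= B * 1 by rewrite ler_wpM2l.
  lra.
have -> : F * G - (c0 p * d0 p + (c0 p * d1 p + c1 p * d0 p) * t +
      (c0 p * d2 p + c1 p * d1 p + c2 p * d0 p) * t ^+ 2) =
    (F - pF) * G + pF * (G - pG) +
    (c1 p * d2 p + c2 p * d1 p + c2 p * d2 p * t) * t ^+ 3.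
  by rewrite /pF /pG; ring.
rewrite (le_trans (ler_normD _ _))// (le_trans (lerD (ler_normD _ _) (lexx _)))//.
have e1 : `|(F - pF) * G| <= B * t ^+ 3 * (4 * B) by rewrite normrM; apply: ler_pM.
have e2 : `|pF * (G - pG)| <= 3 * B * (B * t ^+ 3) by rewrite normrM; apply: ler_pM.
have e3 : `|(c1 p * d2 p + c2 p * d1 p + c2 p * d2 p * t) * t ^+ 3| <=
    3 * B ^+ 2 * t ^+ 3.
  rewrite normrM (ger0_norm t3) ler_wpM2r// (le_trans (ler_normD _ _))//.
  rewrite (le_trans (lerD (ler_normD _ _) (lexx _)))//.
  have := bM _ _ a1 b2; have := bM _ _ a2 b1.
  have : `|c2 p * d2 p * t| <= B ^+ 2 * 1.
    rewrite normrM; apply: ler_pM => //; first exact: bM.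
    by rewrite gtr0_norm.
  lra.
rewrite (le_trans (lerD (lerD e1 e2) e3))// le_eqVlt; apply/orP; left.
by apply/eqP; ring.
Qed.

Lemma expansion_cst c M : 0 <= M -> (forall p, D p -> `|c p| <= M) ->
  expansion (fun p _ => c p) c (fun=> 0) (fun=> 0).
Proof.
move=> M0 cM; exists M => // p Dp; rewrite normr0; split=> //; first exact: cM.
move=> t /andP[t0 _]; rewrite !mul0r !addr0 subrr normr0 mulr_ge0//.
by rewrite exprn_ge0// ltW.
Qed.

Lemma expansion_id : expansion (fun _ t => t) (fun=> 0) (fun=> 1) (fun=> 0).
Proof.
exists 1 => // p Dp; rewrite normr0 normr1; split=> // t /andP[t0 _].
by rewrite mul0r mul1r add0r addr0 subrr normr0 mul1r exprn_ge0// ltW.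
Qed.

Lemma expansion_sum (I : Type) (r : seq I) (f : I -> P -> R -> R)
    (c0 c1 c2 : I -> P -> R) :
  (forall i, expansion (f i) (c0 i) (c1 i) (c2 i)) ->
  expansion (fun p t => \sum_(i <- r) f i p t)
    (fun p => \sum_(i <- r) c0 i p) (fun p => \sum_(i <- r) c1 i p)
    (fun p => \sum_(i <- r) c2 i p).
Proof.
move=> fE; elim: r => [|i r IH].
  apply: expansion_eq (@expansion_cst (fun=> 0) 0 _ _) _ _ => //.
  - by move=> p _; rewrite normr0.
  - by move=> p t _ _; rewrite big_nil.
  - by move=> p _; rewrite !big_nil.
apply: expansion_eq (expansionD (fE i) IH) _ _.
  by move=> p t _ _; rewrite big_cons.
by move=> p _; rewrite !big_cons.
Qed.

Lemma expansion_exp c V : (forall p, D p -> `|c p| <= V) ->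
  expansion (fun p t => expR (- (c p * t)))
    (fun=> 1) (fun p => - c p) (fun p => c p ^+ 2 / 2).
Proof.
move=> cV; have [[p0 Dp0]|nD] := pselect (exists p, D p); last first.
  by exists 0 => // p Dp; case: nD; exists p.
have V0 : 0 <= V by rewrite (le_trans _ (cV _ Dp0)).
have E0 := expR_gt0 V.
exists (1 + V + V ^+ 2 + expR V * V ^+ 3); first by rewrite !addr_ge0// ?mulr_ge0 ?exprn_ge0// ltW.
have X0 : 0 <= expR V * V ^+ 3 by rewrite mulr_ge0 ?exprn_ge0// ltW.
move=> p /cV cp; have V2 : 0 <= V ^+ 2 by rewrite exprn_ge0.
have cp2 : `|c p| ^+ 2 <= V ^+ 2 by rewrite lerXn2r// nnegrE.
split; rewrite ?normr1 ?normrN; try lra.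
  by rewrite normrM normrX (ger0_norm (x := 2^-1)) ?invr_ge0//; lra.
move=> t /andP[t0 t1].
have t3 : 0 <= t ^+ 3 by rewrite exprn_ge0// ltW.
have ct : `|- (c p * t)| <= V.
  rewrite normrN normrM (gtr0_norm t0); have := ler_pM (normr_ge0 (c p)) (ltW t0) cp t1.
  by rewrite mulr1.
have := expR_taylor2 ct.
rewrite (_ : 1 - c p * t + _ = 1 + - c p * t + c p ^+ 2 / 2 * t ^+ 2); last by field.
move=> /le_trans; apply.
rewrite normrN normrM (gtr0_norm t0) exprMn mulrA ler_wpM2r//.
have : `|c p| ^+ 3 <= V ^+ 3 by rewrite lerXn2r// nnegrE.
move=> /(ler_wpM2l (ltW E0)); lra.
Qed.

Lemma expansion_cos (u : R) :
  expansion (fun p t => cos (u * t)) (fun=> 1) (fun=> 0) (fun=> - u ^+ 2 / 2).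
Proof.
have u3 : 0 <= `|u| ^+ 3 by rewrite exprn_ge0.
have u2 : 0 <= `|u| ^+ 2 by rewrite exprn_ge0.
exists (1 + `|u| ^+ 2 + `|u| ^+ 3); first lra.
move=> p Dp; rewrite normr0 normr1; split; try lra.
  by rewrite mulNr normrN normrM normrX (ger0_norm (x := 2^-1)) ?invr_ge0//; lra.
move=> t /andP[t0 t1].
have t3 : 0 <= t ^+ 3 by rewrite exprn_ge0// ltW.
have := cos_taylor2 (u * t).
rewrite (_ : 1 - _ / 2 = 1 + 0 * t + - u ^+ 2 / 2 * t ^+ 2); last by field.
move=> /le_trans; apply.
rewrite normrM (gtr0_norm t0) exprMn ler_wpM2r//; lra.
Qed.

Lemma expansion_todd (w : R) : 0 < w ->
  expansion (fun p t => w * t / (1 - expR (- (w * t))))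
    (fun=> 1) (fun=> w / 2) (fun=> w ^+ 2 / 12).
Proof.
move=> w0; have E0 := expR_gt0 w.
have w2 : 0 <= w ^+ 2 by rewrite exprn_ge0// ltW.
set K := expR w * (1 + w + expR w * (1 + w + w ^+ 2)).
have K0 : 0 <= K by rewrite /K !mulr_ge0 ?addr_ge0 ?mulr_ge0 ?addr_ge0 ?mulr_ge0// ltW.
have w3 : 0 <= w ^+ 3 by rewrite exprn_ge0// ltW.
have Kw : 0 <= K * w ^+ 3 by rewrite mulr_ge0.
exists (1 + w + w ^+ 2 + K * w ^+ 3); first lra.
move=> p Dp; split; rewrite ?normr1; try (rewrite ger0_norm; lra); first lra.
move=> t /andP[t0 t1].
have t3 : 0 <= t ^+ 3 by rewrite exprn_ge0// ltW.
have wt : 0 < w * t <= w by rewrite mulr_gt0//= ger_pMr.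
have := todd_taylor2 wt; rewrite -/K.
rewrite (_ : 1 + _ / 2 + _ = 1 + w / 2 * t + w ^+ 2 / 12 * t ^+ 2); last by field.
move=> /le_trans; apply.
rewrite exprMn mulrA ler_wpM2r//; lra.
Qed.

(** Every integrand below is bounded near 0 by multiplying it by t^3 and checking
    that the three coefficients vanish. *)
Lemma expansion0_bound f : expansion f (fun=> 0) (fun=> 0) (fun=> 0) ->
  exists2 M : R, 0 <= M & forall p t, D p -> 0 < t <= 1 -> `|f p t / t ^+ 3| <= M.
Proof.
move=> [M M0 fM]; exists M => // p t /fM[_ _ _ h] t01; have := h t t01.
rewrite !mul0r !addr0 subr0 normrM normfV => {}h.
case/andP: t01 => t0 _; rewrite ler_pdivrMr; last by rewrite normr_gt0 gt_eqF ?exprn_gt0.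
by rewrite (ger0_norm (x := t ^+ 3))// exprn_ge0// ltW.
Qed.

End UniformExpansions.

(** * Integrals over the positive half-line *)

Section HalfLineValues.
Context {R : realType}.
Implicit Types (f g : R -> R) (a c t u x I J : R).
Local Notation mu := (@lebesgue_measure R).

(** Integrability is kept with the value, because the integral of a function that
    is not integrable is meaningless and linearity would fail. *)
Definition half_line_value f I : Prop :=
  mu.-integrable `]0, +oo[%classic (EFin \o f) /\
  \int[mu]_(t in `]0, +oo[) f t = I.

Lemma half_line_eq f g I : (forall t, 0 < t -> f t = g t) ->
  half_line_value f I -> half_line_value g I.
Proof.
move=> fg [fi fI]; have fg' : {in `]0, +oo[%classic, f =1 g}.
  by move=> t; rewrite inE/= in_itv/= andbT => /fg.
split; last by rewrite -fI; apply: eq_Rintegral => t /fg'.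
apply: eq_integrable fi => // t tI; congr EFin; exact: fg'.
Qed.

Lemma half_lineD f g I J : half_line_value f I -> half_line_value g J ->
  half_line_value (fun t => f t + g t) (I + J).
Proof.
move=> [fi <-] [gi <-]; split; last by rewrite RintegralD.
by apply: eq_integrable (integrableD _ fi gi) => // t tI; rewrite /= EFinD.
Qed.

Lemma half_lineZ f I c : half_line_value f I ->
  half_line_value (fun t => c * f t) (c * I).
Proof.
move=> [fi <-]; split; last by rewrite RintegralZl.
by apply: eq_integrable (integrableZl _ c fi) => // t tI; rewrite /= EFinM.
Qed.

Lemma half_lineB f g I J : half_line_value f I -> half_line_value g J ->
  half_line_value (fun t => f t - g t) (I - J).
Proof.
move=> fI /(half_lineZ (-1)) gJ; rewrite -[I - J]/(I + - J) -mulN1r.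
by apply: half_line_eq (half_lineD fI gJ) => t _; rewrite mulN1r.
Qed.

Lemma half_line0 : half_line_value (fun=> 0) 0.
Proof.
split; last by rewrite /Rintegral integral0.
exact: integrable0.
Qed.

Lemma half_line_sum (T : Type) (r : seq T) (P : pred T) (f : T -> R -> R)
    (I : T -> R) :
  (forall i, P i -> half_line_value (f i) (I i)) ->
  half_line_value (fun t => \sum_(i <- r | P i) f i t) (\sum_(i <- r | P i) I i).
Proof.
move=> fI; elim: r => [|i r IH].
  by rewrite big_nil; apply: half_line_eq half_line0 => t _; rewrite big_nil.
rewrite big_cons; case: ifPn => Pi.
  by apply: half_line_eq (half_lineD (fI i Pi) IH) => t _; rewrite big_cons Pi.
by apply: half_line_eq IH => t _; rewrite big_cons (negbTE Pi).
Qed.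

Lemma half_line_le f g I J : half_line_value f I -> half_line_value g J ->
  (forall t, 0 < t -> f t <= g t) -> I <= J.
Proof.
move=> [fi <-] [gi <-] fg; apply: le_Rintegral => // t /=.
by rewrite in_itv/= andbT => /fg.
Qed.

Lemma continuous_half_line f : (forall t, 0 < t -> {for t, continuous f}) ->
  measurable_fun (`]0, +oo[%classic : set R) f.
Proof.
move=> cf; apply: open_continuous_measurable_fun => // t.
by rewrite inE/= in_itv/= andbT => /cf.
Qed.

Lemma half_line_ge0 f I : (forall t, 0 < t -> {for t, continuous f}) ->
  (forall t, 0 < t -> 0 <= f t) ->
  (\int[mu]_(t in `]0%R, +oo[) (f t)%:E = I%:E)%E -> half_line_value f I.
Proof.
move=> cf f0 fI; split; last by rewrite /Rintegral fI.
apply/integrableP; split.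
  by apply/measurable_EFinP; exact: continuous_half_line.
have -> : (\int[mu]_(t in `]0%R, +oo[) `|(EFin \o f) t| =
    \int[mu]_(t in `]0%R, +oo[) (f t)%:E)%E.
  apply: eq_integral => t; rewrite inE/= in_itv/= andbT => t0.
  by rewrite ger0_norm// f0.
by rewrite fI ltry.
Qed.

(** 1 / (1 + t^2) dominates functions that are bounded near 0 and decay like
    1 / t^2 at infinity. *)
Lemma half_line_oneDsqr : half_line_value (fun t => (oneDsqr t)^-1) (pi / 2).
Proof.
apply: half_line_ge0.
- by move=> t _; exact: continuous_oneDsqrV.
- by move=> t _; rewrite invr_ge0 (le_trans _ (oneDsqr_ge1 t)).
- rewrite -integral0y_oneDsqr integral_itv_obnd_cbnd//.
  apply/measurable_EFinP; apply: continuous_half_line => t _.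
  exact: continuous_oneDsqrV.
Qed.

Lemma le_oneDsqr f M : (forall t, 0 < t <= 1 -> `|f t| <= M) ->
  (forall t, 1 <= t -> `|f t| * t ^+ 2 <= M) ->
  forall t, 0 < t -> `|f t| <= 2 * M * (oneDsqr t)^-1.
Proof.
move=> f0 f1 t t0; have o0 : 0 < oneDsqr t by rewrite (lt_le_trans _ (oneDsqr_ge1 t)).
rewrite ler_pdivlMr// /oneDsqr mulrDr mulr1.
have a0 := normr_ge0 (f t).
have [t1|/ltW t1] := leP t 1.
  have h := f0 t; rewrite t0 t1 in h; have {}h := h isT.
  have : t ^+ 2 <= 1 by rewrite exprn_ile1// ltW.
  nra.
have := f1 t t1; have : 1 <= t ^+ 2 by rewrite exprn_ege1.
nra.
Qed.

Lemma half_line_dominated f g I : (forall t, 0 < t -> {for t, continuous f}) ->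
  (forall t, 0 < t -> `|f t| <= g t) -> half_line_value g I ->
  exists J, half_line_value f J.
Proof.
move=> cf fg [gi _]; exists (\int[mu]_(t in `]0, +oo[) f t); split => //.
apply: (le_integrable _ _ _ gi) => //.
  by apply/measurable_EFinP; exact: continuous_half_line.
move=> t; rewrite /= in_itv/= andbT => t0; rewrite lee_fin.
by rewrite (le_trans (fg t t0))// ler_norm.
Qed.

Lemma half_line_bounded f M : (forall t, 0 < t -> {for t, continuous f}) ->
  (forall t, 0 < t <= 1 -> `|f t| <= M) ->
  (forall t, 1 <= t -> `|f t| * t ^+ 2 <= M) ->
  exists J, half_line_value f J.
Proof.
move=> cf f0 f1; apply: (half_line_dominated cf (le_oneDsqr f0 f1)).
exact: half_lineZ half_line_oneDsqr.
Qed.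

Lemma continuous_expRM c t : {for t, continuous (fun s : R => expR (- (c * s)))}.
Proof. exact: is_derive_continuous (is_derive_expRM c t). Qed.

Lemma continuous_cosM c t : {for t, continuous (fun s : R => cos (c * s))}.
Proof. exact: is_derive_continuous (is_derive_cosM c t). Qed.

Lemma continuous_inv t : 0 < t -> {for t, continuous (fun s : R => s^-1)}.
Proof. by move=> t0; apply: cvgV; [rewrite gt_eqF|exact: cvg_id]. Qed.

Lemma half_line_dirichlet u :
  half_line_value (fun t => (1 - cos (u * t)) * (t^-1 * t^-1)) (pi / 2 * `|u|).
Proof.
apply: half_line_ge0; last exact: integral_dirichlet.
- move=> t t0; apply: cvgM.
    by apply: cvgB; [exact: cvg_cst|exact: continuous_cosM].
  by apply: cvgM; exact: continuous_inv.
- move=> t t0; rewrite mulr_ge0 ?subr_ge0 ?cos_le1//.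
  by rewrite mulr_ge0// invr_ge0 ltW.
Qed.

(** The real part of Frullani's integral, - log z for z = a + iu.  The integrand
    splits into two parts of constant sign, (e^(-at) - e^(-t)) / t and
    - (1 - cos (ut)) e^(-at) / t, to which Tonelli's theorem applies. *)
Lemma half_line_frullani a u : 0 < a ->
  half_line_value (fun t => (expR (- (a * t)) * cos (u * t) - expR (- t)) / t)
    (- (ln (a * a + u * u) / 2)).
Proof.
move=> a0.
have hc : half_line_value
    (fun t => (1 - cos (u * t)) * (expR (- (a * t)) / t))
    (ln (a * a + u * u) / 2 - ln a).
  apply: half_line_ge0; last exact: integral_frullani_cos.
  - move=> t t0; apply: cvgM.
      by apply: cvgB; [exact: cvg_cst|exact: continuous_cosM].
    by apply: cvgM; [exact: continuous_expRM|exact: continuous_inv].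
  - move=> t t0; rewrite mulr_ge0 ?subr_ge0 ?cos_le1//.
    by rewrite mulr_ge0 ?expR_ge0// invr_ge0 ltW.
have he b c : 0 < b -> 0 <= c -> half_line_value
    (fun t => (1 - expR (- (c * t))) * (expR (- (b * t)) / t))
    (ln (b + c) - ln b).
  move=> b0 c0; apply: half_line_ge0; last exact: integral_frullani_exp.
  - move=> t t0; apply: cvgM.
      by apply: cvgB; [exact: cvg_cst|exact: continuous_expRM].
    by apply: cvgM; [exact: continuous_expRM|exact: continuous_inv].
  - move=> t t0; rewrite mulr_ge0//.
      by rewrite subr_ge0 -expR0 ler_expR oppr_le0 mulr_ge0// ltW.
    by rewrite mulr_ge0 ?expR_ge0// invr_ge0 ltW.
have ha : half_line_value (fun t => (expR (- (a * t)) - expR (- t)) / t) (- ln a).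
  have [a1|/ltW a1] := leP a 1.
    have := he a (1 - a) a0; rewrite subr_ge0 => /(_ a1).
    rewrite [a + (1 - a)]addrC subrK ln1 sub0r; apply: half_line_eq => t t0.
    have -> : expR (- t) = expR (- ((1 - a) * t)) * expR (- (a * t)).
      by rewrite -expRD; congr expR; ring.
    by ring.
  have := he 1 (a - 1) ltr01; rewrite subr_ge0 => /(_ a1).
  rewrite [1 + (a - 1)]addrC subrK ln1 subr0 => /(half_lineZ (-1)); rewrite mulN1r.
  apply: half_line_eq => t t0.
  have -> : expR (- (a * t)) = expR (- ((a - 1) * t)) * expR (- t).
    by rewrite -expRD; congr expR; ring.
  by rewrite mul1r; ring.
have := half_lineB ha hc.
rewrite (_ : - ln a - _ = - (ln (a * a + u * u) / 2)); last by ring.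
by apply: half_line_eq => t t0; field; rewrite gt_eqF.
Qed.

End HalfLineValues.

(** * The integral for log |Gamma_2| *)

Section GammaIntegrand.
Context {R : realType} (w1 w2 : R).
Hypotheses (w1_gt0 : 0 < w1) (w2_gt0 : 0 < w2).
Implicit Types (a t u : R) (K : nat).

Definition lattice_den t : R := (1 - expR (- (w1 * t))) * (1 - expR (- (w2 * t))).

Definition lattice_sum K t : R :=
  \sum_(k < K) \sum_(l < K) expR (- (lattice w1 w2 k l * t)).

(** The generating function of the lattice points (k, l) that are not both less
    than K; the remaining ones are factors of Gamma_2. *)
Definition lattice_tail K t : R := (lattice_den t)^-1 - lattice_sum K t.

Definition re_bern22 a u : R :=
  (a ^+ 2 - u ^+ 2) / (w1 * w2) - (w1 + w2) / (w1 * w2) * a +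
  (w1 ^+ 2 + w2 ^+ 2 + 3 * (w1 * w2)) / (6 * (w1 * w2)).

Definition re_gamma2_integrand K a u t : R :=
  (expR (- (a * t)) * cos (u * t) * lattice_tail K t - (w1 * w2)^-1 / t ^+ 2 +
   (a / (w1 * w2) - (w1 + w2) / (2 * (w1 * w2))) / t -
   (re_bern22 a u / 2 - (K ^ 2)%:R) * expR (- t)) / t.

Lemma oneB_expRN_gt0 (w t : R) : 0 < w -> 0 < t -> 0 < 1 - expR (- (w * t)).
Proof. by move=> w0 t0; rewrite subr_gt0 -expR0 ltr_expR oppr_lt0 mulr_gt0. Qed.

Lemma lattice_den_gt0 t : 0 < t -> 0 < lattice_den t.
Proof. by move=> t0; rewrite mulr_gt0// oneB_expRN_gt0. Qed.

Lemma geometric_expRN (w t : R) K :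
  (\sum_(k < K) expR (- (k%:R * w * t))) * (1 - expR (- (w * t))) =
  1 - expR (- (K%:R * w * t)).
Proof.
elim: K => [|K IH].
  by rewrite big_ord0 mul0r !mul0r oppr0 expR0 subrr.
rewrite big_ord_recr /= mulrDl IH -natr1 !mulrDl opprD expRD mul1r; ring.
Qed.

(** Both geometric sums are explicit.  This form shows the decay at infinity,
    the difference in the definition does not. *)
Lemma lattice_tailE K t : 0 < t ->
  lattice_tail K t = (lattice_den t)^-1 * (expR (- (K%:R * w1 * t)) +
    expR (- (K%:R * w2 * t)) - expR (- (K%:R * w1 * t)) * expR (- (K%:R * w2 * t))).
Proof.
move=> t0; rewrite /lattice_tail.
have e1 := oneB_expRN_gt0 w1_gt0 t0; have e2 := oneB_expRN_gt0 w2_gt0 t0.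
have -> : lattice_sum K t = (\sum_(k < K) expR (- (k%:R * w1 * t))) *
    (\sum_(k < K) expR (- (k%:R * w2 * t))).
  rewrite /lattice_sum mulr_suml; apply: eq_bigr => k _.
  rewrite mulr_sumr; apply: eq_bigr => l _.
  by rewrite /lattice mulrDl opprD expRD.
have g1 := geometric_expRN w1 t K; have g2 := geometric_expRN w2 t K.
apply: (mulfI (lt0r_neq0 (lattice_den_gt0 t0))).
rewrite mulrBr mulfV ?mulVKf ?(lt0r_neq0 (lattice_den_gt0 t0))//.
rewrite /lattice_den mulrACA [_ * (\sum_(_ < _) _)]mulrC g1.
by rewrite [_ * (\sum_(_ < _) _)]mulrC g2; ring.
Qed.

Lemma mul_expRN_le1 (kappa t : R) : 0 < kappa -> 0 < t ->
  t * expR (- (kappa * t)) <= kappa^-1.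
Proof.
move=> k0 t0; rewrite expRN ler_pdivrMr ?expR_gt0// ler_pdivlMl//.
by have := expR_ge1Dx (kappa * t); lra.
Qed.

(** The slowest terms of the tail are e^(-K w1 t) and e^(-K w2 t).  The bound has to
    be uniform in a, which contains the imaginary part of the argument of phi. *)
Lemma lattice_tail_decay K (kappa : R) : 0 < kappa -> exists2 M : R, 0 <= M &
  forall t a, 1 <= t -> kappa <= a + K%:R * w1 -> kappa <= a + K%:R * w2 ->
  `|expR (- (a * t)) * lattice_tail K t| * t <= M.
Proof.
move=> k0; have d0 := lattice_den_gt0 ltr01.
exists (2 * ((lattice_den 1)^-1 * kappa^-1)).
  by rewrite mulr_ge0// mulr_ge0// invr_ge0 ltW.
move=> t a t1 h1 h2; have t0 : 0 < t by exact: lt_le_trans t1.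
have dt0 := lattice_den_gt0 t0.
have dd : (lattice_den t)^-1 <= (lattice_den 1)^-1.
  rewrite lef_pV2 ?posrE// /lattice_den; apply: ler_pM.
  - by apply: ltW; exact: oneB_expRN_gt0.
  - by apply: ltW; exact: oneB_expRN_gt0.
  - by rewrite lerD2l lerN2 ler_expR lerN2 ler_pM2l.
  - by rewrite lerD2l lerN2 ler_expR lerN2 ler_pM2l.
rewrite lattice_tailE// normrM ger0_norm ?expR_ge0// normrM.
rewrite [X in _ * (X * _)]ger0_norm ?invr_ge0 ?(ltW dt0)//.
set e1 := expR (- (_ * w1 * t)); set e2 := expR (- (_ * w2 * t)).
have e10 : 0 < e1 by exact: expR_gt0.
have e20 : 0 < e2 by exact: expR_gt0.
have e11 : e1 <= 1.
  by rewrite -expR0 ler_expR oppr_le0 !mulr_ge0// ltW.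
have e21 : e2 <= 1.
  by rewrite -expR0 ler_expR oppr_le0 !mulr_ge0// ltW.
have en : `|e1 + e2 - e1 * e2| <= e1 + e2.
  by rewrite ger0_norm; nra.
have m1 : expR (- (a * t)) * e1 <= expR (- (kappa * t)).
  by rewrite -expRD ler_expR -opprD lerN2 -mulrDl ler_pM2r.
have m2 : expR (- (a * t)) * e2 <= expR (- (kappa * t)).
  by rewrite -expRD ler_expR -opprD lerN2 -mulrDl ler_pM2r.
have key : expR (- (a * t)) * `|e1 + e2 - e1 * e2| <= 2 * expR (- (kappa * t)).
  rewrite (le_trans (ler_wpM2l (expR_ge0 _) en))// mulrDr; lra.
have tk := mul_expRN_le1 k0 t0.
have -> : expR (- (a * t)) * ((lattice_den t)^-1 * `|e1 + e2 - e1 * e2|) * t =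
  (lattice_den t)^-1 * (expR (- (a * t)) * `|e1 + e2 - e1 * e2| * t) by ring.
rewrite [leRHS]mulrCA; apply: ler_pM => //.
- by rewrite invr_ge0 ltW.
- by rewrite !mulr_ge0 ?expR_ge0// ltW.
- rewrite (le_trans (ler_wpM2r (ltW t0) key))//; lra.
Qed.

Lemma continuous_sumr (I : Type) (r : seq I) (f : I -> R -> R) t :
  (forall i, {for t, continuous (f i)}) ->
  {for t, continuous (fun s => \sum_(i <- r) f i s)}.
Proof.
move=> fc; elim: r => [|i r IH].
  rewrite (_ : (fun _ => _) = fun=> 0); first exact: cvg_cst.
  by apply/funext => s; rewrite big_nil.
rewrite (_ : (fun _ => _) = fun s => f i s + \sum_(j <- r) f j s).
  by apply: cvgD; [exact: fc|exact: IH].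
by apply/funext => s; rewrite big_cons.
Qed.

Lemma continuous_lattice_tail K t : 0 < t -> {for t, continuous (lattice_tail K)}.
Proof.
move=> t0; apply: cvgB.
  apply: cvgV; first by rewrite gt_eqF// lattice_den_gt0.
  by apply: cvgM; apply: cvgB; (exact: cvg_cst || exact: continuous_expRM).
apply: continuous_sumr => k; apply: continuous_sumr => l.
exact: continuous_expRM.
Qed.

Lemma continuous_re_gamma2_integrand K a u t : 0 < t ->
  {for t, continuous (re_gamma2_integrand K a u)}.
Proof.
move=> t0; have ti := continuous_inv t0.
apply: cvgM => //; apply: cvgB; last first.
  apply: cvgM; first exact: cvg_cst.
  have := @continuous_expRM R 1 t.
  rewrite (_ : (fun s : R => expR (- (1 * s))) = fun s => expR (- s)); first exact.
  by apply/funext => s; rewrite mul1r.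
apply: cvgD; last by apply: cvgM => //; exact: cvg_cst.
apply: cvgB.
  apply: cvgM; last exact: continuous_lattice_tail.
  by apply: cvgM; [exact: continuous_expRM|exact: continuous_cosM].
apply: cvgM; first exact: cvg_cst.
by apply: cvgV; [rewrite gt_eqF ?exprn_gt0|exact: exprn_continuous].
Qed.

Section Expansion.
Context {P : Type} (D : P -> Prop).

Lemma expansion_const (r : R) :
  expansion D (fun _ _ => r) (fun=> r) (fun=> 0) (fun=> 0).
Proof. by apply: (@expansion_cst _ _ D (fun=> r) `|r|). Qed.

Lemma expansion_sqrM f c0 c1 c2 : expansion D f c0 c1 c2 ->
  expansion D (fun p t => t ^+ 2 * f p t) (fun=> 0) (fun=> 0) c0.
Proof.
move=> fE; have := expansionM (expansion_id D) (expansionM (expansion_id D) fE).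
move=> /expansion_eq; apply; first by move=> p t _ _; ring.
by move=> p _; split; ring.
Qed.

Lemma expansion_lattice_den :
  expansion D (fun _ t => t ^+ 2 * (lattice_den t)^-1)
    (fun=> (w1 * w2)^-1) (fun=> (w1 + w2) / (2 * (w1 * w2)))
    (fun=> (w1 ^+ 2 + w2 ^+ 2 + 3 * (w1 * w2)) / (12 * (w1 * w2))).
Proof.
have w1n0 := lt0r_neq0 w1_gt0; have w2n0 := lt0r_neq0 w2_gt0.
have := expansionM (expansion_const (w1 * w2)^-1)
  (expansionM (expansion_todd D w1_gt0) (expansion_todd D w2_gt0)).
move=> /expansion_eq; apply.
  move=> p t _ /andP[t0 _]; rewrite /lattice_den.
  have := lt0r_neq0 (oneB_expRN_gt0 w1_gt0 t0).
  have := lt0r_neq0 (oneB_expRN_gt0 w2_gt0 t0).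
  by move=> n1 n2; field; rewrite n1 n2 w1n0 w2n0.
by move=> p _; split; field; rewrite w1n0 w2n0.
Qed.

Lemma expansion_lattice_sum K : exists c1 c2,
  expansion D (fun _ t => lattice_sum K t) (fun=> (K ^ 2)%:R) c1 c2.
Proof.
have e k l := @expansion_exp R P D (fun=> lattice w1 w2 k l)
  `|lattice w1 w2 k l| (fun _ _ => lexx _).
have := expansion_sum (index_enum 'I_K) (fun k : 'I_K =>
  expansion_sum (index_enum 'I_K) (fun l : 'I_K => e k l)).
move=> h; eexists; eexists; apply: expansion_eq h _ _ => // p _; split=> //.
by rewrite !sumr_const card_ord -mulrnA mulnn.
Qed.

End Expansion.

(** The polar part that is subtracted in the definition of Gamma_2 is the
    expansion of its first term, up to the K^2 lattice terms, whose value at 0 is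
    compensated by K^2 e^(-t). *)
Lemma re_gamma2_integrand_bound0 K a u : exists2 M : R, 0 <= M &
  forall t, 0 < t <= 1 -> `|re_gamma2_integrand K a u t| <= M.
Proof.
have w1n0 := lt0r_neq0 w1_gt0; have w2n0 := lt0r_neq0 w2_gt0.
pose D (p : unit) := True.
have expc c := @expansion_exp R unit D (fun=> c) `|c| (fun _ _ => lexx _).
have eE := expansionM (expc a) (expansion_cos D u).
have [c1 [c2 eS]] := expansion_lattice_sum D K.
have eK r := @expansion_const unit D r.
have eH := expansionM eE (expansion_lattice_den D).
have eES := expansionM (eK (- 1)) (expansion_sqrM (expansionM eE eS)).
have e3 := expansionM (eK (a / (w1 * w2) - (w1 + w2) / (2 * (w1 * w2))))
  (expansion_id D).
have e4 := expansionM (eK (- (re_bern22 a u / 2 - (K ^ 2)%:R)))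
  (expansion_sqrM (expc 1)).
have e := expansionD (expansionD (expansionD (expansionD eH eES)
  (eK (- (w1 * w2)^-1))) e3) e4.
have {e} := expansion_eq (g := fun _ t => t ^+ 3 * re_gamma2_integrand K a u t)
  (d0 := fun=> 0) (d1 := fun=> 0) (d2 := fun=> 0) e.
case/(_ _ _)/expansion0_bound.
- move=> p t _ /andP[t0 _]; rewrite /re_gamma2_integrand /lattice_tail mul1r.
  by field; rewrite !gt_eqF ?lattice_den_gt0.
- move=> p _; split; rewrite /re_bern22; field; rewrite ?w1n0 ?w2n0//.
- move=> M M0 h; exists M => // t t01; have := h tt t I t01.
  rewrite mulrAC mulfV ?mul1r// gt_eqF// exprn_gt0//.
  by case/andP: t01.
Qed.

Lemma re_gamma2_integrand_bound1 K a u : 0 < a + K%:R * w1 -> 0 < a + K%:R * w2 ->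
  exists2 M : R, 0 <= M &
  forall t, 1 <= t -> `|re_gamma2_integrand K a u t| * t ^+ 2 <= M.
Proof.
move=> h1 h2; pose kappa := Num.min (a + K%:R * w1) (a + K%:R * w2).
have k0 : 0 < kappa by rewrite lt_min h1 h2.
have k1 : kappa <= a + K%:R * w1 by rewrite ge_min lexx.
have k2 : kappa <= a + K%:R * w2 by rewrite ge_min lexx orbT.
have [M M0 hM] := lattice_tail_decay K k0.
set b20 := (w1 * w2)^-1; set b21 := a / (w1 * w2) - (w1 + w2) / (2 * (w1 * w2)).
set b := re_bern22 a u / 2 - (K ^ 2)%:R.
exists (M + `|b20| + `|b21| + `|b|); first by rewrite !addr_ge0.
move=> t t1; have t0 : 0 < t by exact: lt_le_trans t1.
rewrite -[X in _ * X](ger0_norm (x := t ^+ 2)) ?exprn_ge0 ?(ltW t0)// -normrM.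
have -> : re_gamma2_integrand K a u t * t ^+ 2 =
    expR (- (a * t)) * lattice_tail K t * t * cos (u * t) - b20 / t + b21 -
    b * (t * expR (- (1 * t))).
  by rewrite /re_gamma2_integrand -/b20 -/b21 -/b mul1r; field; rewrite gt_eqF.
have {}hM := hM t a t1 k1 k2.
rewrite (le_trans (ler_normB _ _))//; apply: lerD; last first.
  rewrite normrM ler_piMr// ger0_norm ?mulr_ge0 ?expR_ge0 ?(ltW t0)//.
  by rewrite -[leRHS]invr1 mul_expRN_le1.
rewrite (le_trans (ler_normD _ _))// lerD2r (le_trans (ler_normB _ _))//.
apply: lerD.
  rewrite normrM normrM (gtr0_norm t0) (le_trans _ hM)// ler_piMr//.
    by rewrite mulr_ge0// ltW.
  by rewrite ler_norml cos_geN1 cos_le1.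
by rewrite normrM ler_piMr// gtr0_norm ?invr_gt0// invf_le1.
Qed.

Lemma half_line_re_gamma2 K a u : 0 < a + K%:R * w1 -> 0 < a + K%:R * w2 ->
  exists J, half_line_value (re_gamma2_integrand K a u) J.
Proof.
move=> h1 h2; have [M M0 hM] := re_gamma2_integrand_bound0 K a u.
have [M' M'0 hM'] := re_gamma2_integrand_bound1 u h1 h2.
apply: (@half_line_bounded _ _ (M + M')).
- by move=> t; exact: continuous_re_gamma2_integrand.
- by move=> t /hM/le_trans; apply; rewrite lerDl.
- by move=> t /hM'/le_trans; apply; rewrite lerDr.
Qed.

End GammaIntegrand.

(** * The complex modulus *)

Section ComplexAbs.
Context {R : realType}.
Implicit Types (z x y : R[i]) (r a u : R).

Lemma cabsE z : cabs z = ComplexField.Normc.normc z. Proof. by case: z. Qed.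

Lemma cabsM x y : cabs (x * y) = cabs x * cabs y.
Proof. by rewrite !cabsE ComplexField.Normc.normcM. Qed.

Lemma cabsV x : cabs x^-1 = (cabs x)^-1.
Proof. by rewrite !cabsE ComplexField.Normc.normcV. Qed.

Lemma cabs1 : cabs (1 : R[i]) = 1.
Proof. by rewrite cabsE ComplexField.Normc.normc1. Qed.

Lemma cabsN z : cabs (- z) = cabs z.
Proof. by case: z => a u; rewrite /cabs /= !sqrrN. Qed.

Lemma cabs_ge0 z : 0 <= cabs z. Proof. exact: sqrtr_ge0. Qed.

Lemma cabs0 : cabs (0 : R[i]) = 0.
Proof. by rewrite /cabs /= expr0n /= addr0 sqrtr0. Qed.

Lemma cabsD x y : cabs (x + y) <= cabs x + cabs y.
Proof.
have := ler_normD x y.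
by rewrite !normc_def -rmorphD lecR.
Qed.

Lemma Re_le_cabs z : `|complex.Re z| <= cabs z.
Proof. by rewrite /cabs -sqrtr_sqr ler_wsqrtr// lerDl sqr_ge0. Qed.

Lemma Im_le_cabs z : `|complex.Im z| <= cabs z.
Proof. by rewrite /cabs -sqrtr_sqr ler_wsqrtr// lerDr sqr_ge0. Qed.

Lemma cabs_prod (I : Type) (s : seq I) (P : pred I) (F : I -> R[i]) :
  cabs (\prod_(i <- s | P i) F i) = \prod_(i <- s | P i) cabs (F i).
Proof.
by elim/big_rec2: _ => [|i y1 y2 _ <-]; rewrite ?cabs1// cabsM.
Qed.

Lemma cabs_cexp z : cabs (cexp z) = expR (complex.Re z).
Proof.
rewrite /cexp cabsM /cabs /= expr0n /= addr0 sqrtr_sqr ger0_norm ?expR_ge0//.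
by rewrite cos2Dsin2 sqrtr1 mulr1.
Qed.

Lemma inv_ofR r : (ofR r)^-1 = ofR r^-1.
Proof. exact/esym/(fmorphV (real_complex R)). Qed.

Lemma ofR_nat n : n%:R = ofR n%:R :> R[i].
Proof. exact/esym/(rmorph_nat (real_complex R)). Qed.

End ComplexAbs.

(** * Independence of the cutoff *)

Section GammaModulus.
Context {R : realType} (w1 w2 : R).
Hypotheses (w1_gt0 : 0 < w1) (w2_gt0 : 0 < w2).
Implicit Types (a t u : R) (K : nat).
Local Notation mu := (@lebesgue_measure R).

(** log |x + k w1 + l w2| for x = a + iu. *)
Definition log_shift k l a u : R :=
  ln ((a + lattice w1 w2 k l) * (a + lattice w1 w2 k l) + u * u) / 2.

(** log |Gamma_2 (a + iu)|, computed with the cutoff K. *)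
Definition log_gamma2 K a u : R :=
  \int[mu]_(t in `]0, +oo[) re_gamma2_integrand w1 w2 K a u t -
  \sum_(k < K) \sum_(l < K) log_shift k l a u.

Lemma lattice_ge0 k l : 0 <= lattice w1 w2 k l.
Proof. by rewrite addr_ge0// mulr_ge0// ltW. Qed.

Lemma sum_square_widen K K' (F : nat -> nat -> R) : (K <= K')%N ->
  \sum_(k < K) \sum_(l < K) F k l =
  \sum_(k < K') \sum_(l < K') if (k < K)%N && (l < K)%N then F k l else 0.
Proof.
move=> KK'; rewrite (big_ord_widen _ (fun k => \sum_(l < K) F k l) KK').
rewrite big_mkcond; apply: eq_bigr => k _; case: ifP => kK /=.
  by rewrite (big_ord_widen _ (fun l => F k l) KK') big_mkcond.
by rewrite big1.
Qed.

Lemma sum_square_affine n (A B : R) (F : nat -> nat -> R) :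
  \sum_(k < n) \sum_(l < n) (A * F k l - B) =
  A * (\sum_(k < n) \sum_(l < n) F k l) - (n ^ 2)%:R * B.
Proof.
rewrite mulr_sumr (_ : (n ^ 2)%:R * B = \sum_(k < n) n%:R * B); last first.
  by rewrite sumr_const card_ord -[RHS]mulr_natl mulrA -natrM mulnn.
rewrite -sumrB; apply: eq_bigr => k _.
by rewrite sumrB mulr_sumr sumr_const card_ord mulr_natl.
Qed.

(** Raising the cutoff moves finitely many terms (e^(-zt) - e^(-t)) / t with
    z = x + k w1 + l w2 out of the integrand, and Frullani's integral converts each
    of them into the factor z of the product. *)
Lemma log_gamma2_widen K K' a u : (K <= K')%N ->
  0 < a + K%:R * w1 -> 0 < a + K%:R * w2 -> log_gamma2 K a u = log_gamma2 K' a u.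
Proof.
move=> KK' h1 h2.
have lat_lt k l : ~~ ((k < K)%N && (l < K)%N) -> 0 < a + lattice w1 w2 k l.
  rewrite negb_and -!leqNgt => /orP[h|h].
    apply: (lt_le_trans h1); rewrite lerD2l /lattice.
    have := mulr_ge0 (ler0n R l) (ltW w2_gt0).
    have : K%:R * w1 <= k%:R * w1 by rewrite ler_pM2r ?ler_nat.
    lra.
  apply: (lt_le_trans h2); rewrite lerD2l /lattice.
  have := mulr_ge0 (ler0n R k) (ltW w1_gt0).
  have : K%:R * w2 <= l%:R * w2 by rewrite ler_pM2r ?ler_nat.
  lra.
have h1' : 0 < a + K'%:R * w1.
  by rewrite (lt_le_trans h1)// lerD2l ler_pM2r ?ler_nat.
have h2' : 0 < a + K'%:R * w2.
  by rewrite (lt_le_trans h2)// lerD2l ler_pM2r ?ler_nat.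
have [J' hJ'] := half_line_re_gamma2 w1_gt0 w2_gt0 u h1' h2'.
pose fr k l t := (expR (- ((a + lattice w1 w2 k l) * t)) * cos (u * t) -
  expR (- t)) / t.
have hfr : half_line_value
    (fun t => \sum_(k < K') \sum_(l < K') if (k < K)%N && (l < K)%N then 0 else fr k l t)
    (\sum_(k < K') \sum_(l < K') if (k < K)%N && (l < K)%N then 0 else - log_shift k l a u).
  apply: half_line_sum => k _; apply: half_line_sum => l _.
  case: ifPn => [_|/lat_lt kl]; first exact: half_line0.
  exact: half_line_frullani.
have := half_lineD hJ' hfr.
have -> : (fun t => re_gamma2_integrand w1 w2 K' a u t +
   \sum_(k < K') \sum_(l < K') if (k < K)%N && (l < K)%N then 0 else fr k l t) =
   re_gamma2_integrand w1 w2 K a u.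
  apply/funext => t.
  pose E k l := expR (- (a * t)) * cos (u * t) *
     expR (- (lattice w1 w2 k l * t)) - expR (- t).
  have EK n : \sum_(k < n) \sum_(l < n) E k l =
     expR (- (a * t)) * cos (u * t) * lattice_sum w1 w2 n t -
      (n ^ 2)%:R * expR (- t).
    by rewrite /E (sum_square_affine _ _ _ (fun k l =>
      expR (- (lattice w1 w2 k l * t)))).
  have -> : \sum_(k < K') \sum_(l < K')
      (if (k < K)%N && (l < K)%N then 0 else fr k l t) =
      (\sum_(k < K') \sum_(l < K') E k l - \sum_(k < K) \sum_(l < K) E k l) / t.
    rewrite (sum_square_widen _ KK') -sumrB mulr_suml; apply: eq_bigr => k _.
    rewrite -sumrB mulr_suml; apply: eq_bigr => l _; case: ifP => _.
      by rewrite subrr mul0r.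
    have -> : fr k l t = (expR (- (a * t)) * expR (- (lattice w1 w2 k l * t)) *
        cos (u * t) - expR (- t)) / t.
      by rewrite /fr -expRD; congr ((expR _ * _ - _) / _); ring.
    by rewrite /E; ring.
  by rewrite !EK /re_gamma2_integrand /lattice_tail; ring.
move=> [_]; rewrite /log_gamma2 (proj2 hJ') => ->.
rewrite (sum_square_widen (fun k l => log_shift k l a u) KK').
rewrite -addrA -sumrB; congr (_ + _); rewrite -sumrN; apply: eq_bigr => k _.
rewrite -sumrB -sumrN; apply: eq_bigr => l _; case: ifP => _.
  by rewrite sub0r.
by rewrite subr0.
Qed.


End GammaModulus.

(** * Exponential decay of the kernel *)

Section KernelDecay.
Context {R : realType} (w1 w2 : R).
Hypotheses (w1_gt0 : 0 < w1) (w2_gt0 : 0 < w2).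
Implicit Types (a t u v : R) (K : nat).
Local Notation mu := (@lebesgue_measure R).

Lemma Re_gamma2_integrand a u t :
  complex.Re (gamma2_integrand w1 w2 (Complex a u) t) =
  re_gamma2_integrand w1 w2 (gamma2_cutoff w1 w2 (Complex a u)) a u t.
Proof.
rewrite /gamma2_integrand; set K := gamma2_cutoff _ _ _.
rewrite /re_gamma2_integrand /lattice_tail /lattice_den /lattice_sum.
set q := _ - \sum_(_ < _) _.
rewrite /cexp /bern20 /bern21 /bern22 !ofR_nat !inv_ofR /ofR !expr2.
simpc; rewrite /=.
rewrite cosN /re_bern22; ring.
Qed.

Lemma cabs_Gamma2 a u : u != 0 ->
  cabs (Gamma2 w1 w2 (Complex a u)) =
  expR (log_gamma2 w1 w2 (gamma2_cutoff w1 w2 (Complex a u)) a u).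
Proof.
move=> u0; set K := gamma2_cutoff _ _ _.
have -> : cabs (Gamma2 w1 w2 (Complex a u)) =
    expR (\int[mu]_(t in `]0, +oo[) re_gamma2_integrand w1 w2 K a u t) /
    cabs (\prod_(k < K) \prod_(l < K) (Complex a u + ofR (lattice w1 w2 k l))).
  apply: (etrans (cabsM _ _)); apply: (congr2 *%R _ (cabsV _)).
  apply: (etrans (cabs_cexp _)); congr expR.
  by apply: eq_Rintegral => t _; exact: Re_gamma2_integrand.
set I := Rintegral _ _ _; rewrite (expRD I) expRN; congr (_ / _).
rewrite cabs_prod expR_sum; apply: eq_bigr => k _.
rewrite cabs_prod expR_sum; apply: eq_bigr => l _.
rewrite /log_shift /cabs /= addr0 -!expr2.
set s := _ ^+ 2 + _; have s0 : 0 < s.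
  by rewrite /s ltr_wpDl ?sqr_ge0// exprn_even_gt0.
rewrite -[in LHS](lnK s0) (_ : ln s = ln s / 2 + ln s / 2); last by field.
rewrite expRD -expr2 sqrtr_sqr ger0_norm ?expR_ge0//.
by congr expR; field.
Qed.

Lemma gamma2_cutoff_gt (w : R) (x : R[i]) : w = w1 \/ w = w2 ->
  0 < complex.Re x + (gamma2_cutoff w1 w2 x)%:R * w.
Proof.
move=> ww; have w0 : 0 < w by case: ww => ->.
have c0 := cabs_ge0 x; have c1 : 0 <= cabs x / w1 by rewrite divr_ge0// ltW.
have c2 : 0 <= cabs x / w2 by rewrite divr_ge0// ltW.
have : cabs x / w < (gamma2_cutoff w1 w2 x)%:R.
  apply: (@le_lt_trans _ _ (cabs x / w1 + cabs x / w2)).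
    by case: ww => ->; [rewrite lerDl|rewrite lerDr].
  by apply: real_truncnS_gt; exact: num_real.
rewrite ltr_pdivrMr// => h.
by have := Re_le_cabs x; rewrite ler_norml => /andP[+ _]; lra.
Qed.

(** The cutoff of the definition and K are compared through their maximum. *)
Lemma cabs_Gamma2_cutoff K a u : u != 0 ->
  0 < a + K%:R * w1 -> 0 < a + K%:R * w2 ->
  cabs (Gamma2 w1 w2 (Complex a u)) = expR (log_gamma2 w1 w2 K a u).
Proof.
move=> u0 h1 h2; rewrite cabs_Gamma2//; congr expR.
set c := gamma2_cutoff w1 w2 (Complex a u).
have g1 : 0 < a + c%:R * w1.
  exact: (@gamma2_cutoff_gt w1 (Complex a u) (or_introl erefl)).
have g2 : 0 < a + c%:R * w2.
  exact: (@gamma2_cutoff_gt w2 (Complex a u) (or_intror erefl)).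
rewrite (log_gamma2_widen w1_gt0 w2_gt0 u (leq_maxr K c) g1 g2).
by rewrite (log_gamma2_widen w1_gt0 w2_gt0 u (leq_maxl K c) h1 h2).
Qed.

Lemma log_gamma2N K a u : log_gamma2 w1 w2 K a (- u) = log_gamma2 w1 w2 K a u.
Proof.
rewrite /log_gamma2 /log_shift; congr (_ - _).
  apply: eq_Rintegral => t _.
  by rewrite /re_gamma2_integrand /re_bern22 mulNr cosN sqrrN.
by apply: eq_bigr => k _; apply: eq_bigr => l _; rewrite mulrNN.
Qed.

Lemma cabs_S2 (x x' : R[i]) (L L' : R) : ofR (w1 + w2) - x = x' ->
  cabs (Gamma2 w1 w2 x) = expR L -> cabs (Gamma2 w1 w2 x') = expR L' ->
  cabs (S2 w1 w2 x) = expR (L' - L).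
Proof.
move=> <- e e'; apply: (etrans (cabsM _ _)).
apply: (etrans (congr2 *%R e' (etrans (cabsV _) (congr1 GRing.inv e)))).
by rewrite -expRN -expRD.
Qed.

(** log |1 / (S_2 (ix - h) S_2 (-ix - h))| at x = u + iv, with h = pi / n in the
    application; log_gamma2 is even in u. *)
Definition log_kernel K (h u v : R) : R :=
  log_gamma2 w1 w2 K (- v - h) u + log_gamma2 w1 w2 K (v - h) u -
  log_gamma2 w1 w2 K (w1 + w2 + v + h) u - log_gamma2 w1 w2 K (w1 + w2 - v + h) u.

Lemma cabs_kernel K (h V u v : R) : 0 <= h -> `|v| <= V -> u != 0 ->
  V + h < K%:R * w1 -> V + h < K%:R * w2 ->
  cabs (S2 w1 w2 (iR 1 * Complex u v - ofR h) *
        S2 w1 w2 (- (iR 1 * Complex u v) - ofR h))^-1 =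
  expR (log_kernel K h u v).
Proof.
move=> h0; rewrite ler_norml => /andP[vV1 vV2] u0 h1 h2.
have Nu0 : - u != 0 by rewrite oppr_eq0.
have w12 : 0 < w1 + w2 by rewrite addr_gt0.
have e1 : cabs (S2 w1 w2 (Complex (- v - h) u)) =
    expR (log_gamma2 w1 w2 K (w1 + w2 + v + h) (- u) -
          log_gamma2 w1 w2 K (- v - h) u).
  apply: (@cabs_S2 _ (Complex (w1 + w2 + v + h) (- u))).
  - by rewrite /ofR; simpc; congr Complex; ring.
  - by apply: cabs_Gamma2_cutoff => //; lra.
  - by apply: cabs_Gamma2_cutoff => //; lra.
have e2 : cabs (S2 w1 w2 (Complex (v - h) (- u))) =
    expR (log_gamma2 w1 w2 K (w1 + w2 - v + h) u -
          log_gamma2 w1 w2 K (v - h) (- u)).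
  apply: (@cabs_S2 _ (Complex (w1 + w2 - v + h) u)).
  - by rewrite /ofR; simpc; congr Complex; ring.
  - by apply: cabs_Gamma2_cutoff => //; lra.
  - by apply: cabs_Gamma2_cutoff => //; lra.
have -> : iR 1 * Complex u v - ofR h = Complex (- v - h) u.
  by rewrite /iR /ofR; simpc.
have -> : - (iR 1 * Complex u v) - ofR h = Complex (v - h) (- u).
  by rewrite /iR /ofR; simpc.
apply: (etrans (cabsV _)).
apply: (etrans (congr1 GRing.inv (etrans (cabsM _ _) (congr2 *%R e1 e2)))).
rewrite -expRD -expRN !log_gamma2N /log_kernel; congr expR; ring.
Qed.

(** y + u^2 >= u^2 and x + u^2 <= u^2 (1 + x) when u^2 >= 1.  So the finitely many
    lattice factors of phi contribute a bounded amount to log |phi|. *)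
Lemma log_shift_sub k l (a b u B : R) : 1 <= u ^+ 2 -> `|b| <= B ->
  log_shift w1 w2 k l b u - log_shift w1 w2 k l a u <=
  (B + lattice w1 w2 k l) ^+ 2 / 2.
Proof.
move=> u2 bB; have l0 := lattice_ge0 w1_gt0 w2_gt0 k l.
rewrite /log_shift -!expr2; set x := (b + _) ^+ 2; set y := (a + _) ^+ 2.
have x0 : 0 <= x by exact: sqr_ge0.
have y0 : 0 <= y by exact: sqr_ge0.
have u0 : 0 < u ^+ 2 by exact: lt_le_trans u2.
have xB : x <= (B + lattice w1 w2 k l) ^+ 2.
  rewrite /x -[(b + _) ^+ 2]real_normK ?num_real// lerXn2r ?nnegrE//.
    by rewrite addr_ge0// (le_trans _ bB).
  by rewrite (le_trans (ler_normD _ _))// (ger0_norm l0) lerD2r.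
have x1 : 0 < 1 + x by rewrite ltr_pwDl.
have lx : ln (x + u ^+ 2) <= ln (u ^+ 2) + ln (1 + x).
  have p1 : 0 < x + u ^+ 2 by rewrite ltr_wpDl.
  have p2 : 0 < u ^+ 2 * (1 + x) by rewrite mulr_gt0.
  rewrite -lnM ?posrE// ler_ln ?posrE//.
  by rewrite mulrDr mulr1 addrC lerD2l ler_peMl.
have ly : ln (u ^+ 2) <= ln (y + u ^+ 2).
  by rewrite ler_ln ?posrE ?ltr_wpDl// lerDr.
have l1 : ln (1 + x) <= x by rewrite le_ln1Dx// (lt_le_trans (ltrN10 _)).
lra.
Qed.

Section Remainder.
Variables (h V : R) (K : nat).
Hypotheses (h_ge0 : 0 <= h) (V_ge0 : 0 <= V).
Hypotheses (K1 : V + h < K%:R * w1) (K2 : V + h < K%:R * w2).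

Let A : R := 2 * (w1 + w2 + 2 * h) / (w1 * w2).

(** The sum of the four e^(-at), with cos (ut) factored out; the sign is that of the
    corresponding Gamma_2 in phi.  Times the lattice tail, it is the q_v(t) of the
    introduction. *)
Definition kernel_numerator v t : R :=
  expR (- ((- v - h) * t)) + expR (- ((v - h) * t)) -
  expR (- ((w1 + w2 + v + h) * t)) - expR (- ((w1 + w2 - v + h) * t)).

(** What is left of the integrand of log |phi|, without the factor cos (ut), when
    the leading singularity A / t^2 is split off. *)
Definition kernel_remainder v t : R :=
  (kernel_numerator v t * lattice_tail w1 w2 K t - A / t) / t.

(** The integral of the remainder would diverge at 0 if q_v(t) - A / t had a
    constant term; it has none because B_22 (x) = B_22 (w1 + w2 - x). *)
Lemma kernel_remainder_bound0 : exists2 M : R, 0 <= M &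
  forall v t, `|v| <= V -> 0 < t <= 1 -> `|kernel_remainder v t| <= M.
Proof.
have w1n0 := lt0r_neq0 w1_gt0; have w2n0 := lt0r_neq0 w2_gt0.
have w12 : 0 < w1 + w2 by rewrite addr_gt0.
have h0 := h_ge0; have V0 := V_ge0.
pose D v := `|v| <= V.
pose B := w1 + w2 + V + h.
have e1 := @expansion_exp R R D (fun v => - v - h) B.
have e2 := @expansion_exp R R D (fun v => v - h) B.
have e3 := @expansion_exp R R D (fun v => w1 + w2 + v + h) B.
have e4 := @expansion_exp R R D (fun v => w1 + w2 - v + h) B.
have bnd v : D v -> [/\ `|- v - h| <= B, `|v - h| <= B,
    `|w1 + w2 + v + h| <= B & `|w1 + w2 - v + h| <= B].
  rewrite /D /B !ler_norml => /andP[? ?].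
  by split; apply/andP; split; lra.
have {}e1 := e1 (fun v Dv => let: And4 p _ _ _ := bnd v Dv in p).
have {}e2 := e2 (fun v Dv => let: And4 _ p _ _ := bnd v Dv in p).
have {}e3 := e3 (fun v Dv => let: And4 _ _ p _ := bnd v Dv in p).
have {}e4 := e4 (fun v Dv => let: And4 _ _ _ p := bnd v Dv in p).
have eK r := @expansion_const R R D r.
have eN := expansionD (expansionD (expansionD e1 e2) (expansionM (eK (- 1)) e3))
  (expansionM (eK (- 1)) e4).
have [c1 [c2 eS]] := @expansion_lattice_sum R w1 w2 R D K.
have e := expansionD (expansionD
  (expansionM eN (expansion_lattice_den w1_gt0 w2_gt0 D))
  (expansionM (eK (- 1)) (expansion_sqrM (expansionM eN eS))))
  (expansionM (eK (- A)) (expansion_id D)).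
have {e} := expansion_eq (g := fun v t => t ^+ 3 * kernel_remainder v t)
  (d0 := fun=> 0) (d1 := fun=> 0) (d2 := fun=> 0) e.
case/(_ _ _)/expansion0_bound.
- move=> v t _ /andP[t0 _]; rewrite /kernel_remainder /lattice_tail /kernel_numerator.
  by field; rewrite !gt_eqF ?lattice_den_gt0.
- move=> v _; split; rewrite /A; field; rewrite ?w1n0 ?w2n0//.
- move=> M M0 hM; exists M => // v t vV t01; have := hM v t vV t01.
  rewrite mulrAC mulfV ?mul1r// gt_eqF// exprn_gt0//.
  by case/andP: t01.
Qed.

Lemma kernel_remainder_bound1 : exists2 M : R, 0 <= M &
  forall v t, `|v| <= V -> 1 <= t -> `|kernel_remainder v t| * t ^+ 2 <= M.
Proof.
have w12 : 0 < w1 + w2 by rewrite addr_gt0.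
have h0 := h_ge0; have V0 := V_ge0.
pose kappa := Num.min (K%:R * w1 - (V + h)) (K%:R * w2 - (V + h)).
have k0 : 0 < kappa by rewrite lt_min !subr_gt0 K1.
have k1 : kappa <= K%:R * w1 - (V + h) by rewrite ge_min lexx.
have k2 : kappa <= K%:R * w2 - (V + h) by rewrite ge_min lexx orbT.
have [M M0 hM] := lattice_tail_decay w1_gt0 w2_gt0 K k0.
exists (4 * M + `|A|); first by rewrite addr_ge0// mulr_ge0.
move=> v t; rewrite ler_norml => /andP[v1 v2] t1.
have t0 : 0 < t by exact: lt_le_trans t1.
have bnd a : - (V + h) <= a ->
    `|expR (- (a * t)) * lattice_tail w1 w2 K t * t| <= M.
  by move=> aV; rewrite normrM (gtr0_norm t0) hM//; lra.
rewrite -[X in _ * X](ger0_norm (x := t ^+ 2)) ?exprn_ge0 ?(ltW t0)// -normrM.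
have -> : kernel_remainder v t * t ^+ 2 =
    expR (- ((- v - h) * t)) * lattice_tail w1 w2 K t * t +
    expR (- ((v - h) * t)) * lattice_tail w1 w2 K t * t -
    expR (- ((w1 + w2 + v + h) * t)) * lattice_tail w1 w2 K t * t -
    expR (- ((w1 + w2 - v + h) * t)) * lattice_tail w1 w2 K t * t - A.
  by rewrite /kernel_remainder /kernel_numerator; field; rewrite gt_eqF.
have b1 := bnd (- v - h); have b2 := bnd (v - h).
have b3 := bnd (w1 + w2 + v + h); have b4 := bnd (w1 + w2 - v + h).
rewrite (le_trans (ler_normB _ _))// lerD2r.
rewrite (le_trans (ler_normB _ _))//.
rewrite (le_trans (lerD (ler_normB _ _) (lexx _)))//.
rewrite (le_trans (lerD (lerD (ler_normD _ _) (lexx _)) (lexx _)))//.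
have {}b1 := b1 ltac:(lra); have {}b2 := b2 ltac:(lra).
have {}b3 := b3 ltac:(lra); have {}b4 := b4 ltac:(lra).
lra.
Qed.

(** The integrand is cos (ut) times the remainder, which is integrable uniformly in
    u and v, minus A (1 - cos (ut)) / t^2, whose integral is A pi |u| / 2.  The lattice
    factors add the bounded amount L. *)
Lemma log_kernel_bound : exists C : R, forall u v, `|v| <= V -> 1 <= `|u| ->
  log_kernel K h u v <= C - pi * (w1 + w2 + 2 * h) / (w1 * w2) * `|u|.
Proof.
have w1n0 := lt0r_neq0 w1_gt0; have w2n0 := lt0r_neq0 w2_gt0.
have w12 : 0 < w1 + w2 by rewrite addr_gt0.
have h0 := h_ge0; have V0 := V_ge0; have k1 := K1; have k2 := K2.
have [M0 M0ge hM0] := kernel_remainder_bound0.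
have [M1 M1ge hM1] := kernel_remainder_bound1.
pose M := M0 + M1.
pose L := \sum_(k < K) \sum_(l < K) (w1 + w2 + V + h + lattice w1 w2 k l) ^+ 2.
exists (2 * M * (pi / 2) + L) => u v vV u1.
have /andP[v1 v2] : - V <= v <= V by rewrite -ler_norml.
have u0 : u != 0 by rewrite -normr_gt0 (lt_le_trans _ u1).
pose I a := \int[mu]_(t in `]0, +oo[) re_gamma2_integrand w1 w2 K a u t.
have lgE a : log_gamma2 w1 w2 K a u =
    I a - \sum_(k < K) \sum_(l < K) log_shift w1 w2 k l a u by [].
have val a : - (V + h) <= a ->
    half_line_value (re_gamma2_integrand w1 w2 K a u) (I a).
  move=> aV; have p1 : 0 < a + K%:R * w1 by lra.
  have p2 : 0 < a + K%:R * w2 by lra.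
  by have [J [hi hJ]] := half_line_re_gamma2 w1_gt0 w2_gt0 u p1 p2; split.
have a1 : - (V + h) <= - v - h by lra.
have a2 : - (V + h) <= v - h by lra.
have a3 : - (V + h) <= w1 + w2 + v + h by lra.
have a4 : - (V + h) <= w1 + w2 - v + h by lra.
have tot := half_lineB (half_lineB (half_lineD (val _ a1) (val _ a2)) (val _ a3)) (val _ a4).
have bd := half_lineB (half_lineZ (2 * M) (@half_line_oneDsqr R))
  (half_lineZ A (half_line_dirichlet u)).
have {tot bd} := half_line_le tot bd.
set I1 := I (- v - h); set I2 := I (v - h).
set I3 := I (w1 + w2 + v + h); set I4 := I (w1 + w2 - v + h).
have rM t : 0 < t -> `|kernel_remainder v t| <= 2 * M * (oneDsqr t)^-1.
  apply: le_oneDsqr => s hs.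
    by rewrite (le_trans (hM0 v s vV hs))// lerDl.
  by rewrite (le_trans (hM1 v s vV hs))// lerDr.
move=> hI.
have {}hI : I1 + I2 - I3 - I4 <= 2 * M * (pi / 2) - A * (pi / 2 * `|u|).
  apply: hI => t t0; have {}rM := rM t t0; set o := 2 * M * _ in rM *.
  have -> : re_gamma2_integrand w1 w2 K (- v - h) u t +
     re_gamma2_integrand w1 w2 K (v - h) u t -
     re_gamma2_integrand w1 w2 K (w1 + w2 + v + h) u t -
     re_gamma2_integrand w1 w2 K (w1 + w2 - v + h) u t =
     cos (u * t) * kernel_remainder v t - A * ((1 - cos (u * t)) * (t^-1 * t^-1)).
    rewrite /re_gamma2_integrand /kernel_remainder /kernel_numerator /re_bern22 /A.
    by field; rewrite w1n0 w2n0 gt_eqF.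
  rewrite lerD2r (le_trans _ rM)// (le_trans (ler_norm _))// normrM ler_piMl//.
  by rewrite ler_norml cos_geN1 cos_le1.
have u2 : 1 <= u ^+ 2 by rewrite -real_normK ?num_real// exprn_ege1.
have -> : log_kernel K h u v = I1 + I2 - I3 - I4 +
    \sum_(k < K) \sum_(l < K)
      ((log_shift w1 w2 k l (w1 + w2 + v + h) u - log_shift w1 w2 k l (- v - h) u) +
       (log_shift w1 w2 k l (w1 + w2 - v + h) u - log_shift w1 w2 k l (v - h) u)).
  rewrite /log_kernel !lgE -/I1 -/I2 -/I3 -/I4.
  under [X in _ = _ + X]eq_bigr do rewrite big_split /= !sumrB.
  by rewrite big_split /= !sumrB; ring.
have hS : \sum_(k < K) \sum_(l < K)
      ((log_shift w1 w2 k l (w1 + w2 + v + h) u - log_shift w1 w2 k l (- v - h) u) +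
       (log_shift w1 w2 k l (w1 + w2 - v + h) u - log_shift w1 w2 k l (v - h) u)) <= L.
  apply: ler_sum => k _; apply: ler_sum => l _.
  have b3 : `|w1 + w2 + v + h| <= w1 + w2 + V + h.
    by rewrite ler_norml; apply/andP; split; lra.
  have b4 : `|w1 + w2 - v + h| <= w1 + w2 + V + h.
    by rewrite ler_norml; apply/andP; split; lra.
  have H1 := log_shift_sub k l (- v - h) u2 b3.
  have H2 := log_shift_sub k l (v - h) u2 b4.
  by rewrite (le_trans (lerD H1 H2))// -splitr.
have -> : pi * (w1 + w2 + 2 * h) / (w1 * w2) * `|u| = A * (pi / 2 * `|u|).
  by rewrite /A; field; rewrite w1n0 w2n0.
lra.
Qed.

End Remainder.
End KernelDecay.

(** * Bounds at a distance from the poles *)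

Section PoleAvoidance.
Context {R : realType}.
Implicit Types (z p : R[i]) (f : R[i] -> R[i]).

Lemma phi_decay (n : nat) (rho V : R) : (0 < n)%N -> 0 < rho -> 0 <= V ->
  exists M : R, forall z, `|complex.Im z| <= V -> 1 <= `|complex.Re z| ->
    cabs (phi n rho z) <=
      M * expR (- ((n%:R / 4 + 3 / 2 * (pi / rho)) * `|complex.Re z|)).
Proof.
move=> n0 rho0 V0; have nR : 0 < n%:R :> R by rewrite ltr0n.
pose w2 : R := 4 * pi / n%:R; pose h : R := pi / n%:R.
have pi0 : 0 < pi :> R by exact: pi_gt0.
have w20 : 0 < w2 by rewrite divr_gt0// mulr_gt0.
have h0 : 0 <= h by rewrite divr_ge0// ltW.
pose K := (Num.truncn ((V + h) / rho + (V + h) / w2)).+1.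
have hK : (V + h) / rho + (V + h) / w2 < K%:R.
  by apply: real_truncnS_gt; exact: num_real.
have Vh : 0 <= V + h by rewrite addr_ge0.
have K1 : V + h < K%:R * rho.
  rewrite -ltr_pdivrMr// (le_lt_trans _ hK)// lerDl divr_ge0// ltW//.
have K2 : V + h < K%:R * w2.
  rewrite -ltr_pdivrMr// (le_lt_trans _ hK)// lerDr divr_ge0// ltW//.
have [C hC] := log_kernel_bound rho0 w20 h0 V0 K1 K2.
exists (expR C) => -[u v] /= vV u1.
have u0 : u != 0 by rewrite -normr_gt0 (lt_le_trans _ u1).
have -> : cabs (phi n rho (Complex u v)) = expR (log_kernel rho w2 K h u v).
  exact: (cabs_kernel rho0 w20 h0 vV u0 K1 K2).
rewrite -expRD ler_expR (le_trans (hC u v vV u1))// lerD2l lerN2.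
rewrite le_eqVlt; apply/orP; left; apply/eqP; rewrite /w2 /h.
have alg (q r s x : R) : q != 0 -> r != 0 -> s != 0 ->
    (r / 4 + 3 / 2 * (q / s)) * x =
    q * (s + 4 * q / r + 2 * (q / r)) / (s * (4 * q / r)) * x.
  by move=> q0 r0 s0; field; rewrite q0 r0 s0.
by apply: alg; rewrite gt_eqF.
Qed.

(** In the compact part |Re z| <= 1 of the strip, a point that is a pole has a
    neighbourhood without admissible z, and any other point has one in which f is
    bounded. *)
Lemma bounded_off_poles f (V d B : R) : 0 < d -> 0 <= B ->
  (exists M : R, forall z, `|complex.Im z| <= V -> 1 <= `|complex.Re z| ->
     cabs (f z) <= M * expR (- (B * `|complex.Re z|))) ->
  exists2 M : R, 0 <= M & forall z, `|complex.Im z| <= V ->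
     (forall p, is_pole f p -> d <= cabs (z - p)) ->
     cabs (f z) <= M * expR (- (B * `|complex.Re z|)).
Proof.
move=> d0 B0 [M hM].
pose A : set (R * R) := `[-1, 1]%classic `*` `[- V, V]%classic.
have cA : compact A by apply: compact_setX; exact: segment_compact.
pose P (m : R) (x : R * R) :=
  (forall p, is_pole f p -> d <= cabs (Complex x.1 x.2 - p)) ->
  cabs (f (Complex x.1 x.2)) <= m.
have close (x x' : R * R) e : 0 < e -> `|x'.1 - x.1| < e / 2 -> `|x'.2 - x.2| < e / 2 ->
    cabs (Complex x'.1 x'.2 - Complex x.1 x.2) < e.
  move=> e0 h1 h2; rewrite /cabs /= (@le_lt_trans _ _ (`|x'.1 - x.1| + `|x'.2 - x.2|))//; last lra.
  rewrite -[leRHS]ger0_norm ?addr_ge0// -sqrtr_sqr ler_wsqrtr//.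
  set a := x'.1 - x.1; set b := x'.2 - x.2.
  rewrite -(real_normK (num_real a)) -(real_normK (num_real b)).
  by have := normr_ge0 a; have := normr_ge0 b; nra.
have nearx (x : R * R) e : 0 < e -> \forall x' \near x,
    cabs (Complex x'.1 x'.2 - Complex x.1 x.2) < e.
  move=> e0; have e2 : 0 < e / 2 by rewrite divr_gt0.
  exists (ball x.1 (e / 2), ball x.2 (e / 2)); first by split; exact: nbhsx_ballx.
  by move=> x' [/= h1 h2]; apply: close => //; rewrite distrC.
have loc x : A x -> \forall x' \near x & m \near +oo, P m x'.
  move=> _; have [pole|npole] := pselect (is_pole f (Complex x.1 x.2)).
    exists ([set x' | cabs (Complex x'.1 x'.2 - Complex x.1 x.2) < d], setT).
      by split=> /=; [exact: nearx|exact: filterT].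
    by move=> [x' m] [/= hx' _] /(_ _ pole); rewrite leNgt hx'.
  have [e [M0 [e0 eM]]] : exists e M : R, 0 < e /\ forall y,
      0 < cabs (y - Complex x.1 x.2) < e -> cabs (f y) <= M.
    exact: contrapT.
  (* The bound near a point that is not a pole omits the point itself. *)
  pose M1 := Num.max M0 (cabs (f (Complex x.1 x.2))).
  exists ([set x' | cabs (Complex x'.1 x'.2 - Complex x.1 x.2) < e], [set m | M1 <= m]).
    split=> /=; first exact: nearx.
    by apply: nbhs_pinfty_ge; exact: num_real.
  move=> [x' m] [/= hx' hm] _; apply: le_trans hm.
  have [y0|] := ltP 0 (cabs (Complex x'.1 x'.2 - Complex x.1 x.2)).
    by rewrite /M1 le_max eM ?y0.
  move=> y0; have /eqP : cabs (Complex x'.1 x'.2 - Complex x.1 x.2) == 0.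
    by rewrite eq_le y0 cabs_ge0.
  rewrite cabsE => /ComplexField.Normc.eq0_normc/eqP; rewrite subr_eq0 => /eqP ->.
  by rewrite /M1 le_max lexx orbT.
have [m0 [_ hm0]] := (compact_near_coveringP A).1 cA R +oo P _ loc.
pose m := Num.max (m0 + 1) 0.
have m0' : 0 <= m by rewrite le_max lexx orbT.
have hm : A `<=` P m by apply: hm0; rewrite lt_max ltrDl ltr01.
exists (Num.max M (m * expR B)).
  by rewrite le_max mulr_ge0 ?expR_ge0 ?orbT.
move=> [u v] /= vV hp; have [u1|u1] := leP 1 `|u|.
  rewrite (le_trans (hM (Complex u v) vV u1))// ler_wpM2r ?expR_ge0//.
  by rewrite le_max lexx.
have Auv : A (u, v).
  by split; rewrite /= in_itv/= -ler_norml// ltW.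
rewrite (le_trans (hm (u, v) Auv hp))//.
apply: (@le_trans _ _ (m * expR B * expR (- (B * `|u|)))).
  rewrite -mulrA -expRD ler_peMr// -expR0 ler_expR.
  by rewrite subr_ge0 ler_piMr// ltW.
by rewrite ler_wpM2r ?expR_ge0// le_max lexx orbT.
Qed.

End PoleAvoidance.

(** * The factors of w and W as products over pairs of variables *)

Section LevelFactors.
Context {R : realType}.
Implicit Types (z : R[i]) (a : R) (g : gammas R).

Lemma cabs_sum (I : Type) (s : seq I) (P : pred I) (F : I -> R[i]) :
  cabs (\sum_(i <- s | P i) F i) <= \sum_(i <- s | P i) cabs (F i).
Proof.
elim/big_rec2: _ => [|i y1 y2 _ h]; first by rewrite cabs0.
by rewrite (le_trans (cabsD _ _))// lerD2l.
Qed.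

Lemma cabs_prod_le (I : Type) (s : seq I) (P : pred I) (F : I -> R[i])
    (e : I -> R) : (forall i, P i -> cabs (F i) <= expR (e i)) ->
  cabs (\prod_(i <- s | P i) F i) <= expR (\sum_(i <- s | P i) e i).
Proof.
move=> Fe; rewrite cabs_prod expR_sum; apply: ler_prod => i Pi.
by rewrite cabs_ge0 Fe.
Qed.

Lemma oppr_le_norm (x : R) : - x <= `|x|.
Proof. by rewrite -normrN ler_norm. Qed.

Lemma Re_ofRM a z : complex.Re (ofR a * z) = a * complex.Re z.
Proof. by case: z => x y; rewrite /ofR; simpc. Qed.

Lemma Re_add (x y : R[i]) : complex.Re (x + y) = complex.Re x + complex.Re y.
Proof. by case: x; case: y. Qed.

Lemma Re_opp (x : R[i]) : complex.Re (- x) = - complex.Re x.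
Proof. by case: x. Qed.

Lemma cabs_sh z : cabs (sh z) <= expR `|complex.Re z|.
Proof.
rewrite /sh cabsM cabsV.
have -> : cabs (2%:R : R[i]) = 2.
  by rewrite ofR_nat /cabs /= expr0n addr0 sqrtr_sqr ger0_norm.
rewrite ler_pdivrMr// (le_trans (cabsD _ _))// cabsN !cabs_cexp.
have h1 : expR (complex.Re z) <= expR `|complex.Re z| by rewrite ler_expR ler_norm.
have h2 : expR (complex.Re (- z)) <= expR `|complex.Re z|.
  by rewrite ler_expR Re_opp oppr_le_norm.
lra.
Qed.

Lemma Im_sub (x y : R[i]) : complex.Im (x - y) = complex.Im x - complex.Im y.
Proof. by case: x; case: y. Qed.

(** For equal rows neither sh occurs, and the exponential of that row takes their
    place: with this convention every pair of variables has exactly one factor. *)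
Definition level_pair (n : nat) a (r r' : nat) z : R[i] :=
  if (r' < r)%N then sh (ofR a * (z + iR (pi / n%:R)))
  else if (r < r')%N then sh (ofR a * (z - iR (pi / n%:R)))
  else cexp (- (ofR a * z)).

(** sh and exp grow at the same rate, so the three cases need not be distinguished
    in the estimates. *)
Lemma cabs_level_pair n a r r' z : 0 <= a ->
  cabs (level_pair n a r r' z) <= expR (a * `|complex.Re z|).
Proof.
move=> a0; have na x : a * `|x| = `|a * x| by rewrite normrM ger0_norm.
rewrite /level_pair; case: ifP => _.
  by rewrite (le_trans (cabs_sh _))// Re_ofRM Re_add /= addr0 na.
case: ifP => _.
  by rewrite (le_trans (cabs_sh _))// Re_ofRM Re_add Re_opp /= subr0 na.
by rewrite cabs_cexp Re_opp Re_ofRM ler_expR na oppr_le_norm.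
Qed.

Section Rows.
Variables (N n : nat) (nu : nat -> nat) (J : {ffun 'I_N -> 'I_n}).
Hypothesis JZ : inZ nu J.

Lemma rowsE j :
  rows J j = map (@nat_of_ord N) [seq r <- enum 'I_N | (j <= J r)%N].
Proof. by []. Qed.

Lemma size_rows j : (j <= n)%N -> size (rows J j) = nu j.
Proof.
move=> jn; have jn' : (j < n.+1)%N by [].
have /forallP/(_ (Ordinal jn'))/eqP /= <- := JZ.
rewrite rowsE size_map size_filter -sum1_count big_enum_cond -sum1_card /=.
by apply: eq_bigl => r; rewrite inE.
Qed.

Lemma uniq_rows j : uniq (rows J j).
Proof.
rewrite rowsE map_inj_uniq; last by move=> x y /= xy; exact: ord_inj.
by apply: filter_uniq; exact: enum_uniq.
Qed.

Lemma rows_pred j : {subset rows J j <= rows J j.-1}.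
Proof.
move=> r; rewrite !rowsE => /mapP[k].
rewrite mem_filter => /andP[jk _] ->.
apply: map_f; rewrite mem_filter mem_enum inE andbT.
exact: leq_trans (leq_pred j) jk.
Qed.

Lemma index_row_of j m : (j <= n)%N -> (m < nu j)%N ->
  index (row_of J j m) (rows J j) = m.
Proof. by move=> jn mj; rewrite /row_of index_uniq ?size_rows ?uniq_rows. Qed.

Lemma prod_rows (F : nat -> R[i]) j : (j <= n)%N ->
  \prod_(r <- rows J j) F r = \prod_(m < nu j) F (row_of J j m).
Proof. by move=> jn; rewrite (big_nth N) size_rows// big_mkord. Qed.

(** Since J_r >= j implies J_r >= j - 1, every row of level j occurs once in
    level j - 1. *)
Lemma prod_eq_row (F : nat -> R[i]) j m : (0 < j <= n)%N -> (m < nu j)%N ->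
  F (index (row_of J j m) (rows J j.-1)) =
  \prod_(m' < nu j.-1 | row_of J j.-1 m' == row_of J j m) F m'.
Proof.
move=> /andP[j0 jn] mj; have j1n : (j.-1 <= n)%N by exact: leq_trans (leq_pred j) jn.
have rj : row_of J j m \in rows J j.-1.
  by apply: rows_pred; rewrite /row_of mem_nth// size_rows.
have im : (index (row_of J j m) (rows J j.-1) < nu j.-1)%N.
  by rewrite -(size_rows j1n) index_mem.
rewrite (big_pred1 (Ordinal im))// => m' /=.
rewrite -[RHS]val_eqE /=; apply/eqP/eqP => [<-|->].
  by rewrite index_row_of.
by rewrite /row_of nth_index.
Qed.

Lemma level_factorE a g j : (0 < j <= n)%N ->
  level_factor nu a J g j = \prod_(m < nu j) \prod_(m' < nu j.-1)
    level_pair n a (row_of J j m) (row_of J j.-1 m') (g j m - g j.-1 m').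
Proof.
move=> /[dup] j0n /andP[j0 jn].
rewrite /level_factor prod_rows// -big_split /=; apply: eq_bigr => m _.
rewrite /alpha (index_row_of jn (ltn_ord m)).
rewrite (prod_eq_row (fun i => cexp (ofR a * (g j.-1 i - g j m))) j0n (ltn_ord m)).
rewrite big_mkcond [X in _ * (X * _)]big_mkcond [X in _ * (_ * X)]big_mkcond.
rewrite -!big_split /=; apply: eq_bigr => m' _; rewrite /level_pair.
case: (ltngtP (row_of J j.-1 m') (row_of J j m)) => _; rewrite ?mulr1 ?mul1r//.
by rewrite -mulrN opprB.
Qed.

Section Permuted.
Variable s : forall j, 'S_(nu j).

Definition level_perm j : 'S_(nu j) := if j == 0%N then 1%g else s j.

Lemma permute_allE g j (m : 'I_(nu j)) :
  permute_all s g j m = g j (level_perm j m).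
Proof.
rewrite /permute_all /level_perm; case: eqP => [j0|_]; last by rewrite /perm_nat valK.
by rewrite perm1; congr (g _ _); rewrite j0.
Qed.

Lemma permuted_rowE j (m : 'I_(nu j)) :
  permuted_row J s j (level_perm j m) = row_of J j m.
Proof.
rewrite /permuted_row /level_perm; case: eqP => [j0|_]; first by rewrite perm1.
by rewrite /perm_nat valK permK.
Qed.

(** In this form each pair of variables has its own factor, to be combined with the
    factor of phi whose poles it may cancel. *)
Lemma level_factor_permute a g j : (0 < j <= n)%N ->
  level_factor nu a J (permute_all s g) j =
  \prod_(m < nu j) \prod_(m' < nu j.-1)
    level_pair n a (permuted_row J s j m) (permuted_row J s j.-1 m')
      (g j m - g j.-1 m').
Proof.
move=> j0n; rewrite level_factorE//.
rewrite [RHS](reindex_inj (@perm_inj _ (level_perm j))); apply: eq_bigr => m _.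
rewrite [RHS](reindex_inj (@perm_inj _ (level_perm j.-1))); apply: eq_bigr => m' _.
by rewrite !permute_allE !permuted_rowE.
Qed.

End Permuted.

End Rows.
End LevelFactors.

(** * Growth of w and W *)

Section Growth.
Context {R : realType} (n N : nat) (nu : nat -> nat).
Implicit Types (x y : nat -> nat -> R) (g : gammas R) (a c : R).

Definition re g : nat -> nat -> R := fun j m => complex.Re (g j m).

Definition pair_dist x j : R :=
  \sum_(m < nu j) \sum_(m' < nu j.-1) `|x j m - x j.-1 m'|.

Definition self_dist x j : R :=
  \sum_(m < nu j) \sum_(m' < nu j) `|x j m - x j m'|.

(** The relation under which all exponents below are invariant; skew-symmetrization
    and the permuted terms only rearrange variables within a level. *)
Definition rearranges y x : Prop :=
  forall j, exists p : 'S_(nu j), forall m : 'I_(nu j), y j m = x j (p m).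

Lemma pair_dist_rearranges y x j : rearranges y x -> pair_dist y j = pair_dist x j.
Proof.
move=> yx; have [p hp] := yx j; have [q hq] := yx j.-1.
rewrite /pair_dist [RHS](reindex_inj (@perm_inj _ p)); apply: eq_bigr => m _.
rewrite [RHS](reindex_inj (@perm_inj _ q)); apply: eq_bigr => m' _.
by rewrite hp hq.
Qed.

Lemma self_dist_rearranges y x j : rearranges y x -> self_dist y j = self_dist x j.
Proof.
move=> yx; have [p hp] := yx j.
rewrite /self_dist [RHS](reindex_inj (@perm_inj _ p)); apply: eq_bigr => m _.
rewrite [RHS](reindex_inj (@perm_inj _ p)); apply: eq_bigr => m' _.
by rewrite !hp.
Qed.

Lemma rearranges_permute_all (s : forall j, 'S_(nu j)) g :
  rearranges (re (permute_all s g)) (re g).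
Proof. by move=> j; exists (level_perm s j) => m; rewrite /re permute_allE. Qed.

Lemma rearranges_permute_level j (s : 'S_(nu j)) g :
  rearranges (re (permute_level j s g)) (re g).
Proof.
move=> j'; rewrite /re /permute_level; case: eqP => [->|_].
  by exists s => m; rewrite /perm_nat valK.
by exists 1%g => m; rewrite perm1.
Qed.

Lemma sum_lt_half (k : nat) (F : 'I_k -> 'I_k -> R) :
  (forall m m', F m m' = F m' m) -> (forall m, F m m = 0) ->
  \sum_(m < k) \sum_(m' < k | (m < m')%N) F m m' =
  (\sum_(m < k) \sum_(m' < k) F m m') / 2.
Proof.
move=> Fsym F0; set S := LHS.
have -> : \sum_(m < k) \sum_(m' < k) F m m' = S + S.
  rewrite {2}/S [X in _ = _ + X](exchange_big_dep xpredT)//= -big_split /=; apply: eq_bigr => m _.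
  rewrite [X in _ = X + _]big_mkcond [X in _ = _ + X]big_mkcond -big_split /=.
  apply: eq_bigr => m' _; case: ltngtP => [_|_|/val_inj ->].
  - by rewrite addr0.
  - by rewrite add0r Fsym.
  - by rewrite F0 addr0.
by field.
Qed.

Lemma cabs_sh_self a c g j : 0 <= a ->
  cabs (\prod_(m < nu j) \prod_(m' < nu j | (m < m')%N)
          sh (ofR a * (g j m' - g j m - iR c))) <=
  expR (a * (self_dist (re g) j / 2)).
Proof.
move=> a0; rewrite /self_dist.
rewrite -(@sum_lt_half _ (fun m m' : 'I_(nu j) => `|re g j m - re g j m'|)); last first.
- by move=> m; rewrite subrr normr0.
- by move=> m m'; rewrite distrC.
rewrite mulr_sumr; apply: cabs_prod_le => m _.
rewrite mulr_sumr; apply: cabs_prod_le => m' _.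
rewrite (le_trans (cabs_sh _))// ler_expR Re_ofRM !Re_add !Re_opp /= subr0.
by rewrite normrM (ger0_norm a0) distrC.
Qed.

Lemma cabs_level_factor (J : {ffun 'I_N -> 'I_n}) a g j : inZ nu J -> 0 <= a ->
  (0 < j <= n)%N ->
  cabs (level_factor nu a J g j) <= expR (a * pair_dist (re g) j).
Proof.
move=> JZ a0 j0n; rewrite (level_factorE JZ)// mulr_sumr.
apply: cabs_prod_le => m _; rewrite mulr_sumr; apply: cabs_prod_le => m' _.
by rewrite (le_trans (cabs_level_pair _ _ _ _ a0))// Re_add Re_opp.
Qed.

Definition small_growth a x : R :=
  \sum_(1 <= j < n) (a * pair_dist x j + a * (self_dist x j / 2)).

Definition big_growth a x : R := \sum_(1 <= j < n) a * pair_dist x j.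

Lemma cabs_g_small (J : {ffun 'I_N -> 'I_n}) rho g : inZ nu J -> 0 < rho ->
  cabs (g_small nu rho J g) <= expR (small_growth (pi / rho) (re g)).
Proof.
move=> JZ rho0; have a0 : 0 <= pi / rho by rewrite divr_ge0 ?pi_ge0// ltW.
rewrite /g_small /small_growth [X in cabs X]big_seq_cond [X in expR X]big_seq_cond.
apply: cabs_prod_le => j; rewrite mem_index_iota andbT => /andP[j0 jn].
rewrite cabsM expRD; apply: ler_pM; rewrite ?cabs_ge0//.
  by apply: cabs_level_factor; rewrite ?j0 ?(ltnW jn).
exact: cabs_sh_self.
Qed.

Lemma cabs_G_big (J : {ffun 'I_N -> 'I_n}) g : inZ nu J ->
  cabs (G_big nu J g) <= expR (big_growth (n%:R / 4) (re g)).
Proof.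
move=> JZ; have a0 : 0 <= n%:R / 4 :> R by rewrite divr_ge0.
rewrite /G_big /big_growth [X in cabs X]big_seq_cond [X in expR X]big_seq_cond.
apply: cabs_prod_le => j; rewrite mem_index_iota andbT => /andP[j0 jn].
by apply: cabs_level_factor; rewrite ?j0 ?(ltnW jn).
Qed.

Lemma small_growth_rearranges a y x : rearranges y x ->
  small_growth a y = small_growth a x.
Proof.
move=> yx; apply: eq_bigr => j _.
by rewrite (pair_dist_rearranges _ yx) (self_dist_rearranges _ yx).
Qed.

Lemma big_growth_rearranges a y x : rearranges y x ->
  big_growth a y = big_growth a x.
Proof. by move=> yx; apply: eq_bigr => j _; rewrite (pair_dist_rearranges _ yx). Qed.

Lemma cabs_sign (b : bool) : cabs ((-1) ^+ b : R[i]) = 1.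
Proof. by case: b; rewrite ?expr1 ?expr0 ?cabsN cabs1. Qed.

(** Each skew-symmetrization multiplies the constant by the number of permutations,
    because the exponent B does not see them. *)
Lemma cabs_Skew_all (X : gammas R -> R[i]) (B : (nat -> nat -> R) -> R) :
  (forall y x, rearranges y x -> B y = B x) ->
  (forall g, cabs (X g) <= expR (B (re g))) ->
  exists2 c, 0 <= c & forall g, cabs (Skew_all n nu X g) <= c * expR (B (re g)).
Proof.
move=> Binv XB; rewrite /Skew_all.
have {XB} : exists2 c, 0 <= c & forall g, cabs (X g) <= c * expR (B (re g)).
  by exists 1 => // g; rewrite mul1r.
elim: (iota 1 n.-1) X => [|j l IH] X //= [c c0 Xc].
apply: IH; exists (\sum_(s : 'S_(nu j)) c); first exact: sumr_ge0.
move=> g; rewrite /Skew (le_trans (cabs_sum _ _ _))// mulr_suml.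
apply: ler_sum => s _; rewrite cabsM cabs_sign mul1r (le_trans (Xc _))//.
by rewrite (Binv _ _ (rearranges_permute_level s g)).
Qed.

Lemma cabs_lincomb (X : {ffun 'I_N -> 'I_n} -> gammas R -> R[i])
    (B : (nat -> nat -> R) -> R) (c : {ffun 'I_N -> 'I_n} -> R[i]) :
  (forall J, inZ nu J -> exists2 M, 0 <= M & forall g,
    cabs (X J g) <= M * expR (B (re g))) ->
  exists2 M, 0 <= M & forall g,
    cabs (\sum_(J | inZ nu J) c J * X J g) <= M * expR (B (re g)).
Proof.
move=> XB.
have /choice[M hM] : forall J, exists M, 0 <= M /\ (inZ nu J -> forall g,
    cabs (X J g) <= M * expR (B (re g))).
  move=> J; case: (boolP (inZ nu J)) => [/XB[M M0 h]|_]; last by exists 0.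
  by exists M.
exists (\sum_(J | inZ nu J) cabs (c J) * M J).
  by apply: sumr_ge0 => J _; rewrite mulr_ge0 ?cabs_ge0//; case: (hM J).
move=> g; rewrite (le_trans (cabs_sum _ _ _))// mulr_suml; apply: ler_sum => J JZ.
by rewrite cabsM -mulrA ler_wpM2l ?cabs_ge0//; case: (hM J) => _; exact.
Qed.

Lemma in_F_growth rho w : 0 < rho -> in_F n N nu rho w ->
  exists2 M, 0 <= M & forall g,
    cabs (w g) <= M * expR (small_growth (pi / rho) (re g)).
Proof.
move=> rho0 [c wE]; have [|M M0 hM] := @cabs_lincomb
    (fun J => Skew_all n nu (g_small nu rho J)) (small_growth (pi / rho)) c.
  move=> J JZ; apply: cabs_Skew_all; first exact: small_growth_rearranges.
  by move=> g; exact: cabs_g_small.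
by exists M => // g; rewrite wE.
Qed.

Lemma in_W_growth W : in_W n N nu W ->
  exists2 M, 0 <= M & forall g,
    cabs (W g) <= M * expR (big_growth (n%:R / 4) (re g)).
Proof.
move=> [c WE]; have [|M M0 hM] := @cabs_lincomb
    (fun J => Skew_all n nu (G_big nu J)) (big_growth (n%:R / 4)) c.
  move=> J JZ; apply: cabs_Skew_all; first exact: big_growth_rearranges.
  by move=> g; exact: cabs_G_big.
by exists M => // g; rewrite WE.
Qed.

End Growth.

(** * Distances as sums of distances between indicators *)

Section LayerCake.
Context {R : realType}.
Implicit Types (x y a : R) (s : seq R).

Lemma gaps_below a s x : path <=%R a s -> x <= a ->
  \sum_(p <- zip (a :: s) s) (p.2 - p.1) * (p.1 < x)%R%:R = 0.
Proof.
elim: s a => [|b s IH] a /=; first by rewrite big_nil.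
move=> /andP[ab bs] xa; rewrite big_cons /= ltNge xa mulr0 add0r.
by rewrite IH// (le_trans xa).
Qed.

(** Only the gaps to the left of x are counted, and they add up to x - a. *)
Lemma gaps_telescope a s x : path <=%R a s -> x \in a :: s ->
  \sum_(p <- zip (a :: s) s) (p.2 - p.1) * (p.1 < x)%R%:R = x - a.
Proof.
elim: s a => [|b s IH] a.
  by rewrite inE => _ /eqP ->; rewrite big_nil subrr.
move=> /[dup] ps /= /andP[ab bs]; rewrite inE => /predU1P[->|xs].
  by rewrite (@gaps_below a (b :: s)) ?subrr.
rewrite big_cons /= IH//.
have bx : b <= x.
  move: xs; rewrite inE => /predU1P[->//|xs].
  by move: bs; rewrite le_path_sortedE => /andP[/allP h _]; exact: h.
have [ax|xa] := ltP a x; first by rewrite mulr1; ring.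
have -> : x = a by apply/le_anti; rewrite xa (le_trans ab).
have -> : b = a by apply/le_anti; rewrite ab (le_trans bx).
by rewrite mulr0 add0r.
Qed.

Lemma gaps_dist a s x y : path <=%R a s -> x \in a :: s -> y \in a :: s ->
  `|x - y| =
  \sum_(p <- zip (a :: s) s) (p.2 - p.1) * `|(p.1 < x)%R%:R - (p.1 < y)%R%:R|.
Proof.
move=> ps xs ys; wlog xy : x y xs ys / x <= y.
  move=> h; have [/h->//|/ltW yx] := leP x y.
  rewrite distrC h//; apply: eq_bigr => p _; by rewrite distrC.
rewrite distrC ger0_norm ?subr_ge0//.
have -> : y - x = (y - a) - (x - a) by ring.
rewrite -(gaps_telescope ps ys) -(gaps_telescope ps xs) -sumrB.
apply: eq_bigr => p _; rewrite -mulrBr distrC ger0_norm// subr_ge0.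
by have [px|_] := ltP p.1 x; rewrite ?(lt_le_trans px xy).
Qed.

End LayerCake.

(** * The energy inequality *)

Section Energy.
Context {R : realType} (n : nat) (nu : nat -> nat).
Hypothesis n_gt1 : (1 < n)%N.
Hypothesis nu_n : nu n = 0%N.
Hypothesis nu_0 : (0 < nu 0)%N.
Hypothesis nu_convex : forall j : nat, (1 <= j <= n.-1)%N ->
  (2 * nu j <= nu j.-1 + nu j.+1)%N.
Implicit Types (x y : nat -> nat -> R) (D : R -> R -> R) (b : nat -> nat -> bool).

(** Integrality of the counts enters the proof only here. *)
Lemma natr_sqr_sub (p q : nat) : p%:R - q%:R <= (p%:R - q%:R) ^+ 2 :> R.
Proof.
have [pq|qp] := leqP p q.
  have : p%:R <= q%:R :> R by rewrite ler_nat.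
  by move=> h; rewrite (@le_trans _ _ 0) ?sqr_ge0// subr_le0.
have : q%:R + 1 <= p%:R :> R by rewrite natr1 ler_nat.
nra.
Qed.

(** The quadratic form is that of the Cartan matrix of type A, written as a sum of
    squares; k is arbitrary for the induction, which leaves the boundary terms. *)
Lemma cartan_form (c v : nat -> R) k : c 0%N = 0 ->
  \sum_(1 <= j < k.+1) (c j * v j.-1 + c j.-1 * v j - 2 * (c j * c j.-1) -
     2 * (c j * v j) + 2 * c j ^+ 2) =
  \sum_(1 <= j < k.+1) c j * (v j.-1 + v j.+1 - 2 * v j) - c k * v k.+1 +
  \sum_(1 <= j < k.+1) (c j - c j.-1) ^+ 2 + c k ^+ 2.
Proof.
move=> c0; elim: k => [|k IH].
  by rewrite !big_nil//= ?big_geq// c0; ring.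
by rewrite !(big_nat_recr k.+1)//= IH; ring.
Qed.

Lemma cartan_form_ge (c : nat -> nat) : c 0%N = 0%N ->
  n%:R^-1 * \sum_(1 <= j < n) (c j)%:R <=
  \sum_(1 <= j < n) ((c j)%:R * (nu j.-1)%:R + (c j.-1)%:R * (nu j)%:R -
    2 * ((c j)%:R * (c j.-1)%:R) - 2 * ((c j)%:R * (nu j)%:R) + 2 * (c j)%:R ^+ 2)
    :> R.
Proof.
move=> c0; have n0 : (0 < n)%N by exact: ltnW.
have en : n = n.-1.+1 by rewrite prednK.
set T := \sum_(1 <= j < n) ((c j)%:R - (c j.-1)%:R) ^+ 2 : R.
apply: (@le_trans _ _ T); last first.
  have c0' : (c 0%N)%:R = 0 :> R by rewrite c0.
  have := @cartan_form (fun j => (c j)%:R) (fun j => (nu j)%:R) n.-1 c0'.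
  rewrite -en nu_n mulr0 subr0 -/T => ->.
  rewrite -[leLHS]add0r -addrA; apply: lerD; last first.
    by rewrite lerDl sqr_ge0.
  rewrite big_seq_cond sumr_ge0// => j; rewrite mem_index_iota andbT => /andP[j1 jn].
  rewrite mulr_ge0// subr_ge0 -natrM -natrD ler_nat nu_convex// j1 /=.
  by rewrite -ltnS prednK.
have T0 : 0 <= T by apply: sumr_ge0 => j _; exact: sqr_ge0.
have cT k : (k < n)%N -> (c k)%:R <= T.
  move=> kn; apply: (@le_trans _ _ (\sum_(1 <= j < k.+1) ((c j)%:R - (c j.-1)%:R) ^+ 2)).
    elim: k {kn} => [|k IH]; first by rewrite big_geq// c0.
    rewrite big_nat_recr//= -[leLHS](subrK (c k)%:R) addrC.
    by apply: lerD => //; exact: natr_sqr_sub.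
  rewrite /T [leRHS](big_cat_nat (n := k.+1))//= lerDl.
  by apply: sumr_ge0 => j _; exact: sqr_ge0.
have : \sum_(1 <= j < n) (c j)%:R <= n%:R * T :> R.
  apply: (@le_trans _ _ (\sum_(1 <= j < n) T)).
    rewrite big_seq_cond [leRHS]big_seq_cond; apply: ler_sum => j.
    by rewrite mem_index_iota andbT => /andP[_ /cT].
  by rewrite sumr_const_nat -[leLHS]mulr_natl ler_wpM2r// ler_nat leq_subr.
by rewrite ler_pdivrMl// ltr0n.
Qed.

(** D is kept abstract because the inequality is proved for D u v = |u - v| by
    linearity in D.  Level 0 is constant, and x 0 0 is its value. *)
Definition energy D x : R := \sum_(1 <= j < n) (
  (\sum_(m < nu j) \sum_(m' < nu j.-1) D (x j m) (x j.-1 m')) -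
  (\sum_(m < nu j) \sum_(m' < nu j) D (x j m) (x j m')) -
  n%:R^-1 * \sum_(m < nu j) D (x j m) (x 0%N 0%N)).

Lemma energy_linear D1 D2 x (c : R) :
  energy (fun u v => c * D1 u v + D2 u v) x = c * energy D1 x + energy D2 x.
Proof.
rewrite /energy mulr_sumr -big_split /=; apply: eq_bigr => j _.
have s2 (p q : nat) (f : 'I_p -> R) (g : 'I_q -> R) :
    \sum_(m < p) \sum_(m' < q) (c * D1 (f m) (g m') + D2 (f m) (g m')) =
    c * (\sum_(m < p) \sum_(m' < q) D1 (f m) (g m')) +
    \sum_(m < p) \sum_(m' < q) D2 (f m) (g m').
  rewrite mulr_sumr -big_split /=; apply: eq_bigr => m _.
  by rewrite mulr_sumr -big_split.
have s1 (p : nat) (f : 'I_p -> R) (z : R) :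
    \sum_(m < p) (c * D1 (f m) z + D2 (f m) z) =
    c * (\sum_(m < p) D1 (f m) z) + \sum_(m < p) D2 (f m) z.
  by rewrite mulr_sumr -big_split.
by rewrite !s2 s1; ring.
Qed.

Lemma eq_energy D1 D2 x :
  (forall j m k l, (j < n)%N -> (m < nu j)%N -> (k < n)%N -> (l < nu k)%N ->
     D1 (x j m) (x k l) = D2 (x j m) (x k l)) -> energy D1 x = energy D2 x.
Proof.
move=> D12; rewrite /energy big_seq_cond [RHS]big_seq_cond; apply: eq_bigr => j.
rewrite mem_index_iota andbT => /andP[j0 jn].
have j1n : (j.-1 < n)%N by exact: leq_ltn_trans (leq_pred j) jn.
congr (_ - _ - _ * _).
- by apply: eq_bigr => m _; apply: eq_bigr => m' _; exact: D12.
- by apply: eq_bigr => m _; apply: eq_bigr => m' _; exact: D12.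
- by apply: eq_bigr => m _; apply: D12 => //; exact: ltnW.
Qed.

Lemma sum_bool_dist (p q : nat) (f : 'I_p -> bool) (g : 'I_q -> bool) :
  \sum_(m < p) \sum_(m' < q) `|(f m)%:R - (g m')%:R| =
  (\sum_(m < p) f m)%:R * q%:R + p%:R * (\sum_(m' < q) g m')%:R -
  2 * ((\sum_(m < p) f m)%:R * (\sum_(m' < q) g m')%:R) :> R.
Proof.
have e (u v : bool) : `|u%:R - v%:R| = u%:R * 1 + 1 * v%:R - 2 * (u%:R * v%:R) :> R.
  by case: u; case: v => /=; rewrite ?subrr ?subr0 ?sub0r ?normrN ?normr0 ?normr1; lra.
under eq_bigr do (under eq_bigr do rewrite e).
rewrite !natr_sum.
under eq_bigr => m _.
  rewrite sumrB big_split /= -!mulr_sumr sumr_const card_ord.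
  over.
rewrite /= sumrB big_split /= sumr_const card_ord -mulr_suml -!mulr_sumr.
by rewrite -mulr_suml mul1r -[X in _ + X - _]mulr_natl.
Qed.

(** Exchanging 0 and 1 changes no distance, so level 0 may be taken to be 0. *)
Lemma energy_bool b : (forall m, b 0%N m = b 0%N 0%N) ->
  0 <= energy (fun u v => `|u - v|) (fun j m => (b j m)%:R).
Proof.
wlog b00 : b / b 0%N 0%N = false.
  move=> h b0; case E : (b 0%N 0%N); last exact: h.
  have := h (fun j m => ~~ b j m); rewrite E => /(_ erefl)/wrap[].
  move=> /(_ (fun m => congr1 negb (etrans (b0 m) E))).
  congr (0 <= _); rewrite /energy.
  have e (u v : bool) : `|(~~ u)%:R - (~~ v)%:R| = `|u%:R - v%:R| :> R.
    by case: u; case: v => /=; rewrite ?subrr// distrC.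
  apply: eq_bigr => j _; congr (_ - _ - _ * _); apply: eq_bigr => m _; rewrite ?e//.
    by apply: eq_bigr => m' _; rewrite e.
  by apply: eq_bigr => m' _; rewrite e.
move=> b0; pose c j := (\sum_(m < nu j) b j m)%N.
have c0 : c 0%N = 0%N by apply: big1 => m _; rewrite b0 b00.
rewrite /energy; have := cartan_form_ge c0.
rewrite -subr_ge0 mulr_sumr -sumrB.
congr (0 <= _); apply: eq_bigr => j _.
rewrite !sum_bool_dist -/(c j) -/(c j.-1).
have -> : \sum_(m < nu j) `|(b j m)%:R - (b 0%N 0%N)%:R| = (c j)%:R :> R.
  by rewrite natr_sum; apply: eq_bigr => m _; rewrite b00 subr0 normr_nat.
ring.
Qed.

Lemma energy_ge0 x : (forall m, x 0%N m = 0) -> 0 <= energy (fun u v => `|u - v|) x.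
Proof.
move=> x0.
(* The values of x on all levels, level 0 included, are the breakpoints. *)
pose vals := 0 :: [seq x v.1 v.2 | v <- [seq (j, m) | j <- iota 0 n, m <- iota 0 (nu j)]].
have mem_vals j m : (j < n)%N -> (m < nu j)%N -> x j m \in sort <=%R vals.
  move=> jn mj; rewrite mem_sort inE; apply/orP; right.
  apply: (map_f (fun v => x v.1 v.2) (x := (j, m))).
  by apply/allpairsPdep; exists j, m; rewrite !mem_iota.
have : sorted <=%R (sort <=%R vals) by exact: sort_le_sorted.
case: (sort _ _) mem_vals => [/(_ 0%N 0%N)|a s mem_vals /= ps].
  by rewrite (ltnW n_gt1) nu_0 => /(_ erefl erefl).
rewrite (@eq_energy _ (fun u v => \sum_(p <- zip (a :: s) s)
    (p.2 - p.1) * `|(p.1 < u)%R%:R - (p.1 < v)%R%:R|)); last first.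
  by move=> j m k l jn mj kn lk; apply: gaps_dist => //; exact: mem_vals.
have : all (fun p => p.1 <= p.2) (zip (a :: s) s).
  by elim: s a ps {mem_vals} => //= b s IH a /andP[-> /IH].
elim: (zip _ _) => [_|p l IH /= /andP[p12 /IH {}IH]].
  rewrite /energy big1// => j _.
  rewrite [X in X - _ - _]big1 => [|m _]; last by rewrite big1// => m' _; rewrite big_nil.
  rewrite [X in _ - X - _]big1 => [|m _]; last by rewrite big1// => m' _; rewrite big_nil.
  by rewrite [X in _ * X]big1 ?mulr0 ?subrr// => m _; rewrite big_nil.
rewrite (@eq_energy _ (fun u v => (p.2 - p.1) * `|(p.1 < u)%R%:R - (p.1 < v)%R%:R| +
    \sum_(q <- l) (q.2 - q.1) * `|(q.1 < u)%R%:R - (q.1 < v)%R%:R|)); last first.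
  by move=> *; rewrite big_cons.
rewrite energy_linear addr_ge0// mulr_ge0 ?subr_ge0//.
have := @energy_bool (fun j m => p.1 < x j m).
by apply => m; rewrite !x0.
Qed.

End Energy.

(** * Iterated integrals *)

Section IteratedIntegrals.
Context {R : realType}.
Local Notation mu := (@lebesgue_measure R).

(** For nonnegative functions the integral is a supremum over simple functions, so
    no measurability is required.  This avoids discussing the measurability of phi
    and of the contours. *)
Lemma ge0_le_integralT (f g : R -> \bar R) :
  (forall x, 0 <= f x)%E -> (forall x, f x <= g x)%E ->
  (\int[mu]_x f x <= \int[mu]_x g x)%E.
Proof.
move=> f0 fg; have g0 x : (0 <= g x)%E by exact: le_trans (fg x).
rewrite !ge0_integralTE//; apply: ereal_sup_le => _ [h hf <-].
by exists h => // x; exact: le_trans (hf x) (fg x).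
Qed.

Lemma integral_expR_abs (e : R) : 0 < e ->
  (\int[mu]_u (expR (- (`|u| * e)))%:E = (2 / e)%:E)%E.
Proof.
move=> e0; rewrite ge0_symfun_integralT; last 3 first.
- by move=> u; exact: expR_ge0.
- move=> u; apply: continuous_comp; last exact: continuous_expR.
  apply: cvgN; apply: cvgM; last exact: cvg_cst.
  exact: norm_continuous.
- by move=> u /=; rewrite normrN.
rewrite -set_itvcy -integral_itv_obnd_cbnd; last first.
  apply/measurable_EFinP; apply: continuous_half_line => u _.
  apply: continuous_comp; last exact: continuous_expR.
  apply: cvgN; apply: cvgM; last exact: cvg_cst.
  exact: norm_continuous.
have -> : (\int[mu]_(u in `]0%R, +oo[) (expR (- (`|u| * e)))%:E =
    \int[mu]_(u in `]0%R, +oo[) (1 * expR (- (u * e)))%:E)%E.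
  apply: eq_integral => u; rewrite inE/= in_itv/= andbT => u0.
  by rewrite mul1r gtr0_norm.
by rewrite laplace_cst// mul0r oppr0 expR0 mul1r.
Qed.

Lemma iterated_integral_ge0 vars (F : param R -> \bar R) t :
  (forall t, 0 <= F t)%E -> (0 <= iterated_integral vars F t)%E.
Proof.
move=> F0; elim: vars t => [|[j m] vars IH] t //=.
by apply: integral_ge0 => u _; exact: IH.
Qed.

(** G collects the factors of the variables that are already fixed. *)
Lemma iterated_integral_prod (h : R -> R) (H : R) vars (F : param R -> \bar R)
    (G : param R -> R) :
  measurable_fun setT h -> (forall u, 0 <= h u) -> 0 <= H ->
  (\int[mu]_u (h u)%:E = H%:E)%E -> uniq vars ->
  (forall t, 0 <= F t)%E -> (forall t, 0 <= G t) ->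
  (forall j m t u, (j, m) \in vars -> G (upd t j m u) = G t) ->
  (forall t, F t <= (G t * \prod_(v <- vars) h (t v.1 v.2))%:E)%E ->
  forall t, (iterated_integral vars F t <= (G t * H ^+ size vars)%:E)%E.
Proof.
move=> mh h0 H0 hH; elim: vars G => [|[j m] vars IH] G /=.
  by move=> _ _ _ _ FG t; have := FG t; rewrite big_nil.
move=> /andP[jm uv] F0 G0 Gupd FG t.
pose G' (t : param R) := G t * h (t j m).
have {}IH : forall t, (iterated_integral vars F t <= (G' t * H ^+ size vars)%:E)%E.
  apply: IH => //.
  - by move=> t'; rewrite mulr_ge0.
  - move=> j' m' t' u v'; rewrite /G' Gupd ?inE ?v' ?orbT//.
    rewrite /upd; case: andP => // -[/eqP ej /eqP em].
    by move: jm; rewrite ej em v'.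
  - by move=> t'; have := FG t'; rewrite big_cons /= mulrA.
apply: (@le_trans _ _ (\int[mu]_u ((G t * H ^+ size vars)%:E * (h u)%:E))%E).
  apply: ge0_le_integralT => u; first exact: iterated_integral_ge0.
  rewrite (le_trans (IH _))// /G' Gupd ?mem_head// -EFinM lee_fin.
  by rewrite /upd !eqxx /= mulrAC.
rewrite ge0_integralZl//; last 3 first.
- exact/measurable_EFinP.
- by move=> u _; rewrite lee_fin.
- by rewrite lee_fin mulr_ge0// exprn_ge0.
by rewrite hH -EFinM -mulrA -exprSr.
Qed.

End IteratedIntegrals.

(** * From exponential decay to absolute convergence *)

Section Convergence.
Context {R : realType} (n N : nat) (rho : R) (nu : nat -> nat) (beta : nat -> R[i]).
Hypothesis n_gt1 : (1 < n)%N.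
Hypothesis N_gt0 : (0 < N)%N.
Hypothesis nu_0 : nu 0%N = N.
Hypothesis nu_n : nu n = 0%N.
Hypothesis nu_convex : forall j : nat, (1 <= j <= n.-1)%N ->
  (2 * nu j <= nu j.-1 + nu j.+1)%N.
Implicit Types (C : contours R) (t : param R) (F : gammas R -> R[i]).

(** The pairs of variables with a factor phi; level j - 1 may be level 0. *)
Definition is_pair j m m' := is_variable n nu j m && (m' < nu j.-1)%N.

Lemma sum_variables (f : nat -> nat -> R) :
  \sum_(v <- variables n nu) f v.1 v.2 = \sum_(1 <= j < n) \sum_(m < nu j) f j m.
Proof.
rewrite /variables big_flatten /= big_map /index_iota subn1.
apply: eq_bigr => j _; rewrite big_map /= -(big_mkord xpredT (fun m => f j m)).
by rewrite /index_iota subn0.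
Qed.

Lemma mem_variables j m : ((j, m) \in variables n nu) = is_variable n nu j m.
Proof.
have n0 : (0 < n)%N by exact: ltnW.
rewrite /variables /is_variable; apply/allpairsPdep/idP => [[k [l [kI lI [-> ->]]]]|].
  move: kI lI; rewrite !mem_iota !add0n add1n prednK// => /andP[k1 kn] /andP[_ lk].
  by rewrite k1 kn lk.
by move=> /and3P[j0 jn mj]; exists j, m; rewrite !mem_iota j0 !add0n mj add1n prednK.
Qed.

Lemma uniq_variables : uniq (variables n nu).
Proof.
rewrite /variables; apply: allpairs_uniq_dep; rewrite ?iota_uniq//.
  by move=> j _; rewrite iota_uniq.
by move=> [j m] [k l] _ _ /= [-> ->].
Qed.

Section OneSystem.
Variables (f : nat -> nat -> nat -> R[i] -> R[i]) (C : contours R).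
Hypothesis CS : contour_system n nu rho beta f C.

(** The contours stay at bounded distance from the real line, and so do the finitely
    many beta_m, which are compared with 0. *)
Lemma on_contours_bounded : exists2 K : R, 0 <= K &
  [/\ forall j m t, (j < n)%N -> (m < nu j)%N ->
        `|complex.Im (on_contours beta C t j m)| <= K,
      forall j m t, (j < n)%N -> (m < nu j)%N ->
        `|re (on_contours beta C t) j m - (if j == 0%N then 0 else t j m)| <= K
    & forall j m t, is_variable n nu j m -> cabs (velocity C j m t) <= K].
Proof.
have [K hK] := contour_bounded CS.
pose B : R := \sum_(m < N) cabs (beta m).
have B0 : 0 <= B by apply: sumr_ge0 => m _; exact: cabs_ge0.
have bB m : (m < N)%N -> cabs (beta m) <= B.
  move=> mN; rewrite /B (bigD1 (Ordinal mN))//= lerDl.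
  by apply: sumr_ge0 => i _; exact: cabs_ge0.
have KK : K <= `|K| + B by rewrite (le_trans (ler_norm K))// lerDl.
have BK : B <= `|K| + B by rewrite lerDr.
exists (`|K| + B); first by rewrite addr_ge0.
split.
- move=> j m t jn mj; rewrite /on_contours; case: eqP => [j0|/eqP j0].
    by rewrite (le_trans (Im_le_cabs _))// (le_trans _ BK)// bB// -nu_0 -j0.
  have [|h _] := hK j m t; first by rewrite /is_variable lt0n j0 jn mj.
  rewrite (le_trans _ KK)// (le_trans _ h)// (le_trans _ (Im_le_cabs _))//.
  by rewrite Im_sub /= subr0.
- move=> j m t jn mj; rewrite /re /on_contours; case: eqP => [j0|/eqP j0].
    by rewrite subr0 (le_trans (Re_le_cabs _))// (le_trans _ BK)// bB// -nu_0 -j0.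
  have [|h _] := hK j m t; first by rewrite /is_variable lt0n j0 jn mj.
  rewrite (le_trans _ KK)// (le_trans _ h)// (le_trans _ (Re_le_cabs _))//.
  by rewrite Re_add Re_opp.
- by move=> j m t jm; rewrite (le_trans _ KK)//; case: (hK j m t jm).
Qed.

(** Passes from the points on the contours to the real parameters. *)
Lemma growth_bounded_shift (x y : nat -> nat -> R) (K : R) :
  (forall j m, (j < n)%N -> (m < nu j)%N -> `|x j m - y j m| <= K) ->
  \sum_(1 <= j < n) (pair_dist nu y j - self_dist nu y j) -
    2 * K * (\sum_(1 <= j < n) (nu j * nu j.-1 + nu j * nu j))%:R <=
  \sum_(1 <= j < n) (pair_dist nu x j - self_dist nu x j).
Proof.
move=> xyK; rewrite natr_sum mulr_sumr -sumrB big_seq_cond [leRHS]big_seq_cond.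
apply: ler_sum => j; rewrite mem_index_iota andbT => /andP[j0 jn].
have dist (u v u' v' : R) : `|u - u'| <= K -> `|v - v'| <= K ->
    `|u' - v'| - 2 * K <= `|u - v|.
  have -> : u' - v' = (u - v) - (u - u') + (v - v') by ring.
  have := ler_normD ((u - v) - (u - u')) (v - v').
  have := ler_normB (u - v) (u - u'); lra.
have sum2 (p q : nat) (G H : 'I_p -> 'I_q -> R) :
    (forall m m', G m m' - 2 * K <= H m m') ->
    \sum_(m < p) \sum_(m' < q) G m m' - 2 * K * (p * q)%:R <=
    \sum_(m < p) \sum_(m' < q) H m m'.
  move=> GH; rewrite lerBlDr.
  have -> : 2 * K * (p * q)%:R = \sum_(m < p) \sum_(m' < q) (2 * K).
    by rewrite !sumr_const !card_ord -mulrnA mulr_natr mulnC.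
  rewrite -big_split /=; apply: ler_sum => m _; rewrite -big_split /=.
  by apply: ler_sum => m' _; rewrite -lerBlDr.
have j1n : (j.-1 < n)%N by exact: leq_ltn_trans (leq_pred j) jn.
have h1 : pair_dist nu y j - 2 * K * (nu j * nu j.-1)%:R <= pair_dist nu x j.
  by apply: sum2 => m m'; apply: dist; exact: xyK.
have h2 : self_dist nu x j - 2 * K * (nu j * nu j)%:R <= self_dist nu y j.
  by apply: sum2 => m m'; apply: dist; rewrite distrC; exact: xyK.
rewrite natrD; lra.
Qed.

Lemma abs_convergent_decay F (a M : R) : 0 < a -> 0 <= M ->
  (forall t, cabs (F (on_contours beta C t)) <=
     M * expR (- (a * \sum_(1 <= j < n)
       (pair_dist nu (re (on_contours beta C t)) j -
        self_dist nu (re (on_contours beta C t)) j)))) ->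
  abs_convergent n nu beta C F.
Proof.
move=> a0 M0 hF; have [K K0 [_ hre hvel]] := on_contours_bounded.
pose e := a / n%:R.
have n0 : 0 < n%:R :> R by rewrite ltr0n (ltnW n_gt1).
have e0 : 0 < e by rewrite divr_gt0.
pose Q := 2 * K * (\sum_(1 <= j < n) (nu j * nu j.-1 + nu j * nu j))%:R.
pose c := M * expR (a * Q) * K ^+ size (variables n nu).
have c0 : 0 <= c by rewrite !mulr_ge0 ?expR_ge0// exprn_ge0.
have bnd t : abs_density n nu beta C F t <=
    c * \prod_(v <- variables n nu) expR (- (`|t v.1 v.2| * e)).
  rewrite /abs_density /c -mulrA [_ ^+ _ * _]mulrC mulrA; apply: ler_pM.
  - exact: cabs_ge0.
  - by apply: prodr_ge0 => v _; exact: cabs_ge0.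
  - rewrite (le_trans (hF t))// -mulrA ler_wpM2l// -expR_sum -expRD ler_expR.
    pose y j m : R := if j == 0%N then 0 else t j m.
    have h1 := @growth_bounded_shift (re (on_contours beta C t)) y K
      (fun j m jn mj => hre j m t jn mj).
    have n0' : (0 < nu 0)%N by rewrite nu_0.
    have h2 : n%:R^-1 * (\sum_(1 <= j < n) \sum_(m < nu j) `|y j m - y 0%N 0%N|) <=
        \sum_(1 <= j < n) (pair_dist nu y j - self_dist nu y j).
      have := @energy_ge0 R n nu n_gt1 nu_n n0' nu_convex y (fun m => erefl).
      by rewrite /energy sumrB subr_ge0 -mulr_sumr.
    have h3 : \sum_(v <- variables n nu) - (`|t v.1 v.2| * e) =
        - (a * (n%:R^-1 * \sum_(1 <= j < n) \sum_(m < nu j) `|y j m - y 0%N 0%N|)).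
      rewrite (sum_variables (fun j m => - (`|t j m| * e))) mulrA -/e.
      rewrite mulr_sumr -sumrN big_seq_cond [RHS]big_seq_cond.
      apply: eq_bigr => j; rewrite mem_index_iota andbT => /andP[j1 _].
      rewrite mulr_sumr -sumrN; apply: eq_bigr => m _.
      by rewrite /y eqxx gtn_eqF// subr0 mulrC.
    rewrite h3; move: h1 h2; rewrite -/Q.
    set S1 := \sum_(_ <= _ < _) _; set S2 := \sum_(_ <= _ < _) _.
    set S3 := n%:R^-1 * _ => h1 h2; nra.
  - have -> : K ^+ size (variables n nu) = \prod_(v <- variables n nu) K.
      by rewrite big_const_seq count_predT iter_mulr_1.
    rewrite big_seq_cond [leRHS]big_seq_cond; apply: ler_prod.
    move=> [j m]; rewrite andbT mem_variables => jm.
    by rewrite cabs_ge0 hvel.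
have mh : measurable_fun setT (fun u : R => expR (- (`|u| * e))).
  apply: continuous_measurable_fun => u; apply: continuous_comp; last exact: continuous_expR.
  apply: cvgN; apply: cvgM; last exact: cvg_cst.
  exact: norm_continuous.
rewrite /abs_convergent.
apply: (@le_lt_trans _ _ (c * (2 / e) ^+ size (variables n nu))%:E); last exact: ltry.
apply: (@iterated_integral_prod _ (fun u => expR (- (`|u| * e))) (2 / e) _ _ (fun=> c)) => //.
- by rewrite divr_ge0// ltW.
- exact: integral_expR_abs.
- exact: uniq_variables.
- move=> t; rewrite lee_fin mulr_ge0 ?cabs_ge0//.
  by apply: prodr_ge0 => v _; exact: cabs_ge0.
Qed.

End OneSystem.
End Convergence.

(** * The integrand on the contours *)

Section Proposition.
Context {R : realType} (n N : nat) (rho : R) (nu : nat -> nat) (beta : nat -> R[i]).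
Hypothesis n_gt1 : (1 < n)%N.
Hypothesis N_gt0 : (0 < N)%N.
Hypothesis rho_gt0 : 0 < rho.
Hypothesis nu_0 : nu 0%N = N.
Hypothesis nu_n : nu n = 0%N.
Hypothesis nu_convex : forall j : nat, (1 <= j <= n.-1)%N ->
  (2 * nu j <= nu j.-1 + nu j.+1)%N.

(** The constants M may depend on the pair: there are finitely many of them, and only
    their product is used. *)
Lemma factor_on_contours (f : nat -> nat -> nat -> R[i] -> R[i])
    (B : nat -> nat -> nat -> R) (C : contours R) :
  contour_system n nu rho beta f C -> (forall j m m', 0 <= B j m m') ->
  (forall j m m' V, 0 <= V -> exists M : R, forall z,
     `|complex.Im z| <= V -> 1 <= `|complex.Re z| ->
     cabs (f j m m' z) <= M * expR (- (B j m m' * `|complex.Re z|))) ->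
  exists M : nat -> nat -> nat -> R, (forall j m m', 0 <= M j m m') /\
    forall j m m' t, is_pair n nu j m m' ->
    let z := on_contours beta C t j m - on_contours beta C t j.-1 m' in
    cabs (f j m m' z) <= M j m m' * expR (- (B j m m' * `|complex.Re z|)).
Proof.
move=> CS B0 fB.
have [K K0 [hIm _ _]] := on_contours_bounded nu_0 CS.
have [d d0 hd] := contour_avoids CS.
have V0 : 0 <= K + K by rewrite addr_ge0.
have H (p : nat * nat * nat) : exists M : R, 0 <= M /\ forall t,
    is_pair n nu p.1.1 p.1.2 p.2 ->
    let z := on_contours beta C t p.1.1 p.1.2 - on_contours beta C t p.1.1.-1 p.2 in
    cabs (f p.1.1 p.1.2 p.2 z) <=
      M * expR (- (B p.1.1 p.1.2 p.2 * `|complex.Re z|)).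
  case: p => -[j m] m' /=.
  have [M M0 hM] := bounded_off_poles d0 (B0 j m m') (fB j m m' _ V0).
  exists M; split=> // t /andP[jm mm]; apply: hM.
    have /and3P[j0 jn mj] := jm.
    rewrite Im_sub (le_trans (ler_normB _ _))//; apply: lerD; apply: hIm => //.
    exact: leq_ltn_trans (leq_pred j) jn.
  by move=> p pole; exact: (hd _ _ _ t p jm mm pole).
have /choice[M hM] := H.
exists (fun j m m' => M (j, m, m')); split=> [j m m'|j m m' t jm].
  by case: (hM (j, m, m')).
by case: (hM (j, m, m')) => _; exact.
Qed.

Lemma pair_product_bound (G : nat -> nat -> nat -> R[i])
    (M : nat -> nat -> nat -> R) (x : nat -> nat -> R) (e : R) :
  (forall j m m', 0 <= M j m m') ->
  (forall j m m', is_pair n nu j m m' ->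
     cabs (G j m m') <= M j m m' * expR (- (e * `|x j m - x j.-1 m'|))) ->
  cabs (\prod_(1 <= j < n) \prod_(m < nu j) \prod_(m' < nu j.-1) G j m m') <=
  (\prod_(1 <= j < n) \prod_(m < nu j) \prod_(m' < nu j.-1) M j m m') *
  expR (- (e * \sum_(1 <= j < n) pair_dist nu x j)).
Proof.
move=> M0 GM; rewrite -mulNr mulr_sumr expR_sum -big_split /= cabs_prod.
rewrite big_seq_cond [leRHS]big_seq_cond; apply: ler_prod => j.
rewrite mem_index_iota andbT => /andP[j0 jn]; rewrite cabs_ge0 cabs_prod /=.
rewrite mulr_sumr expR_sum -big_split /=; apply: ler_prod => m _.
rewrite cabs_prod prodr_ge0 => [/=|m' _]; last exact: cabs_ge0.
rewrite mulr_sumr expR_sum -big_split /=; apply: ler_prod => m' _.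
by rewrite cabs_ge0 mulNr GM// /is_pair /is_variable j0 jn !ltn_ord.
Qed.

Let a : R := pi / rho.
Let b : R := n%:R / 4.

Lemma small_rate_gt0 : 0 < a. Proof. by apply: divr_gt0 => //; exact: pi_gt0. Qed.
Lemma big_rate_ge0 : 0 <= b. Proof. by rewrite divr_ge0. Qed.

Lemma small_growthE (c : R) x : small_growth n nu c x =
  c * \sum_(1 <= j < n) pair_dist nu x j + c / 2 * \sum_(1 <= j < n) self_dist nu x j.
Proof.
rewrite /small_growth !mulr_sumr -big_split /=; apply: eq_bigr => j _; ring.
Qed.

Lemma big_growthE (c : R) x : big_growth n nu c x =
  c * \sum_(1 <= j < n) pair_dist nu x j.
Proof. by rewrite /big_growth mulr_sumr. Qed.

Lemma convergent_one_system (w W : gammas R -> R[i]) (C : contours R) :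
  in_F n N nu rho w -> in_W n N nu W ->
  contour_system n nu rho beta (fun _ _ _ => phi n rho) C ->
  abs_convergent n nu beta C (integrand n nu rho w W).
Proof.
move=> wF WW CS; have a0 := small_rate_gt0; have b0 := big_rate_ge0.
have [Mw Mw0 hw] := in_F_growth rho_gt0 wF.
have [MW MW0 hW] := in_W_growth WW.
have [//|j m m' V V0|M [M0 hM]] := factor_on_contours
  (B := fun _ _ _ => b + 3 / 2 * a) CS.
- by rewrite addr_ge0// mulr_ge0// ltW.
- by apply: phi_decay => //; exact: ltnW.
pose P := \prod_(1 <= j < n) \prod_(m < nu j) \prod_(m' < nu j.-1) M j m m'.
have P0 : 0 <= P.
  by apply: prodr_ge0 => j _; apply: prodr_ge0 => m _; apply: prodr_ge0 => m' _.
have a20 : 0 < a / 2 by lra.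
have PM0 : 0 <= P * Mw * MW by rewrite !mulr_ge0.
apply: (abs_convergent_decay n_gt1 N_gt0 nu_0 nu_n nu_convex CS a20 PM0) => t.
set g := on_contours beta C t.
rewrite /integrand cabsM [cabs (_ * w g)]cabsM.
have h1 : cabs (\prod_(1 <= j < n) \prod_(m < nu j) \prod_(m' < nu j.-1)
      phi n rho (g j m - g j.-1 m')) <=
    P * expR (- ((b + 3 / 2 * a) * \sum_(1 <= j < n) pair_dist nu (re g) j)).
  apply: (pair_product_bound (G := fun j m m' => phi n rho (g j m - g j.-1 m'))).
    exact: M0.
  by move=> j m m' jm; have := hM j m m' t jm; rewrite /= Re_add Re_opp.
have {}hw := hw g; have {}hW := hW g.
apply: (le_trans (ler_pM _ (cabs_ge0 _) (ler_pM (cabs_ge0 _) (cabs_ge0 _) h1 hw) hW)).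
  by rewrite mulr_ge0 ?cabs_ge0.
have mulE (p q r x y z : R) : p * x * (q * y) * (r * z) = p * q * r * (x * y * z).
  by ring.
rewrite mulE -!expRD ler_wpM2l// ler_expR small_growthE big_growthE sumrB.
rewrite -/a -/b; lra.
Qed.

Lemma pair_factorE (c : R) (J : {ffun 'I_N -> 'I_n}) (s : forall j, 'S_(nu j))
    j m m' (z : R[i]) :
  level_pair n c (permuted_row J s j m) (permuted_row J s j.-1 m') z =
  pair_factor c J s j m m' z *
  (if permuted_row J s j m == permuted_row J s j.-1 m' then cexp (- (ofR c * z)) else 1).
Proof.
by rewrite /level_pair /pair_factor; case: ltngtP => _; rewrite ?mulr1 ?mul1r.
Qed.

Lemma cabs_pair_factor (c : R) (J : {ffun 'I_N -> 'I_n}) (s : forall j, 'S_(nu j))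
    j m m' (z : R[i]) : 0 <= c ->
  cabs (pair_factor c J s j m m' z) <=
  expR ((permuted_row J s j m != permuted_row J s j.-1 m')%:R * c * `|complex.Re z|).
Proof.
move=> c0; have := @cabs_level_pair R n c (permuted_row J s j m)
  (permuted_row J s j.-1 m') z c0.
rewrite pair_factorE; case: eqP => [e|_]; last by rewrite mulr1 mul1r.
by rewrite /pair_factor e ltnn cabs1 !mul0r expR0.
Qed.

(** Complements [cabs_pair_factor]: for each pair exactly one of the two bounds is
    not trivial. *)
Lemma cabs_row_exp (c : R) (r r' : nat) (z : R[i]) : 0 <= c ->
  cabs (if r == r' then cexp (- (ofR c * z)) else 1) <=
  expR ((r == r')%:R * c * `|complex.Re z|).
Proof.
move=> c0; case: eqP => _; last by rewrite cabs1 !mul0r expR0.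
rewrite cabs_cexp Re_opp Re_ofRM ler_expR mul1r -[X in X * `|_|](ger0_norm c0) -normrM.
exact: oppr_le_norm.
Qed.

(** Here the contours only avoid the poles of phi times the two pair factors, so this
    product has to be estimated as a whole.  Its rate is that of phi minus those of
    the pair factors that occur; for the pairs in the same row the exponentials
    supply the difference, and every pair ends with the rate a / 2. *)
Lemma convergent_term (J K : {ffun 'I_N -> 'I_n}) (s s' : forall j, 'S_(nu j))
    (C : contours R) : inZ nu J -> inZ nu K ->
  contour_system n nu rho beta
    (fun j m m' z => phi n rho z * pair_factor a J s j m m' z
                     * pair_factor b K s' j m m' z) C ->
  abs_convergent n nu beta C
    (integrand n nu rho
       (fun g => g_small nu rho J (permute_all s g))
       (fun g => G_big nu K (permute_all s' g))).
Proof.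
move=> JZ KZ CS; have a0 := small_rate_gt0; have b0 := big_rate_ge0.
pose dJ j m m' : bool := permuted_row J s j m == permuted_row J s j.-1 m'.
pose dK j m m' : bool := permuted_row K s' j m == permuted_row K s' j.-1 m'.
pose B j m m' : R := b + 3 / 2 * a - (~~ dJ j m m')%:R * a - (~~ dK j m m')%:R * b.
have [j m m'|j m m' V V0|M [M0 hM]] := factor_on_contours (B := B) CS.
- by rewrite /B; case: (dJ _ _ _); case: (dK _ _ _) => /=; lra.
- have [M hM] := phi_decay (ltnW n_gt1) rho_gt0 V0; exists M => z zV z1.
  have p1 := @cabs_pair_factor a J s j m m' z (ltW a0).
  have p2 := @cabs_pair_factor b K s' j m m' z b0.
  have {}hM := hM z zV z1.
  rewrite 2!cabsM; apply: (le_trans (ler_pM _ (cabs_ge0 _)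
    (ler_pM (cabs_ge0 _) (cabs_ge0 _) hM p1) p2)).
    by rewrite mulr_ge0 ?cabs_ge0.
  have mulE (p x y v : R) : p * x * y * v = p * (x * y * v) by ring.
  rewrite mulE -!expRD le_eqVlt; apply/orP; left; apply/eqP.
  by congr (_ * expR _); rewrite /B /dJ /dK -/a -/b; ring.
pose P := \prod_(1 <= j < n) \prod_(m < nu j) \prod_(m' < nu j.-1) M j m m'.
have P0 : 0 <= P.
  by apply: prodr_ge0 => j _; apply: prodr_ge0 => m _; apply: prodr_ge0 => m' _.
have a20 : 0 < a / 2 by lra.
apply: (abs_convergent_decay n_gt1 N_gt0 nu_0 nu_n nu_convex CS a20 P0) => t.
set g := on_contours beta C t.
pose Z j m m' := g j m - g j.-1 m'.
pose H j m m' := phi n rho (Z j m m') *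
  level_pair n a (permuted_row J s j m) (permuted_row J s j.-1 m') (Z j m m') *
  level_pair n b (permuted_row K s' j m) (permuted_row K s' j.-1 m') (Z j m m').
have -> : integrand n nu rho (fun g => g_small nu rho J (permute_all s g))
    (fun g => G_big nu K (permute_all s' g)) g =
  (\prod_(1 <= j < n) \prod_(m < nu j) \prod_(m' < nu j.-1) H j m m') *
  \prod_(1 <= j < n) \prod_(m < nu j) \prod_(m' < nu j | (m < m')%N)
     sh (ofR a * (permute_all s g j m' - permute_all s g j m - iR (2 * pi / n%:R))).
  rewrite /integrand /g_small /G_big -!big_split /=.
  rewrite big_seq_cond [RHS]big_seq_cond; apply: eq_bigr => j.
  rewrite mem_index_iota andbT => /andP[j0 jn].
  rewrite !level_factor_permute ?j0 ?(ltnW jn)//.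
  have split3 (F1 F2 F3 : 'I_(nu j) -> 'I_(nu j.-1) -> R[i]) :
      \prod_m \prod_m' (F1 m m' * F2 m m' * F3 m m') =
      (\prod_m \prod_m' F1 m m') * (\prod_m \prod_m' F2 m m') *
      (\prod_m \prod_m' F3 m m').
    rewrite -!big_split /=; apply: eq_bigr => m _; by rewrite -!big_split.
  rewrite [in RHS]split3 /Z /a /b; ring.
have h1 : cabs (\prod_(1 <= j < n) \prod_(m < nu j) \prod_(m' < nu j.-1) H j m m') <=
    P * expR (- (a / 2 * \sum_(1 <= j < n) pair_dist nu (re g) j)).
  apply: (pair_product_bound (G := H)); first exact: M0.
  move=> j m m' jm; have {}hM := hM j m m' t jm.
  have -> : re g j m - re g j.-1 m' = complex.Re (Z j m m').
    by rewrite /Z /re Re_add Re_opp.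
  rewrite /H !pair_factorE -/(dJ j m m') -/(dK j m m').
  set z := Z j m m' in hM *.
  have e1 := @cabs_row_exp a (permuted_row J s j m) (permuted_row J s j.-1 m') z (ltW a0).
  have e2 := @cabs_row_exp b (permuted_row K s' j m) (permuted_row K s' j.-1 m') z b0.
  have shuffle (p q r x y : R[i]) : p * (q * x) * (r * y) = p * q * r * (x * y) by ring.
  rewrite shuffle [X in X <= _]cabsM.
  rewrite [X in _ * X <= _]cabsM.
  apply: (le_trans (ler_pM (cabs_ge0 _) _ hM (ler_pM (cabs_ge0 _) (cabs_ge0 _) e1 e2))).
    by rewrite mulr_ge0 ?cabs_ge0.
  rewrite -[leLHS]mulrA -!expRD ler_wpM2l ?M0// ler_expR -/z /B /dJ /dK.
  rewrite le_eqVlt; apply/orP; left; apply/eqP.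
  by case: eqP => _; case: eqP => _ /=; rewrite /b; field.
rewrite cabsM.
have h2 : cabs (\prod_(1 <= j < n) \prod_(m < nu j) \prod_(m' < nu j | (m < m')%N)
     sh (ofR a * (permute_all s g j m' - permute_all s g j m - iR (2 * pi / n%:R)))) <=
   expR (a / 2 * \sum_(1 <= j < n) self_dist nu (re g) j).
  rewrite mulr_sumr; apply: cabs_prod_le => j _.
  apply: le_trans; first by apply: cabs_sh_self; exact: ltW.
  rewrite ler_expR.
  by rewrite (self_dist_rearranges _ (rearranges_permute_all s g)) mulrCA mulrC.
apply: (le_trans (ler_pM (cabs_ge0 _) (cabs_ge0 _) h1 h2)).
rewrite -[leLHS]mulrA -expRD ler_wpM2l// ler_expR sumrB; lra.
Qed.

End Proposition.

Theorem proposition2 (R : realType) (n N : nat) (rho : R) (nu : nat -> nat)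
    (beta : nat -> R[i])
    (hn : (2 <= n)%N) (hN : (1 <= N)%N) (hrho : 0 < rho)
    (hnu0 : nu 0%N = N) (hnun : nu n = 0%N)
    (hmono : forall j : nat, (j < n)%N -> (nu j.+1 <= nu j)%N)
    (hconv : forall j : nat, (1 <= j <= n.-1)%N ->
       (2 * nu j <= nu j.-1 + nu j.+1)%N) :
  (* one system of contours for the whole integrand *)
  (forall (w W : gammas R -> R[i]) (C : contours R),
     in_F n N nu rho w -> in_W n N nu W ->
     contour_system n nu rho beta (fun _ _ _ => phi n rho) C ->
     abs_convergent n nu beta C (integrand n nu rho w W))
  /\
  (* contours chosen term by term, with respect to the poles of each term *)
  (forall (J K : {ffun 'I_N -> 'I_n}) (s s' : forall j : nat, 'S_(nu j))
          (C : contours R),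
     inZ nu J -> inZ nu K ->
     contour_system n nu rho beta
       (fun j m m' z => phi n rho z * pair_factor (pi / rho) J s j m m' z
                        * pair_factor (n%:R / 4) K s' j m m' z) C ->
     abs_convergent n nu beta C
       (integrand n nu rho
          (fun g => g_small nu rho J (permute_all s g))
          (fun g => G_big nu K (permute_all s' g)))).
Proof.
split=> [w W C wF WW CS|J K s s' C JZ KZ CS].
  exact: (convergent_one_system hn hN hrho hnu0 hnun hconv wF WW CS).
exact: (convergent_term hn hN hrho hnu0 hnun hconv JZ KZ CS).
Qed.
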